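(* Fix a prime $p$ and integers $d$ and $n$ so that either $n\ge3$ and $d\ge6$, or $n\ge10$ and $d\ge5$. Let $F$ be the free group on $d$ generators and let $d_i$ be the rank of $F_i/F_{i+1}$. Then $$1\le\frac{|\mathfrak{A}_{d,n}|}{|\mathfrak{C}_{d,n}|}\le 1+C(p)^{n-1}D(p)^{n-2}p^{\,d_{n-1}-d_n/4+d^2}.$$
   Context: For a prime $p$ and a group $H$, the lower $p$-series $H=H_1\ge H_2\ge\cdots$ is defined by $H_{i+1}=H_i^p[H_i,H]$, where $H_i^p$ is the subgroup generated by the $p$-th powers of elements of $H_i$. For the free group $F$ on $d$ generators, $(F_i)$ denotes its lower $p$-series; $F_i/F_{i+1}$ is a finite elementary abelian $p$-group, and its rank is its dimension over $\mathbb{F}_p$. $\mathfrak{A}_{d,n}$ is the set of $\mathrm{Aut}(F/F_{n+1})$-orbits on the set $\mathcal{A}_{d,n}$ of normal subgroups of $F/F_{n+1}$ lying in $F_2/F_{n+1}$. $\mathfrak{C}_{d,n}$ is the set of $\mathrm{Aut}(F/F_{n+1})$-orbits on the set $\mathcal{C}_{d,n}$ of normal subgroups of $F/F_{n+1}$ lying in $F_n/F_{n+1}$. $C(q)=\sum_{r=-\infty}^{\infty}q^{-r^2}$ and $D(q)=\prod_{j=1}^{\infty}(1-q^{-j})^{-1}$. *)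

(* Defs.v *)
From HB Require Import structures.
From mathcomp Require Import all_boot all_order all_algebra all_fingroup.
From mathcomp Require Import all_solvable generic_quotient.
From mathcomp Require Import all_classical all_reals all_analysis.

Set Implicit Arguments.
Unset Strict Implicit.
Unset Printing Implicit Defensive.

Local Open Scope group_scope.
Local Open Scope quotient_scope.

(* The free group on d generators, as the group of reduced words: the letter  *)
(* (i, false) stands for the generator x_i and (i, true) for its inverse.     *)
Section FreeGroup.
Variable d : nat.

Notation letter := ('I_d * bool)%type.

Implicit Types (a b : letter) (u v w : seq letter).

Definition linv a : letter := (a.1, ~~ a.2).

Definition reduced w : bool := sorted (fun a b => b != linv a) w.

Definition cons_letter a w : seq letter :=
  if w is b :: w' then if b == linv a then w' else a :: w else [:: a].

Definition rmul u v : seq letter := foldr cons_letter v u.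

Definition rinv u : seq letter := rev (map linv u).

Lemma linvK : involutive linv.
Proof. by case=> i b; rewrite /linv /= negbK. Qed.

Lemma reduced_cons a w : reduced w -> reduced (cons_letter a w).
Proof.
case: w => //= b w rw; case: ifPn => [_|nb]; last by rewrite /= nb.
by case: w rw => //= c w /andP[].
Qed.

Lemma reduced_rmul u v : reduced v -> reduced (rmul u v).
Proof. by move=> rv; elim: u => //= a u; apply: reduced_cons. Qed.

Lemma cons_linv a w :
  reduced w -> cons_letter a (cons_letter (linv a) w) = w.
Proof.
case: w => [|b w] /=; first by rewrite eqxx.
rewrite linvK; case: eqVneq => [-> | nba] rw; last by rewrite /= eqxx.
case: w rw => //= c w /andP[nc _]; by rewrite (negPf nc).
Qed.

Lemma rmul_cons a u v : reduced v ->
  rmul (cons_letter a u) v = cons_letter a (rmul u v).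
Proof.
case: u => [|b u] //= rv; case: eqP => [->|//].
by rewrite cons_linv // reduced_rmul.
Qed.

Lemma rmulA u v w : reduced w -> rmul u (rmul v w) = rmul (rmul u v) w.
Proof. by move=> rw; elim: u => //= a u IH; rewrite rmul_cons // -IH. Qed.

Lemma rmul1 u : reduced u -> rmul u [::] = u.
Proof.
elim: u => //= a u IH; rewrite /reduced /= => pu.
rewrite IH; last by apply: path_sorted pu.
by case: u pu {IH} => //= b u /andP[/negPf->].
Qed.

Lemma rmulV u : rmul (rinv u) u = [::].
Proof.
elim: u => //= a u IH; rewrite /rinv /= rev_cons /rmul -cats1 foldr_cat /=.
by rewrite linvK eqxx.
Qed.

Lemma rinvK : involutive rinv.
Proof.
move=> u; rewrite /rinv map_rev revK -map_comp map_id_in // => a _.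
exact: linvK.
Qed.

Lemma reduced_rinv u : reduced u -> reduced (rinv u).
Proof.
rewrite /reduced /rinv rev_sorted sorted_map.
by apply: sub_sorted => a b /=; apply: contra => /eqP->; rewrite linvK.
Qed.

Definition freegroup : Type := {w : seq letter | reduced w}.

HB.instance Definition _ := [isSub of freegroup for @sval _ _].
HB.instance Definition _ := [Countable of freegroup by <:].

Implicit Types x y : freegroup.

Definition fmul x y : freegroup :=
  exist _ (rmul (val x) (val y)) (reduced_rmul (val x) (valP y)).
Definition fone : freegroup := exist _ [::] isT.
Definition finv x : freegroup := exist _ (rinv (val x)) (reduced_rinv (valP x)).

Lemma fmulA : associative fmul.
Proof. by move=> x y z; apply: val_inj; apply: rmulA (valP z). Qed.
Lemma fmul1g : left_id fone fmul.
Proof. by move=> x; apply: val_inj. Qed.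
Lemma fmulg1 : right_id fone fmul.
Proof. by move=> x; apply: val_inj; apply: rmul1 (valP x). Qed.
Lemma fmulVg : left_inverse fone finv fmul.
Proof. by move=> x; apply: val_inj; apply: rmulV. Qed.
Lemma fmulgV : right_inverse fone finv fmul.
Proof.
move=> x; apply: val_inj.
by have := rmulV (rinv (val x)); rewrite rinvK.
Qed.

HB.instance Definition _ :=
  isGroup.Build freegroup fmulA fmul1g fmulg1 fmulVg fmulgV.

Definition fletter a : freegroup := exist _ [:: a] isT.

Definition fgenerator (i : 'I_d) : freegroup := fletter (i, false).

Lemma freegroup_ind (P : freegroup -> Prop) :
  P 1 -> (forall a x, P x -> P (fletter a * x)) -> forall x, P x.
Proof.
move=> P1 PM [w rw]; elim: w rw => [|a w IH] rw.
  by rewrite (_ : exist _ _ _ = 1 :> freegroup) //; apply: val_inj.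
have rw' : reduced w by apply: path_sorted rw.
rewrite (_ : exist _ _ _ = fletter a * (exist _ w rw' : freegroup)); first exact: PM.
apply: val_inj => /=; rewrite /cons_letter.
by case: w rw rw' {IH} => //= b w /andP[/negPf->].
Qed.

End FreeGroup.

(* Subgroups of a possibly infinite group are predicates.                     *)
Section LowerPSeries.
Variables (G : groupType) (p : nat).
Implicit Types (S H K : G -> Prop) (x y z : G).

Inductive generated S : G -> Prop :=
| gen_one : generated S 1
| gen_mem x of S x : generated S x
| gen_mul x y of generated S x & generated S y : generated S (x * y)
| gen_inv x of generated S x : generated S x^-1.

Definition power_subgroup H : G -> Prop :=
  generated (fun x => exists2 y, H y & x = y ^+ p).

Definition commutator_subgroup H K : G -> Prop :=
  generated (fun x => exists y z, [/\ H y, K z & x = [~ y, z]]).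

Definition lower_p_step H : G -> Prop := fun x => exists y z,
  [/\ power_subgroup H y, commutator_subgroup H (fun=> True) z & x = y * z].

(* The series is indexed from 1; the value at index 0 is irrelevant.          *)
Definition lower_p_series (i : nat) : G -> Prop :=
  iter i.-1 lower_p_step (fun=> True).

Definition normal_subgroup H : Prop :=
  [/\ H 1, forall x y, H x -> H y -> H (x * y), forall x, H x -> H x^-1
    & forall x y, H x -> H (x ^ y)].

Lemma generated_normal S :
  (forall x y, S x -> S (x ^ y)) -> normal_subgroup (generated S).
Proof.
move=> SJ; split; [exact: gen_one | exact: gen_mul | exact: gen_inv |].
move=> x y; elim=> [|{}x Sx|{}x z _ IHx _ IHz|{}x _ IHx].
- by rewrite conj1g; apply: gen_one.
- by apply: gen_mem; apply: SJ.
- by rewrite conjMg; apply: gen_mul.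
- by rewrite conjVg; apply: gen_inv.
Qed.

Lemma lower_p_step_normal H : normal_subgroup H ->
  normal_subgroup (lower_p_step H).
Proof.
case=> _ _ _ HJ.
have [P1 PM PV PJ] : normal_subgroup (power_subgroup H).
  apply: generated_normal => _ y [x Hx ->]; exists (x ^ y); first exact: HJ.
  by rewrite conjXg.
have [C1 CM CV CJ] : normal_subgroup (commutator_subgroup H (fun=> True)).
  apply: generated_normal => _ y [x [z [Hx _ ->]]].
  by exists (x ^ y), (z ^ y); rewrite -conjRg; split=> //; apply: HJ.
split.
- by exists 1, 1; rewrite mulg1.
- move=> _ _ [x [x' [Px Cx ->]]] [y [y' [Py Cy ->]]].
  exists (x * y), (x' ^ y * y'); split; [exact: PM | by apply/CM/Cy/CJ |].
  by rewrite conjgE !mulgA mulgK.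
- move=> _ [x [x' [Px Cx ->]]]; exists x^-1, (x'^-1 ^ x^-1).
  split; [exact: PV | by apply/CJ/CV |].
  by rewrite conjgE invMg invgK !mulgA mulVg mul1g.
- move=> _ y [x [x' [Px Cx ->]]]; exists (x ^ y), (x' ^ y).
  by split; [exact: PJ | exact: CJ | rewrite conjMg].
Qed.

Lemma lower_p_series_normal i : normal_subgroup (lower_p_series i).
Proof.
by rewrite /lower_p_series; elim: i.-1 => //= k; apply: lower_p_step_normal.
Qed.

Lemma lower_p_seriesS i : (0 < i)%N ->
  lower_p_series i.+1 = lower_p_step (lower_p_series i).
Proof. by case: i. Qed.

Section Quotient.
Variable k : nat.

Let N := lower_p_series k.
Let N1 : N 1. Proof. by case: (lower_p_series_normal k). Qed.
Let NM x y : N x -> N y -> N (x * y).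
Proof. by case: (lower_p_series_normal k) => _ + _ _; apply. Qed.
Let NV x : N x -> N x^-1.
Proof. by case: (lower_p_series_normal k) => _ _ + _; apply. Qed.
Let NJ x y : N x -> N (x ^ y).
Proof. by case: (lower_p_series_normal k) => _ _ _; apply. Qed.

Definition lower_p_rel : rel G := fun x y => `[< lower_p_series k (x^-1 * y) >].

Lemma lower_p_rel_refl : reflexive lower_p_rel.
Proof. by move=> x; apply/asboolP; rewrite mulVg. Qed.
Lemma lower_p_rel_sym : symmetric lower_p_rel.
Proof.
move=> x y; apply/asboolP/asboolP => /NV; by rewrite invMg invgK.
Qed.
Lemma lower_p_rel_trans : transitive lower_p_rel.
Proof.
move=> y x z /asboolP xy /asboolP yz; apply/asboolP.
by have := NM xy yz; rewrite mulgA mulgK.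
Qed.

Canonical lower_p_equiv :=
  EquivRel lower_p_rel lower_p_rel_refl lower_p_rel_sym lower_p_rel_trans.

Definition lower_p_quo : Type := {eq_quot lower_p_equiv}.

HB.instance Definition _ := Choice.on lower_p_quo.
HB.instance Definition _ := EqQuotient.on lower_p_quo.

Definition lower_p_proj x : lower_p_quo := \pi_lower_p_quo x.

Lemma lower_p_projP x y :
  reflect (lower_p_proj x = lower_p_proj y) (lower_p_rel x y).
Proof. exact: eqmodP. Qed.

Lemma lower_p_proj_repr (q : lower_p_quo) : lower_p_proj (repr q) = q.
Proof. exact: reprK. Qed.

Lemma lower_p_repr_proj x : N ((repr (lower_p_proj x))^-1 * x).
Proof.
by apply/asboolP; apply/lower_p_projP; rewrite lower_p_proj_repr.
Qed.

Definition quo_mul (q r : lower_p_quo) := lower_p_proj (repr q * repr r).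
Definition quo_one := lower_p_proj 1.
Definition quo_inv (q : lower_p_quo) := lower_p_proj (repr q)^-1.

Lemma quo_mulE x y :
  quo_mul (lower_p_proj x) (lower_p_proj y) = lower_p_proj (x * y).
Proof.
apply/lower_p_projP/asboolP.
have := NM (NJ y (lower_p_repr_proj x)) (lower_p_repr_proj y).
move/(NJ (y^-1 * repr (lower_p_proj y))).
by rewrite !conjgE !invMg !invgK !mulgA !mulgK mulgKV.
Qed.

Lemma quo_invE x : quo_inv (lower_p_proj x) = lower_p_proj x^-1.
Proof.
apply/lower_p_projP/asboolP; rewrite invgK.
have := NV (NJ x^-1 (lower_p_repr_proj x)).
by rewrite conjgE !invMg !invgK !mulgA mulgV mul1g.
Qed.

Lemma quo_mulA : associative quo_mul.
Proof.
move=> q r s; rewrite -(lower_p_proj_repr q) -(lower_p_proj_repr r).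
by rewrite -(lower_p_proj_repr s) !quo_mulE mulgA.
Qed.
Lemma quo_mul1g : left_id quo_one quo_mul.
Proof. by move=> q; rewrite -(lower_p_proj_repr q) quo_mulE mul1g. Qed.
Lemma quo_mulg1 : right_id quo_one quo_mul.
Proof. by move=> q; rewrite -(lower_p_proj_repr q) quo_mulE mulg1. Qed.
Lemma quo_mulVg : left_inverse quo_one quo_inv quo_mul.
Proof. by move=> q; rewrite -(lower_p_proj_repr q) quo_invE quo_mulE mulVg. Qed.
Lemma quo_mulgV : right_inverse quo_one quo_inv quo_mul.
Proof. by move=> q; rewrite -(lower_p_proj_repr q) quo_invE quo_mulE mulgV. Qed.

HB.instance Definition _ := isGroup.Build lower_p_quo
  quo_mulA quo_mul1g quo_mulg1 quo_mulVg quo_mulgV.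

Lemma lower_p_projM : {morph lower_p_proj : x y / x * y}.
Proof. by move=> x y; rewrite -quo_mulE. Qed.

HB.instance Definition _ := isMultiplicative.Build G lower_p_quo
  lower_p_proj lower_p_projM.

Lemma lower_p_proj1 : lower_p_proj 1 = 1.
Proof. by []. Qed.

Lemma lower_p_projV : {morph lower_p_proj : x / x^-1}.
Proof. by move=> x; rewrite -quo_invE. Qed.

Lemma lower_p_projX m : {morph lower_p_proj : x / x ^+ m}.
Proof.
by move=> x; elim: m => // m IH; rewrite !expgS lower_p_projM IH.
Qed.

Lemma lower_p_proj_eq1 x : lower_p_proj x = 1 <-> N x.
Proof.
split=> [/esym/lower_p_projP/asboolP | Nx]; first by rewrite invg1 mul1g.
by apply/esym/lower_p_projP/asboolP; rewrite invg1 mul1g.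
Qed.

End Quotient.

End LowerPSeries.

Section Finiteness.

Lemma finite_extension (Q : groupType) (p : nat) (X T : seq Q) (H : Q -> Prop) :
    (0 < p)%N -> H 1 -> (forall x y, H x -> H y -> H (x * y)) ->
    (forall x, H x -> H x^-1) -> (forall x y, H x -> commute x y) ->
    (forall x, H x -> x ^+ p = 1) ->
    (forall g, exists2 t, t \in T & H (t^-1 * g)) ->
    (forall P : Q -> Prop, P 1 -> (forall x g, x \in X -> P g -> P (x * g)) ->
       forall g, P g) ->
  exists l : seq Q, forall g, g \in l.
Proof.
move=> p0 H1 HM HV HZ HX HT Xind.
have [r rP] : exists r : Q -> Q, forall g, r g \in T /\ H ((r g)^-1 * g).
  by exists (fun g => s2val (cid2 (HT g))) => g; case: (cid2 (HT g)).
pose B := fix B (s : seq Q) : seq Q :=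
  if s is x :: s' then [seq x ^+ a * y | a <- iota 0 p, y <- B s'] else [:: 1].
have B1 s : 1 \in B s.
  elim: s => [|x s IH]; first by rewrite inE.
  apply/allpairsP; exists (0%N, 1) => /=; split=> //; last by rewrite mulg1.
  by rewrite mem_iota.
have BM s : (forall x, x \in s -> H x) ->
    forall x y, x \in s -> y \in B s -> x * y \in B s.
  elim: s => [//|z s IH] Hs x y xs /allpairsP[[a y'] /= [ap y's ->]].
  have Hz : H z by apply: Hs; rewrite inE eqxx.
  move: xs; rewrite inE => /orP[/eqP->|xs]; last first.
    have zx : commute (z ^+ a) x by apply/commute_sym/commuteX/commute_sym/HZ.
    rewrite mulgA -zx -mulgA; apply/allpairsP; exists (a, x * y') => /=.
    by split=> //; apply: IH => // w ws; apply: Hs; rewrite inE ws orbT.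
  rewrite mulgA -expgS; move: ap; rewrite mem_iota add0n /= => ap.
  have [apE|apE] := eqVneq a.+1 p.
    rewrite apE HX // mul1g; apply/allpairsP; exists (0%N, y').
    by rewrite mem_iota /= mul1g.
  apply/allpairsP; exists (a.+1, y') => /=; split=> //.
  by rewrite mem_iota add0n /= ltn_neqAle apE.
pose S := [seq (r (x * t))^-1 * (x * t) | x <- X, t <- T].
have HS s : s \in S -> H s.
  by case/allpairsP => -[x t] /= [_ _ ->]; case: (rP (x * t)).
exists [seq t * z * (r 1)^-1 | t <- T, z <- B S].
have key g : exists t z, [/\ t \in T, z \in B S & g = t * z * (r 1)^-1].
  elim/Xind: g => [|x g xX [t [z [tT zB ->]]]].
    exists (r 1), 1; split=> //; first by case: (rP 1).
    by rewrite mulg1 mulgV.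
  have sS : (r (x * t))^-1 * (x * t) \in S.
    by apply/allpairsP; exists (x, t).
  exists (r (x * t)), ((r (x * t))^-1 * (x * t) * z); split.
  - by case: (rP (x * t)).
  - exact: BM.
  - by rewrite !mulgA mulgV mul1g.
move=> g; have [t [z [tT zB ->]]] := key g.
by apply/allpairsP; exists (t, z).
Qed.

Variables (d p : nat).
Let F := freegroup d.

Lemma lower_p_central k (x y : F) : (0 < k)%N -> lower_p_series p k x ->
  lower_p_series p k.+1 [~ x, y].
Proof.
move=> k0 Fx; rewrite lower_p_seriesS //; exists 1, [~ x, y].
rewrite mul1g; split=> //; first exact: gen_one.
by apply: gen_mem; exists x, y.
Qed.

Lemma lower_p_power k (x : F) : (0 < k)%N -> lower_p_series p k x ->
  lower_p_series p k.+1 (x ^+ p).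
Proof.
move=> k0 Fx; rewrite lower_p_seriesS //; exists (x ^+ p), 1.
rewrite mulg1; split=> //; last exact: gen_one.
by apply: gen_mem; exists x.
Qed.

Lemma lower_p_quo_finite k : (0 < p)%N ->
  exists l : seq (lower_p_quo F p k), forall q, q \in l.
Proof.
move=> p0; elim: k => [|k [l lP]].
  exists [:: 1] => q; rewrite inE -(lower_p_proj_repr q); apply/eqP.
  exact/lower_p_proj_eq1.
case: k l lP => [|k] l lP.
  exists [:: 1] => q; rewrite inE -(lower_p_proj_repr q); apply/eqP.
  exact/lower_p_proj_eq1.
pose pi := @lower_p_proj F p k.+2.
pose H (q : lower_p_quo F p k.+2) :=
  exists2 x, lower_p_series p k.+1 x & q = pi x.
have [N1 NM NV NJ] := lower_p_series_normal F p k.+1.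
apply: (@finite_extension _ p [seq pi (fletter a) | a <- enum {: 'I_d * bool}]
  [seq pi (repr q) | q <- l] H) => //.
- by exists 1.
- move=> _ _ [x Nx ->] [y Ny ->]; exists (x * y); first exact: NM.
  by rewrite /pi lower_p_projM.
- move=> _ [x Nx ->]; exists x^-1; first exact: NV.
  by rewrite /pi lower_p_projV.
- move=> _ y [x Nx ->]; rewrite -(lower_p_proj_repr y).
  rewrite /commute -!lower_p_projM; apply/esym/lower_p_projP/asboolP.
  by have := lower_p_central (repr y) (ltn0Sn _) Nx; rewrite invMg -mulgA.
- move=> _ [x Nx ->]; rewrite /pi -lower_p_projX; apply/lower_p_proj_eq1.
  exact: lower_p_power.
- move=> g; pose q := lower_p_proj p k.+1 (repr g).
  exists (pi (repr q)); first exact: map_f.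
  exists ((repr q)^-1 * repr g); first exact: lower_p_repr_proj.
  by rewrite /pi lower_p_projM lower_p_projV lower_p_proj_repr.
- move=> P P1 PM g; rewrite -(lower_p_proj_repr g).
  elim/freegroup_ind: (repr g) => [|a x Px]; first by rewrite lower_p_proj1.
  by rewrite lower_p_projM; apply: PM => //; apply/map_f; rewrite mem_enum.
Qed.

End Finiteness.

(* F / F_k, for F the free group on d generators; p_pr only serves to make    *)
(* the finite group instance below canonical.                                 *)
Definition free_quo (d p : nat) (p_pr : prime p) (k : nat) : Type :=
  lower_p_quo (freegroup d) p k.

Section FreeQuotient.
Variables (d p : nat) (p_pr : prime p) (k : nat).

Local Notation Q := (free_quo d p_pr k).

HB.instance Definition _ := Group.on Q.
HB.instance Definition _ :=
  Countable.copy Q (can_type (@lower_p_proj_repr (freegroup d) p k)).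

Let elements : seq Q :=
  undup (projT1 (cid (lower_p_quo_finite d k (prime_gt0 p_pr)))).

Lemma free_quo_enumP : Finite.axiom elements.
Proof.
move=> q; rewrite count_uniq_mem ?undup_uniq // mem_undup.
by case: cid => l lP /=; rewrite lP.
Qed.

HB.instance Definition _ := fintype.isFinite.Build Q free_quo_enumP.

Definition free_proj : freegroup d -> Q := @lower_p_proj (freegroup d) p k.

HB.instance Definition _ := isUMagmaMorphism.Build (freegroup d) Q free_proj
  (@lower_p_proj1 (freegroup d) p k, @lower_p_projM (freegroup d) p k).

End FreeQuotient.

Section Sections.
Variables (d p : nat) (p_pr : prime p).

(* F_i / F_k as a subset of F / F_k (meaningful for i <= k).                  *)
Definition lower_p_section k i : {set free_quo d p_pr k} :=
  [set q : free_quo d p_pr k |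
    `[< exists2 x, lower_p_series p i x & q = free_proj p_pr k x >]].

Lemma lower_p_sectionP k i (q : free_quo d p_pr k) :
  reflect (exists2 x, lower_p_series p i x & q = free_proj p_pr k x)
          (q \in lower_p_section k i).
Proof. by rewrite inE; apply: asboolP. Qed.

Lemma lower_p_section_group_set k i : group_set (lower_p_section k i).
Proof.
have [N1 NM _ _] := lower_p_series_normal (freegroup d) p i.
apply/group_setP; split; first by apply/lower_p_sectionP; exists 1.
move=> _ _ /lower_p_sectionP[x Nx ->] /lower_p_sectionP[y Ny ->].
by apply/lower_p_sectionP; exists (x * y); [apply: NM | rewrite gmulfM].
Qed.

Canonical lower_p_section_group k i := Group (lower_p_section_group_set k i).

Lemma lower_p_section_abelem i : (0 < i)%N ->
  p.-abelem (lower_p_section i.+1 i).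
Proof.
move=> i0; apply/(abelemP p_pr); split.
  apply/centsP => _ /lower_p_sectionP[x Nx ->] _ /lower_p_sectionP[y Ny ->].
  rewrite /commute -!gmulfM; apply/esym/lower_p_projP/asboolP.
  by have := lower_p_central y i0 Nx; rewrite invMg -mulgA.
move=> _ /lower_p_sectionP[x Nx ->].
rewrite -gmulfXn; apply/lower_p_proj_eq1.
exact: lower_p_power.
Qed.

(* F_i / F_(i+1) is elementary abelian, so its p-rank is its F_p-dimension.   *)
Definition lower_p_rank i : nat := 'r_p(lower_p_section i.+1 i).

Lemma lower_p_rankE i : (0 < i)%N ->
  lower_p_rank i = logn p #|lower_p_section i.+1 i|.
Proof. by move=> i0; apply/p_rank_abelem/lower_p_section_abelem. Qed.

End Sections.

Definition normal_subgroups_in (gT : finGroupType) (L : {set gT}) :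
    {set {set gT}} :=
  [set N : {set gT} | [&& group_set N, normal N [set: gT] & N \subset L]].

Definition aut_orbits (gT : finGroupType) (S : {set {set gT}}) :
    {set {set {set gT}}} :=
  [set orbit 'P^* (Aut [set: gT]) N | N : {set gT} in S].

Definition orbits_A d n p (p_pr : prime p) :=
  aut_orbits (normal_subgroups_in (lower_p_section d p_pr n.+1 2)).

Definition orbits_C d n p (p_pr : prime p) :=
  aut_orbits (normal_subgroups_in (lower_p_section d p_pr n.+1 n)).

Local Close Scope group_scope.
Local Open Scope ring_scope.
Import Order.TTheory GRing.Theory Num.Theory.
Import numFieldNormedType.Exports.

Definition theta_sum (R : realType) (q : R) : R :=
  fine (\esum_(r in [set: int]%classic) (q ^ (- r ^+ 2))%:E).

Definition euler_prod (R : realType) (q : R) : R :=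
  limn (fun m : nat => \prod_(1 <= j < m.+1) (1 - q ^- j)^-1).

(* Main.v *)
Require Import Defs.
From HB Require Import structures.
From mathcomp Require Import boolp functions.
From mathcomp Require Import all_boot all_order all_algebra all_fingroup.
From mathcomp Require Import all_solvable mxabelem.
From mathcomp Require Import zify lra.

Set Implicit Arguments.
Unset Strict Implicit.
Unset Printing Implicit Defensive.
Import GRing.Theory.

(** Let G be the quotient of the free group F by the term of index n+1 of its
    lower p-series, G_i the image of the i-th term and d_i the dimension of
    G_i / G_(i+1).

    Let A and C be the sets of the normal subgroups of G inside G_2 and inside
    G_n. The members of C are the subspaces of the central layer G_n, so there
    are roughly p ^ (d_n ^ 2 / 4) of them at least. Automorphisms of G act on
    G_n through their action on G / G_2, because every layer is obtained from
    the preceding one by brackets and p-th powers ([aut_agree_layer]); so an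
    orbit in C has at most p ^ (d ^ 2) elements ([card_central_orbit]). As the
    two constants C(p) and D(p) are at least 1 ([theta_sum_ge1],
    [euler_prod_ge1]), it suffices that the members of A that are not in C
    number at most p ^ (d_(n-1) - d_n / 4) times the members of C
    ([card_noncentral_free]).

    To count them, build a normal subgroup N one layer at a time. If N has
    dimension u on the layer k-1, then the brackets and the p-th powers of its
    elements force a subspace of dimension at least 5u/2 on the layer k
    ([forced_growth]), which leaves few choices for the trace V of N on the
    layer k. Once V and the product M of N and G_k are known, N is given by at
    most u cosets of V in G_k, since M is generated by u elements modulo a
    subgroup that N has to contain ([card_fibre]). Hence there are at most p ^
    (u (d_k + 1)) normal subgroups between G_(k+1) and G_2 that have dimension
    u on the layer k ([card_inner_layer]). At the layer n the forced subspace
    makes the exponent drop by about 3 u d_n / 4, while the choices made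
    before contribute at most u (d_(n-1) + 1), where d_(n-1) is at most 2 d_n
    / 5 ([card_noncentral]).

    The growth by a factor d/2 from a layer to the next ([growth]) is read off
    the Magnus embedding, which sends the i-th generator to 1 + X_i in the
    noncommutative power series over the integers. Filter the series by the
    powers of the ideal generated by p and the variables. The symbols of the
    elements of G_i then embed G_i / G_(i+1) in the functions from the words
    of length at most i to the field with p elements ([gsym_inj]): Lazard
    elimination provides basic commutators with pairwise distinct leading
    words ([lcn_basis]), and the p-power iterates of these span the layer
    ([section_span]). Every subgroup thus has as many dimensions on a layer as
    leading words ([card_leads]). Bracketing an element of leading word w with
    the letter l gives the lesser of wl and lw as leading word, unless w is a
    power of l; such a power never leads when its length is at least two
    ([sym_const]), and if w is l itself then the p-th power map keeps w as a
    leading word. Every word of the next layer arises in this way at most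
    twice. *)

(** * Words and their orders *)

Section Words.
Variable d : nat.
Implicit Types (u v w s t : seq 'I_d) (x y : 'I_d).

Fixpoint lex u v : bool :=
  match u, v with
  | x :: u', y :: v' => (x < y) || (x == y) && lex u' v'
  | [::], _ :: _ => true
  | _, [::] => false
  end.

Lemma lex_irr u : lex u u = false.
Proof. by elim: u => //= x u ->; rewrite ltnn andbF. Qed.

Lemma lex_trans : transitive lex.
Proof.
move=> v u w; elim: u v w => [|x u IH] [|y v] [|z w] //=.
case/orP => [xy|/andP[/eqP<- uv]] /orP[yz|/andP[/eqP<- vw]].
- by rewrite (ltn_trans xy yz).
- by rewrite xy.
- by rewrite yz.
- by rewrite eqxx (IH _ _ uv vw) orbT.
Qed.

Lemma lex_total u v : u != v -> lex u v || lex v u.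
Proof.
elim: u v => [|x u IH] [|y v] //=; rewrite eqseq_cons negb_and.
case: (ltngtP x y) => //= [_|/ord_inj<-]; rewrite ?orbT //; rewrite eqxx /=; exact: IH.
Qed.

Lemma lex_asym u v : lex u v -> lex v u = false.
Proof. by move=> uv; apply/negP => /(lex_trans uv); rewrite lex_irr. Qed.

Lemma lex_cat2l w u v : lex (w ++ u) (w ++ v) = lex u v.
Proof. by elim: w => //= x w ->; rewrite ltnn eqxx. Qed.

(** Neither word being a prefix of the other, the comparison is decided at a
    letter, and what follows does not matter. *)
Lemma lex_cat u v s t : lex u v -> ~~ prefix u v -> lex (u ++ s) (v ++ t).
Proof.
elim: u v => [|x u IH] [|y v] //=; case/orP => [-> //|/andP[/eqP<- uv]].
by rewrite eqxx /= => npuv; rewrite IH ?orbT.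
Qed.

Lemma prefix_eq_size u v : prefix u v -> size v <= size u -> u = v.
Proof.
case/prefixP => t ->; rewrite size_cat -[X in _ <= X]addn0 leq_add2l leqn0.
by move/nilP->; rewrite cats0.
Qed.

Lemma lex_cat_size u v s t :
  size u = size v -> lex u v -> lex (u ++ s) (v ++ t).
Proof.
move=> eq_uv uv; apply: lex_cat => //; apply/negP => /prefix_eq_size uvE.
by move: uv; rewrite uvE ?eq_uv // lex_irr.
Qed.

(** Shorter words come first: a word has finitely many predecessors, and the
    order is compatible with concatenation, so that leading words of series
    are multiplicative. *)
Definition wlt u v := (size u < size v) || (size u == size v) && lex u v.

Lemma wlt_irr u : wlt u u = false.
Proof. by rewrite /wlt ltnn lex_irr andbF. Qed.

Lemma wlt_trans : transitive wlt.
Proof.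
rewrite /wlt => v u w /orP[uv|/andP[/eqP-> uv]] /orP[vw|/andP[/eqP<- vw]].
- by rewrite (ltn_trans uv vw).
- by rewrite uv.
- by rewrite vw.
- by rewrite eqxx (lex_trans uv vw) orbT.
Qed.

Lemma wlt_total u v : u != v -> wlt u v || wlt v u.
Proof. by rewrite /wlt => /lex_total; case: ltngtP. Qed.

Lemma wlt_asym u v : wlt u v -> wlt v u = false.
Proof. by move=> uv; apply/negP => /(wlt_trans uv); rewrite wlt_irr. Qed.

Lemma wlt_size u v : wlt u v -> size u <= size v.
Proof. by case/orP => [/ltnW|/andP[/eqP->]]. Qed.

Lemma size_wlt u v : ~~ wlt u v -> size v <= size u.
Proof. by rewrite /wlt negb_or -leqNgt => /andP[]. Qed.

Lemma wlt_nil u : wlt u [::] = false.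
Proof. by case: u. Qed.

(** The cuts of the two words may be at different places: if the lengths
    allow a strict inequality at all, then they agree piece by piece. *)
Lemma wlt_cat u v s t :
  ~~ wlt s u -> ~~ wlt t v -> ~~ wlt (s ++ t) (u ++ v).
Proof.
move=> nsu ntv; have [us vt] := (size_wlt nsu, size_wlt ntv).
rewrite {1}/wlt negb_or !size_cat -leqNgt leq_add //=.
apply/andP => -[/eqP eq_sz lst].
have [eus evt] : size u = size s /\ size v = size t by lia.
have [E|su] := eqVneq s u.
  by move: lst ntv; rewrite E lex_cat2l /wlt evt eqxx => ->; rewrite orbT.
have /orP[lsu|lus] := lex_total su.
  by move: nsu; rewrite /wlt lsu eus eqxx orbT.
by have := lex_asym (lex_cat_size v t eus lus); rewrite lst.
Qed.

Fixpoint words m : seq (seq 'I_d) :=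
  if m is m'.+1 then [::] :: [seq x :: w | x <- enum 'I_d, w <- words m']
  else [:: [::]].

Lemma words_uniq m : uniq (words m).
Proof.
elim: m => //= m us; apply/andP; split.
  by apply/allpairsP => -[[]] ? ? [].
apply: allpairs_uniq; rewrite ?enum_uniq //.
by move=> [x w] [y v] _ _ [-> ->].
Qed.

Lemma mem_words m w : (w \in words m) = (size w <= m).
Proof.
elim: m w => [|m IH] [|x w] //=; rewrite inE //= ltnS -IH.
apply/allpairsP/idP => [[[y v]] /= [_ vs [_ ->]] //|ws].
by exists (x, w); rewrite mem_enum.
Qed.

End Words.

Arguments words d m : clear implicits.

(** * Noncommutative power series over the integers *)

Local Open Scope ring_scope.

Definition ser (d : nat) : Type := seq 'I_d -> int.

HB.instance Definition _ (d : nat) :=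
  GRing.Zmodule.copy (ser d) (seq 'I_d -> int).

Section Series.
Variable d : nat.
Implicit Types (f g h : ser d) (u v w s t : seq 'I_d) (x y : 'I_d).

Definition shift x f : ser d := fun w => f (x :: w).

(** The Cauchy product, by recursion on the word: either the left factor
    takes no letter at all, or it takes the first one. *)
Fixpoint smul f g w : int :=
  f [::] * g w + (if w is x :: w' then smul (shift x f) g w' else 0).

Definition sone : ser d := fun w => (w == [::])%:R.

Lemma smulE f g w :
  smul f g w = \sum_(i < (size w).+1) f (take i w) * g (drop i w).
Proof.
elim: w f => [|x w IH] f /=; first by rewrite big_ord1 addr0.
by rewrite big_ord_recl IH.
Qed.

Lemma smulDl f1 f2 g w : smul (f1 + f2) g w = smul f1 g w + smul f2 g w.
Proof.
by rewrite !smulE -big_split; apply: eq_bigr => i _; apply: mulrDl.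
Qed.

Lemma smulDr f g1 g2 w : smul f (g1 + g2) w = smul f g1 w + smul f g2 w.
Proof.
by rewrite !smulE -big_split; apply: eq_bigr => i _; apply: mulrDr.
Qed.

Lemma smulZl (c : int) f g w : smul (fun v => c * f v) g w = c * smul f g w.
Proof.
by rewrite !smulE big_distrr; apply: eq_bigr => i _; rewrite -mulrA.
Qed.

Lemma smulA : associative (@smul : ser d -> ser d -> ser d).
Proof.
move=> f g h; apply/funext => w; elim: w f g => [|x w IH] f g /=.
  by rewrite !addr0 mulrA.
rewrite addr0 mulrDr mulrA -addrA; congr (_ + _).
rewrite (_ : shift x (smul f g)
  = (fun v => f [::] * shift x g v : int) + smul (shift x f) g :> ser d) //.
by rewrite smulDl smulZl IH.
Qed.

Lemma smul1s : left_id sone (@smul : ser d -> ser d -> ser d).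
Proof.
move=> f; apply/funext => w; rewrite smulE big_ord_recl take0 drop0 /sone eqxx.
rewrite mul1r big1 ?addr0 // => i _; case: w i => [[]|x w i] //.
by rewrite /= mul0r.
Qed.

Lemma smuls1 : right_id sone (@smul : ser d -> ser d -> ser d).
Proof.
move=> f; apply/funext => w; rewrite smulE big_ord_recr take_size drop_size.
rewrite /= /sone eqxx mulr1 big1 ?add0r // => i _.
by rewrite -size_eq0 size_drop subn_eq0 leqNgt ltn_ord mulr0.
Qed.

Lemma smulDl_fun : left_distributive (@smul : ser d -> ser d -> ser d) +%R.
Proof. by move=> f g h; apply/funext => w; rewrite smulDl. Qed.

Lemma smulDr_fun : right_distributive (@smul : ser d -> ser d -> ser d) +%R.
Proof. by move=> f g h; apply/funext => w; rewrite smulDr. Qed.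

Lemma sone_neq0 : sone != 0 :> ser d.
Proof. by apply/eqP => /(congr1 (fun f : ser d => f [::])). Qed.

HB.instance Definition _ := GRing.Zmodule_isNzRing.Build (ser d)
  smulA smul1s smuls1 smulDl_fun smulDr_fun sone_neq0.

Lemma serM f g w :
  (f * g) w = \sum_(i < (size w).+1) f (take i w) * g (drop i w).
Proof. exact: smulE. Qed.

Lemma serM_nil f g : (f * g) [::] = f [::] * g [::].
Proof. by rewrite serM big_ord1. Qed.

Lemma ser1 w : (1 : ser d) w = (w == [::])%:R. Proof. by []. Qed.
Lemma serD f g w : (f + g) w = f w + g w. Proof. by []. Qed.
Lemma serN f w : (- f) w = - f w. Proof. by []. Qed.
Lemma serB f g w : (f - g) w = f w - g w. Proof. by []. Qed.
Lemma ser0 w : (0 : ser d) w = 0. Proof. by []. Qed.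
Lemma serMn f k w : (f *+ k) w = f w *+ k.
Proof. by elim: k => [|k IH]; rewrite ?mulr0n ?ser0 // !mulrS serD IH. Qed.

Definition var x : ser d := fun w => (w == [:: x])%:R.

Lemma varM_nil x f : (var x * f) [::] = 0.
Proof. by rewrite serM_nil mul0r. Qed.

Lemma varM_cons x f y w : (var x * f) (y :: w) = (y == x)%:R * f w.
Proof.
rewrite serM !big_ord_recl /= take0 drop0 {1 2}/var eqseq_cons andbT mul0r add0r.
rewrite big1 ?addr0 // => i _; case: w i => [[]|z w i] //.
by rewrite /= /var eqseq_cons andbF mul0r.
Qed.

Lemma Mvar_nil x f : (f * var x) [::] = 0.
Proof. by rewrite serM_nil mulr0. Qed.

Lemma Mvar_rcons x f w y : (f * var x) (rcons w y) = f w * (y == x)%:R.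
Proof.
rewrite serM size_rcons !big_ord_recr /=.
rewrite (_ : drop (size w).+1 _ = [::]); last first.
  by rewrite drop_oversize // size_rcons.
rewrite -cats1 take_size_cat // drop_size_cat // mulr0 addr0.
rewrite {2}/var eqseq_cons andbT big1 ?add0r // => i _.
rewrite /var [_ == [:: x]](_ : _ = false) ?mulr0 //.
apply/negP => /eqP /(congr1 size); rewrite size_drop size_cat /=.
by have := ltn_ord i; lia.
Qed.

End Series.

(** * The Magnus embedding *)

Lemma bracket_shift (R : pzRingType) (a b : R) :
  a * b - b * a = (1 + a) * (1 + b) - (1 + b) * (1 + a).
Proof.
have E (u v : R) : (1 + u) * (1 + v) = (1 + u + v) + u * v.
  by rewrite mulrDl mul1r mulrDr mulr1 addrA [1 + v + u]addrAC.
by rewrite !E [1 + b + a]addrAC opprD addrACA subrr add0r.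
Qed.

Section Magnus.
Variable d : nat.
Implicit Types (f g h : ser d) (u v w s t : seq 'I_d) (x y : freegroup d).

(** The inverse of [1 + var i], as a geometric series. *)
Definition var_inv (i : 'I_d) : ser d :=
  fun w => if all (pred1 i) w then (-1) ^+ size w else 0.

Definition mu_letter (a : 'I_d * bool) : ser d :=
  if a.2 then var_inv a.1 else 1 + var a.1.

Lemma var_invMl i : (1 + var i) * var_inv i = 1.
Proof.
apply/funext => -[|j w]; rewrite mulrDl mul1r serD ?varM_nil ?varM_cons //.
rewrite ser1 /var_inv /=; case: (j =P i) => _; last by rewrite mul0r addr0.
by rewrite mul1r /=; case: all; rewrite ?addr0 // exprS mulN1r addNr.
Qed.

Lemma var_invMr i : var_inv i * (1 + var i) = 1.
Proof.
apply/funext => w; rewrite mulrDr mulr1 serD.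
case/lastP: w => [|w j]; first by rewrite Mvar_nil.
rewrite Mvar_rcons ser1 -size_eq0 size_rcons /= /var_inv all_rcons /=.
case: (j =P i) => _; last by rewrite mulr0 addr0.
by rewrite mulr1 size_rcons; case: all; rewrite ?addr0 // exprS mulN1r addNr.
Qed.

Lemma mu_letterV a : mu_letter a * mu_letter (linv a) = 1.
Proof.
by case: a => i [] /=; rewrite /mu_letter /= ?var_invMl ?var_invMr.
Qed.

Definition mu x : ser d := foldr (fun a f => mu_letter a * f) 1 (val x).

Lemma muM x y : mu (x * y)%g = mu x * mu y.
Proof.
rewrite /mu /= /rmul; elim: (val x) => [|a u IH] /=; first by rewrite mul1r.
rewrite -mulrA -{}IH; case: (foldr _ _ u) => //= b w.
case: eqP => [->|//].
by rewrite mulrA mu_letterV mul1r.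
Qed.

Lemma muVM x : mu x^-1%g * mu x = 1.
Proof. by rewrite -muM mulVg. Qed.

Lemma mu_gen i : mu (fgenerator i) = 1 + var i.
Proof. by rewrite /mu /= mulr1. Qed.

Lemma mu_nil x : mu x [::] = 1.
Proof.
rewrite /mu; elim: (val x) => //= -[i b] u IH; rewrite serM_nil IH mulr1.
by case: b.
Qed.

End Magnus.

(** Locked, as unification would otherwise unfold products of series down to
    their coefficients. *)
HB.lock Definition nu (d : nat) (x : freegroup d) : ser d := mu x - 1.
Arguments nu {d} x.

Section Reduced.
Variable d : nat.
Implicit Types (x y : freegroup d).

Lemma nuE x : nu x = mu x - 1. Proof. by rewrite nu.unlock. Qed.

Lemma mu_nu x : mu x = 1 + nu x. Proof. by rewrite nuE addrC subrK. Qed.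

Lemma nu1 : nu (1%g : freegroup d) = 0. Proof. by rewrite nuE subrr. Qed.

Lemma nu_nil x : nu x [::] = 0.
Proof. by rewrite nuE serB mu_nil ser1 subrr. Qed.

Lemma nuM x y : nu (x * y)%g = nu x + nu y + nu x * nu y.
Proof.
rewrite nuE muM (mu_nu x) (mu_nu y) mulrDl mul1r mulrDr mulr1.
by rewrite addrAC [1 + nu y]addrC addrK addrA [nu y + _]addrC.
Qed.

Lemma nuM1 x y : nu (x * y)%g = nu x * mu y + nu y.
Proof. by rewrite nuM (mu_nu y) [nu x * (1 + _)]mulrDr mulr1 addrAC. Qed.

Lemma nuV x : nu x^-1%g = - (mu x^-1%g * nu x).
Proof. by rewrite !nuE mulrBr muVM mulr1 opprB. Qed.

(** A commutator agrees to first order with the additive bracket: the factor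
    in front has constant term 1. *)
Lemma nuR x y :
  nu [~ x, y]%g = mu x^-1%g * mu y^-1%g * (nu x * nu y - nu y * nu x).
Proof.
have -> : nu x * nu y - nu y * nu x = mu x * mu y - mu y * mu x.
  by rewrite (mu_nu x) (mu_nu y) -bracket_shift.
rewrite mulrBr (_ : _ * (mu y * mu x) = 1).
  by rewrite nuE commgEl conjgE !muM !mulrA.
by rewrite mulrA -(mulrA (mu x^-1%g)) muVM mulr1 muVM.
Qed.

(** All the terms of the binomial expansion beyond the linear one are
    collected in a multiple of [nu x * nu x], which lies in the square of
    the ideal where [nu x] lives. *)
Lemma nuX x k : exists c, nu (x ^+ k)%g = nu x *+ k + nu x * nu x * c.
Proof.
elim: k => [|k [c IH]]; first by exists 0; rewrite nu1 mulr0n mulr0 addr0.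
exists (c * mu x + k%:R); rewrite expgSr nuM1 IH.
have E : nu x *+ k * mu x = nu x *+ k + nu x * nu x * k%:R.
  by rewrite [mu x]mu_nu [_ *+ k * (1 + _)]mulrDr mulr1 mulrnAl mulr_natr.
rewrite mulrDl E [_ * (_ + k%:R)]mulrDr mulrA mulrS.
rewrite [nu x + nu x *+ k]addrC -(addrA (nu x *+ k)).
by rewrite [nu x * nu x * k%:R + _]addrC [LHS]addrAC.
Qed.

End Reduced.

(** * The filtration of the power series ring *)

Section Filtration.
Variables (d p : nat).
Implicit Types (f g h : ser d) (u v w s t : seq 'I_d) (x y : freegroup d).

(** The k-th power of the ideal generated by p and the variables. *)
Definition inI k f := forall w, (p%:Z ^+ (k - size w) %| f w)%Z.

Lemma inI_W k l f : (k <= l)%N -> inI l f -> inI k f.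
Proof. by move=> kl fl w; apply: dvdz_trans (fl w); apply: dvdz_exp2l; lia. Qed.

Lemma inI0 f : inI 0 f.
Proof. by move=> w; rewrite sub0n expr0 dvd1z. Qed.

Lemma inI_zero k : inI k 0.
Proof. by move=> w; rewrite ser0 dvdz0. Qed.

Lemma inI_D k f g : inI k f -> inI k g -> inI k (f + g).
Proof. by move=> If Ig w; rewrite serD; apply: rpredD; [apply: If|apply: Ig]. Qed.

Lemma inI_N k f : inI k f -> inI k (- f).
Proof. by move=> If w; rewrite serN rpredN; apply: If. Qed.

Lemma inI_B k f g : inI k f -> inI k g -> inI k (f - g).
Proof. by move=> If Ig; apply: inI_D => //; apply: inI_N. Qed.

Lemma inI_M k l f g : inI k f -> inI l g -> inI (k + l) (f * g).
Proof.
move=> If Ig w; rewrite serM; apply: rpred_sum => i _.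
apply: dvdz_trans (dvdz_mul (If _) (Ig _)); rewrite -exprD; apply: dvdz_exp2l.
have iw : (i <= size w)%N by rewrite -ltnS.
by rewrite size_takel // size_drop; lia.
Qed.

Lemma inI_Ml k f g : inI k g -> inI k (f * g).
Proof. by move=> Ig; have := inI_M (inI0 f) Ig. Qed.

Lemma inI_Mr k f g : inI k f -> inI k (f * g).
Proof. by move=> If; have := inI_M If (inI0 g); rewrite addn0. Qed.

Lemma inI_Mp k f : inI k f -> inI k.+1 (f *+ p).
Proof.
move=> If w; rewrite serMn -mulr_natr natz; apply: dvdz_trans (dvdz_mul (If w) (dvdzz _)).
by rewrite -exprSr; apply: dvdz_exp2l; lia.
Qed.

Definition magnus_dim k x := inI k (nu x).

Lemma dim1 k : magnus_dim k 1%g.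
Proof. by rewrite /magnus_dim nu1; apply: inI_zero. Qed.

Lemma dimM k x y : magnus_dim k x -> magnus_dim k y -> magnus_dim k (x * y)%g.
Proof. by move=> Dx Dy; rewrite /magnus_dim nuM1; apply/inI_D/Dy/inI_Mr. Qed.

Lemma dimV k x : magnus_dim k x -> magnus_dim k x^-1%g.
Proof. by move=> Dx; rewrite /magnus_dim nuV; apply/inI_N/inI_Ml. Qed.

Lemma dimR k l x y : magnus_dim k x -> magnus_dim l y -> magnus_dim (k + l) [~ x, y]%g.
Proof.
move=> Dx Dy; rewrite /magnus_dim nuR; apply/inI_Ml/inI_B; first exact: inI_M.
by rewrite addnC; apply: inI_M.
Qed.

(** The quadratic remainder of the p-th power has degree at least [2 * k],
    and this is where [k] has to be positive. *)
Lemma dimX k x : (0 < k)%N -> magnus_dim k x -> magnus_dim k.+1 (x ^+ p)%g.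
Proof.
move=> k0 Dx; rewrite /magnus_dim; have [c ->] := nuX x p.
apply: inI_D; first exact: inI_Mp.
by apply/inI_Mr/(inI_W _ (inI_M Dx Dx)); lia.
Qed.

Lemma dim_1 x : magnus_dim 1 x.
Proof. by case=> [|i w]; rewrite ?nu_nil ?dvdz0 //= expr0 dvd1z. Qed.

Lemma dim_generated k (S : freegroup d -> Prop) x :
  (forall y, S y -> magnus_dim k y) -> Defs.generated S x -> magnus_dim k x.
Proof.
move=> SD; elim=> {x} [|x /SD //|x y _ Dx _ Dy|x _ Dx].
- exact: dim1.
- exact: dimM.
- exact: dimV.
Qed.

(** Dimensions add up under commutators and grow by one under p-th powers,
    exactly as the indices of the lower p-series do. *)
Lemma lower_dim i x : (0 < i)%N -> lower_p_series p i x -> magnus_dim i x.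
Proof.
elim: i x => // -[|i] IH x _; first by move=> _; apply: dim_1.
rewrite lower_p_seriesS // => -[y [z [Py Cz ->]]]; apply: dimM.
  apply: dim_generated Py => _ [t Ft ->]; apply: dimX => //; exact: IH.
apply: dim_generated Cz => _ [t [s [Ft _ ->]]].
by rewrite -addn1; apply: dimR (dim_1 s); apply: IH.
Qed.

End Filtration.

(** * Symbols *)

Section Symbol.
Variables (d p : nat) (p_pr : prime p).
Implicit Types (f g h : ser d) (u v w s t : seq 'I_d) (x y : freegroup d).

(** The coefficient of [w] in the class of [nu x] modulo the (k+1)-st power of
    the ideal; this class is homogeneous of degree k when p itself is given
    degree one, hence the division. *)
Definition sym k x w : 'F_p := (nu x w %/ p%:Z ^+ (k - size w))%Z%:~R.

Local Lemma p_neq0 k : p%:Z ^+ k != 0.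
Proof. by rewrite expf_neq0 //; have := prime_gt0 p_pr; lia. Qed.

Lemma sym_eq0 k x w : magnus_dim p k x ->
  (sym k x w == 0) = (p%:Z ^+ (k - size w).+1 %| nu x w)%Z.
Proof.
move=> Dx; rewrite /sym -(dvdz_pcharf (pchar_Fp p_pr)).
by rewrite -{2}(divzK (Dx w)) exprS dvdz_mul2r ?p_neq0.
Qed.

Lemma sym_nil k x : sym k x [::] = 0.
Proof. by rewrite /sym nu_nil div0z. Qed.

Lemma sym_dimS k x w : (size w <= k)%N -> magnus_dim p k.+1 x -> sym k x w = 0.
Proof.
move=> wk Dx; apply/eqP; rewrite sym_eq0; last exact: inI_W Dx.
by have := Dx w; rewrite subSn.
Qed.

Lemma symM k x y w : (0 < k)%N -> (size w <= k)%N ->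
    magnus_dim p k x -> magnus_dim p k y ->
  sym k (x * y)%g w = sym k x w + sym k y w.
Proof.
move=> k0 wk Dx Dy; rewrite /sym nuM !serD.
have D2 : (p%:Z ^+ (k - size w).+1 %| (nu x * nu y)%R w)%Z.
  have := inI_M Dx Dy w; apply: dvdz_trans; apply: dvdz_exp2l; lia.
rewrite divzDl; last by apply: rpredD; [apply: Dx | apply: Dy].
rewrite divzDl; last exact: Dx.
rewrite !rmorphD /= -[RHS]addr0; congr (_ + _); apply/eqP.
rewrite -(dvdz_pcharf (pchar_Fp p_pr)).
have D1 : (p%:Z ^+ (k - size w) %| (nu x * nu y)%R w)%Z.
  by apply: dvdz_trans D2; apply: dvdz_exp2l; lia.
by rewrite -(dvdz_mul2r (p_neq0 (k - size w))) divzK // -exprS.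
Qed.

Lemma sym_congr k x y w : (0 < k)%N -> (size w <= k)%N -> magnus_dim p k x ->
  magnus_dim p k.+1 (x^-1 * y)%g -> sym k x w = sym k y w.
Proof.
move=> k0 wk Dx Dxy; rewrite -[y](mulKVg x) symM ?(sym_dimS _ Dxy) ?addr0 //.
exact: inI_W Dxy.
Qed.

(** Only words of length at most [k] are read. In degree [k = 1] this is
    what discards the quadratic remainder: its coefficients at the empty
    word and at the letters vanish because [nu x] has no constant term. *)
Lemma symX k x w : (0 < k)%N -> (size w <= k)%N -> magnus_dim p k x ->
  sym k.+1 (x ^+ p)%g w = sym k x w.
Proof.
move=> k0 wk Dx; rewrite /sym; have [c ->] := nuX x p.
rewrite serD serMn -mulr_natr natz subSn // exprSr.
have D2 : (p%:Z ^+ (k - size w).+1 * p %| (nu x * nu x * c)%R w)%Z.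
  case: k k0 wk Dx => [//|[|k]] _ wk Dx; last first.
    have := inI_Mr c (inI_M Dx Dx) w; apply: dvdz_trans.
    by rewrite -exprSr; apply: dvdz_exp2l; lia.
  case: w wk => [|i [|//]] _; rewrite serM ?big_ord1 ?big_ord_recl ?big_ord1 /=.
    by rewrite serM_nil nu_nil !mul0r dvdz0.
  rewrite serM_nil nu_nil !mul0r add0r serM !big_ord_recl big_ord0 /=.
  by rewrite !nu_nil mul0r mulr0 !addr0 mul0r add0r big_ord0 dvdz0.
have ppos : p%:Z != 0 by have := p_neq0 1; rewrite expr1.
rewrite divzDl; last by apply: dvdz_mul (Dx w) (dvdzz _).
rewrite (divzMr ppos (Dx w)).
rewrite rmorphD /= -[RHS]addr0; congr (_ + _); apply/eqP.
rewrite -(dvdz_pcharf (pchar_Fp p_pr)).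
have D1 : (p%:Z ^+ (k - size w) * p %| (nu x * nu x * c)%R w)%Z.
  by apply: dvdz_trans D2; rewrite exprS -mulrA dvdz_mull.
rewrite -(dvdz_mul2r (p_neq0 (k - size w).+1)) [X in (_ %| _ * X)%Z]exprSr divzK //.
by rewrite mulrC.
Qed.

Definition lmul_var (R : pzRingType) (i : 'I_d) (f : seq 'I_d -> R) w : R :=
  if w is j :: v then (j == i)%:R * f v else 0.

Definition rmul_var (R : pzRingType) (i : 'I_d) (f : seq 'I_d -> R) w : R :=
  if w is j :: v then (last j v == i)%:R * f (belast j v) else 0.

Lemma symR k x i w : (0 < k)%N -> (size w <= k.+1)%N -> magnus_dim p k x ->
  sym k.+1 [~ x, fgenerator i]%g w
    = rmul_var i (sym k x) w - lmul_var i (sym k x) w.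
Proof.
move=> k0 wk Dx; pose g := nu x * var i - var i * nu x.
have nug : nu (fgenerator i) = var i by rewrite nuE mu_gen addrC addKr.
have Ig : inI p k.+1 g.
  have Dv : inI p 1 (var i) by rewrite -nug; apply: dim_1.
  by apply: inI_B; [rewrite -addn1 | rewrite -add1n]; apply: inI_M.
have Ih : inI p k.+2 (nu [~ x, fgenerator i]%g - g).
  rewrite nuR nug -/g -[X in _ - X]mul1r -mulrBl -[k.+2]add1n.
  apply: inI_M Ig; have := dim_1 p (x^-1 * (fgenerator i)^-1)%g.
  by rewrite /magnus_dim nuE muM.
have -> : sym k.+1 [~ x, fgenerator i]%g w
    = (g w %/ p%:Z ^+ (k.+1 - size w))%Z%:~R.
  rewrite /sym -[nu _](subrK g) serD divzDr ?Ig // rmorphD /=.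
  rewrite -[RHS]add0r; congr (_ + _); apply/eqP.
  rewrite -(dvdz_pcharf (pchar_Fp p_pr)).
  rewrite -(dvdz_mul2r (p_neq0 (k.+1 - size w))) divzK -?exprS.
    by have := Ih w; rewrite subSn.
  exact: (inI_W _ Ih w).
case: w wk => [|j v] vk; first by rewrite /g serB varM_nil Mvar_nil div0z subr0.
rewrite /g serB varM_cons lastI Mvar_rcons -lastI /=.
rewrite subSS /sym size_belast divzDl; last by rewrite dvdz_mulr // -(size_belast j).
rewrite rmorphD /= mulrC; congr (_ + _).
  by case: eqP => _; rewrite ?mul1r ?mul0r ?div0z.
case: eqP => _; last by rewrite !mul0r oppr0 div0z oppr0.
by rewrite !mul1r -[- nu x v]mulN1r -mulz_divA ?Dx // mulN1r rmorphN.
Qed.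

End Symbol.

Local Close Scope ring_scope.
Local Open Scope group_scope.

(** * Lazard elimination in the lower central series *)

Section ThreeSubgroups.
Variables (gT : finGroupType) (G : {group gT}).

(** The three subgroup lemma of the quotient by [N]. *)
Lemma three_subgroup_normal (A B C N : {group gT}) :
    N <| G -> A \subset G -> B \subset G -> C \subset G ->
    [~: A, B, C] \subset N -> [~: B, C, A] \subset N -> [~: C, A, B] \subset N.
Proof.
move=> /andP[_ nNG] sA sB sC.
have nN (X : {set gT}) : X \subset G -> X \subset 'N(N).
  by move=> sX; apply: subset_trans nNG.
have sR (X Y : {set gT}) : X \subset G -> Y \subset G -> [~: X, Y] \subset G.
  by move=> sX sY; rewrite (subset_trans (commgSS sX sY)) // der1_subG.
have qR (X Y Z : {group gT}) : X \subset G -> Y \subset G -> Z \subset G ->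
    ([~: X, Y, Z] \subset N) = ([~: X / N, Y / N, Z / N] == 1).
  move=> sX sY sZ; rewrite -quotient_sub1 ?nN ?sR // !quotientR ?nN ?sR //.
  by apply/trivgP/eqP.
rewrite !qR // => /eqP abc /eqP bca; apply/eqP.
exact: (@three_subgroup _ (A / N)%G (B / N)%G (C / N)%G).
Qed.

(** The bracket with the (i+1)-st term is a bracket with the i-th term and
    the whole group, which the three subgroup lemma redistributes. *)
Lemma lcn_commg i j : [~: 'L_i(G), 'L_j(G)] \subset 'L_(i + j)(G).
Proof.
elim: i j => [|i IH] j.
  by rewrite lcn0 add0n commGC (subset_trans (lcnSnS j G)) // lcn_subS.
case: i IH => [|i] IH; first by rewrite lcn1 commGC add1n lcnSnS.
rewrite lcnSn addSn.
apply: (@three_subgroup_normal G 'L_j(G)%G 'L_i.+1(G)%G 'L_(i.+1 + j).+1(G)%G);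
  rewrite ?lcn_normal ?lcn_sub //=.
- apply: subset_trans (commSg _ (_ : _ \subset 'L_j.+1(G))) _.
    by rewrite commGC lcnSnS.
  by rewrite commGC -addnS IH.
- apply: subset_trans (commSg _ (_ : _ \subset 'L_(i.+1 + j)(G))) (lcnSnS _ G).
  by rewrite commGC IH.
Qed.

Lemma lcn_comm i j x y :
  x \in 'L_i(G) -> y \in 'L_j(G) -> [~ x, y] \in 'L_(i + j)(G).
Proof. by move=> Lx Ly; rewrite (subsetP (lcn_commg i j)) // mem_commg. Qed.

End ThreeSubgroups.

Section Elimination.
Variables (gT : finGroupType) (d : nat).
Local Notation G := [set: gT].
Local Notation word := (seq 'I_d).
Local Notation item := (word * gT)%type.
Implicit Types (A B W : seq item) (w v u : word) (a b g h : gT).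

(** The homogeneous component of degree j of the Lie ring generated by the
    items, seen through representatives: membership is only meaningful modulo
    the next term of the lower central series, which is thrown in. *)
Inductive lie A : nat -> gT -> Prop :=
| lie_gen w g of (w, g) \in A : lie A (size w) g
| lie_high j g of g \in 'L_j.+1(G) : lie A j g
| lie_mul j g h of lie A j g & lie A j h : lie A j (g * h)
| lie_comm i j g h of lie A i g & lie A j h : lie A (i + j) [~ g, h].

Lemma lie1 A j : lie A j 1.
Proof. exact/lie_high/group1. Qed.

Lemma lieX A j g k : lie A j g -> lie A j (g ^+ k).
Proof.
by move=> Lg; elim: k => [|k IH]; [apply: lie1 | rewrite expgS; apply: lie_mul].
Qed.

Lemma lieV A j g : lie A j g -> lie A j g^-1.
Proof. by rewrite invg_expg; apply: lieX. Qed.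

Section Graded.
Variable A : seq item.
Hypothesis A_lcn : forall w g, (w, g) \in A -> g \in 'L_(size w)(G).

Lemma lie_lcn j g : lie A j g -> g \in 'L_j(G).
Proof.
elim=> {j g} [w g|j g|j g h _ Lg _ Lh|i j g h _ Lg _ Lh]; first exact: A_lcn.
- by apply/subsetP/lcn_subS.
- by rewrite groupM.
- exact: lcn_comm.
Qed.

Lemma lieJ j g x : lie A j g -> lie A j (g ^ x).
Proof.
move=> Lg; rewrite -[g ^ x](mulKVg g) -commgEl; apply: lie_mul => //.
apply: lie_high; rewrite (subsetP (lcnSnS j _)) // mem_commg ?inE //.
exact: lie_lcn.
Qed.

Lemma lie_commMl j x y z :
  lie A j [~ x, z] -> lie A j [~ y, z] -> lie A j [~ x * y, z].
Proof. by move=> Lx Ly; rewrite commMgJ; apply/lie_mul/Ly/lieJ. Qed.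

Lemma lie_commMr j x y z :
  lie A j [~ x, y] -> lie A j [~ x, z] -> lie A j [~ x, y * z].
Proof. by move=> Ly Lz; rewrite commgMJ; apply/lie_mul/lieJ/Ly. Qed.

Lemma lie_commC j x y : lie A j [~ x, y] -> lie A j [~ y, x].
Proof. by rewrite -invg_comm => /lieV; rewrite invgK. Qed.

Lemma lie_commX j x y k : lie A j [~ x, y] -> lie A j [~ x ^+ k, y].
Proof.
move=> L; elim: k => [|k IH]; first by rewrite comm1g; apply: lie1.
by rewrite expgS; apply: lie_commMl.
Qed.

Lemma lie_commV j x y : lie A j [~ x, y] -> lie A j [~ x^-1, y].
Proof. by rewrite invg_expg; apply: lie_commX. Qed.

Lemma lie_commVr j x y : lie A j [~ x, y] -> lie A j [~ x, y^-1].
Proof. by move/lie_commC/lie_commV/lie_commC. Qed.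

(** The adjoint action of [a] is a derivation, by the Hall-Witt identity, so
    the Lie ring is stable as soon as the generators are. *)
Lemma lie_ad k a : a \in 'L_k(G) ->
    (forall w g, (w, g) \in A -> lie A (k + size w) [~ a, g]) ->
  forall j g, lie A j g -> lie A (k + j) [~ a, g].
Proof.
move=> La Aa j g; elim=> {j g} [w g|j g Lg|j g h _ Lg _ Lh|i j g h Lg IHg Lh IHh].
- exact: Aa.
- by apply: lie_high; rewrite -addnS lcn_comm.
- exact: lie_commMr.
apply: lie_commC; rewrite -(conjgKV h [~ _, _, a]).
have := Hall_Witt_identity g h^-1 a; rewrite invgK -mulgA => /(canRL (mulgK _)).
rewrite mul1g => ->; apply/lieJ/lieV/lie_mul; apply: lieJ.
  rewrite (_ : (k + (i + j))%N = ((k + j) + i)%N); last by lia.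
  by apply: lie_comm => //; apply/lie_commV/lie_commVr/lie_commC.
rewrite (_ : (k + (i + j))%N = ((k + i) + j)%N); last by lia.
by apply: lie_comm; [apply: lie_commVr | apply: lieV].
Qed.

End Graded.

Variable n : nat.
Hypothesis G_nil : 'L_n.+1(G) = 1.

Definition ad_item (a : item) (x : item) : item := (a.1 ++ x.1, [~ a.2, x.2]).

(** The free generators that Lazard elimination puts in the place of [a]:
    the Lie ring generated by [A] is the direct sum of the multiples of [a]
    and of the Lie ring generated by the iterated brackets of [a] with the
    other generators. Brackets of length above [n] vanish, so finitely many
    are kept. *)
Definition eliminate (a : item) A : seq item :=
  [seq x <- [seq iter k (ad_item a) x | x <- [seq x <- A | x.1 != a.1],
                                        k <- iota 0 n.+1]
         | size x.1 <= n].

Lemma eliminate_sub (a x : item) A k : x \in A -> x.1 != a.1 ->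
  size (iter k (ad_item a) x).1 <= n -> 0 < size a.1 ->
  iter k (ad_item a) x \in eliminate a A.
Proof.
move=> Ax xa xn a0; have kn : k <= size (iter k (ad_item a) x).1.
  by elim: (k) => //= l IH; rewrite size_cat; lia.
rewrite mem_filter xn; apply/allpairsP; exists (x, k).
by split; rewrite // ?mem_filter ?xa ?mem_iota //= add0n ltnS (leq_trans kn).
Qed.

Lemma eliminateP (a : item) A y : y \in eliminate a A -> exists x k,
  [/\ x \in A, x.1 != a.1, size y.1 <= n & y = iter k (ad_item a) x].
Proof.
rewrite mem_filter => /andP[yn /allpairsP[[x k] [/= + _ yE]]].
by rewrite mem_filter => /andP[xa Ax]; exists x, k.
Qed.

Section OneStep.
Variables (A : seq item) (w : word) (a : gT).
Hypothesis A_lcn : forall v g, (v, g) \in A -> g \in 'L_(size v)(G).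
Hypothesis A_pos : forall v g, (v, g) \in A -> 0 < size v <= n.
Hypothesis A_prefix : forall x y, x \in A -> y \in A -> prefix x.1 y.1 -> x = y.
Hypothesis Aw : (w, a) \in A.
Hypothesis w_min : forall x, x \in A -> x.1 != w -> lex w x.1.

Let A' := eliminate (w, a) A.

Lemma eliminate_lcn v g : (v, g) \in A' -> g \in 'L_(size v)(G).
Proof.
case/eliminateP => x [k [Ax _ _ vgE]].
suff: (iter k (ad_item (w, a)) x).2 \in 'L_(size (iter k (ad_item (w, a)) x).1)(G).
  by rewrite -vgE.
elim: k {vgE} => [|k IH] /=; first by case: x Ax => u h /A_lcn.
by rewrite size_cat; apply: lcn_comm IH; apply: A_lcn.
Qed.

Lemma lie_eliminate_ad j g :
  lie A' j g -> lie A' (size w + j) [~ a, g].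
Proof.
apply: lie_ad; first exact: eliminate_lcn; first exact: A_lcn.
move=> v g' A'v.
have [vn|vn] := leqP (size (w ++ v)) n; last first.
  apply: lie_high; rewrite (_ : [~ a, g'] = 1) ?group1 //; apply/set1gP.
  rewrite -G_nil (subsetP (@lcn_sub_leq _ (size w + size v) _ _ _)) //.
    by rewrite -size_cat.
  by apply: lcn_comm; [apply: A_lcn | apply: eliminate_lcn A'v].
rewrite -size_cat; apply: lie_gen.
have [x [k [Ax xw xn xE]]] := eliminateP A'v.
have -> : (w ++ v, [~ a, g']) = iter k.+1 (ad_item (w, a)) x by rewrite /= -xE.
apply: eliminate_sub => //; first by rewrite /= -xE.
by have /andP[] := A_pos Aw.
Qed.

(** One elimination: the Lie ring is the sum of the span of the eliminated
    generator and of the subring generated by the remaining ones together with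
    their iterated brackets with it. *)
Lemma lie_eliminate j h : lie A j h -> exists m h',
  [/\ lie A' j h', h = a ^+ m * h' & j = size w \/ m = 0%N].
Proof.
elim=> {j h} [v g Av|j g Lg|j g h _ [m [g' [Lg -> jm]]] _ [l [h' [Lh -> jl]]]|].
- have [vw|vw] := eqVneq v w.
    have [_ ->] : (v, g) = (w, a).
      by apply: A_prefix; rewrite //= vw prefix_refl.
    by exists 1%N, 1; rewrite expg1 mulg1 vw; split; [apply: lie1 | |left].
  exists 0%N, g; rewrite mul1g; split=> //; last by right.
  apply: lie_gen; have /andP[v0 vn] := A_pos Av; have /andP[w0 _] := A_pos Aw.
  exact: (@eliminate_sub (w, a) (v, g) A 0).
- by exists 0%N, g; rewrite mul1g; split; [apply: lie_high | | right].
- exists (m + l)%N, (g' ^ (a ^+ l) * h'); split.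
  + by apply: lie_mul => //; apply: lieJ Lg; apply: eliminate_lcn.
  + by rewrite expgD conjgE !mulgA mulgK.
  + by case: jm jl => [jw|->] [jl|->]; auto.
move=> i j g h _ [m [g' [Lg -> im]]] _ [l [h' [Lh -> jl]]].
exists 0%N, [~ a ^+ m * g', a ^+ l * h']; rewrite mul1g; split=> //; last by right.
have lcA := eliminate_lcn.
apply: lie_commMl => //; last first.
  apply: lie_commMr => //; last exact: lie_comm.
  case: jl => [->|->]; last by rewrite expg0 commg1; apply: lie1.
  apply: lie_commC => //; apply: lie_commX => //.
  by rewrite addnC; apply: lie_eliminate_ad.
apply: lie_commMr => //.
  rewrite (_ : [~ _, _] = 1) //; first exact: lie1.
  by apply/eqP/commgP/commuteX2.
case: im => [->|->]; last by rewrite expg0 comm1g; apply: lie1.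
by apply: lie_commX => //; apply: lie_eliminate_ad.
Qed.

Lemma iter_ad_word k (x : item) :
  (iter k (ad_item (w, a)) x).1 = iter k (cat w) x.1.
Proof. by elim: k => //= k ->. Qed.

Lemma prefix_catl_cmp v t u : prefix v (t ++ u) -> prefix v t || prefix t v.
Proof.
elim: v t => [|i v IH] [|j t] //=.
by case/andP=> /eqP-> /IH; rewrite eqxx.
Qed.

Lemma eliminate_incomparable (x : item) : x \in A -> x.1 != w ->
  ~~ prefix x.1 w /\ ~~ prefix w x.1.
Proof.
move=> Ax xw; split; apply: contra xw => pxw.
  by rewrite (A_prefix Ax Aw pxw).
by rewrite -(A_prefix Aw Ax pxw).
Qed.

(** The words that remain form a prefix code: words [w ^ k v] are compared
    by stripping the powers of [w], which is incomparable to the words [v]. *)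
Lemma eliminate_prefix x y :
  x \in A' -> y \in A' -> prefix x.1 y.1 -> x = y.
Proof.
case/eliminateP => {}x [k [Ax xw _ ->]] /eliminateP [{}y [l [Ay yw _ ->]]].
rewrite !iter_ad_word.
have [nxw nwx] := eliminate_incomparable Ax xw.
have [nyw nwy] := eliminate_incomparable Ay yw.
elim: k l => [|k IH] [|l] /=.
- exact: A_prefix.
- by move/prefix_catl_cmp; rewrite (negPf nxw) (negPf nwx).
- by case/prefixP => t; rewrite -catA => yE; rewrite yE prefix_prefix in nwy.
- by rewrite prefix_catr ?eqxx // => pxy; rewrite (IH l).
Qed.

Lemma lex_eliminate (x : item) : x \in A' -> lex w x.1.
Proof.
case/eliminateP => {}x [k [Ax xw _ ->]]; rewrite iter_ad_word.
case: k => [|k] /=; first exact: w_min.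
have /andP[x0 _] : 0 < size x.1 <= n by case: x Ax {xw} => u g /A_pos.
rewrite -{1}[w]cats0 lex_cat2l.
by case: k => [|k] /=; [case: x.1 x0 | case: w (A_pos Aw)].
Qed.

End OneStep.

Definition lie_span W j : {group gT} :=
  <<[set g | has (fun z : item => (size z.1 == j) && (z.2 == g)) W]
     :|: 'L_j.+1(G)>>%G.

Lemma mem_span W w g : (w, g) \in W -> g \in lie_span W (size w).
Proof.
move=> Wg; rewrite mem_gen // !inE; apply/orP; left.
by apply/hasP; exists (w, g); rewrite ?eqxx.
Qed.

Lemma lcn_span W j : 'L_j.+1(G) \subset lie_span W j.
Proof. exact/sub_gen/subsetUr. Qed.

Lemma span_cons W (x : item) j : lie_span W j \subset lie_span (x :: W) j.
Proof.
apply/genS/setSU/subsetP => g; rewrite !inE /= => ->; exact: orbT.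
Qed.

Lemma lie_nil j h : lie [::] j h -> h \in 'L_j.+1(G).
Proof.
elim=> {j h} [//|//|j g h _ Lg _ Lh|i j g h _ Lg _ Lh]; first by rewrite groupM.
have := lcn_comm Lg Lh; apply: subsetP; apply: lcn_sub_leq; lia.
Qed.

Lemma ex_min (r : rel word) A : transitive r ->
    (forall u v, u != v -> r u v || r v u) -> A != [::] ->
  exists2 x : item, x \in A & forall y, y \in A -> y.1 != x.1 -> r x.1 y.1.
Proof.
move=> r_trans r_total; elim: A => // x A IH _.
have [->|/IH[y Ay ymin]] := eqVneq A [::].
  by exists x; rewrite ?inE // => y; rewrite inE => /eqP->; rewrite eqxx.
have [xy|xy] := boolP (r x.1 y.1); last first.
  exists y; first by rewrite inE Ay orbT.
  move=> z; rewrite inE => /orP[/eqP-> xz|]; last exact: ymin.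
  by have := r_total _ _ xz; rewrite (negPf xy).
exists x; first exact: mem_head.
move=> z; rewrite inE => /orP[/eqP->|Az _]; first by rewrite eqxx.
have [->//|zy] := eqVneq z.1 y.1.
exact: r_trans xy (ymin _ Az zy).
Qed.

(** The invariant of the items under elimination. It only has to pass to a
    bracket when the two words concatenate in increasing order, which is
    what leading words need; the minimality of the eliminated word provides
    it. *)
Variable Q : word -> gT -> Prop.
Hypothesis Q_lcn : forall w g, Q w g -> g \in 'L_(size w)(G).
Hypothesis Q_comm : forall w v a b, Q w a -> Q v b -> lex (w ++ v) (v ++ w) ->
  Q (w ++ v) [~ a, b].

(** Always eliminating the lexicographically least word makes the eliminated
    words strictly increase, so that they are pairwise distinct, and there
    are finitely many of them because only words of length at most n matter.
    The words of the current generators stay a prefix code. *)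
Lemma elimination_basis A (T : seq word) :
    (forall x, x \in A -> Q x.1 x.2 /\ 0 < size x.1 <= n) ->
    (forall x y, x \in A -> y \in A -> prefix x.1 y.1 -> x = y) ->
    (forall u x, size u <= n -> x \in A -> x.1 = u \/ lex x.1 u -> u \in T) ->
  exists W, [/\ uniq (map fst W),
    forall x, x \in W -> [/\ Q x.1 x.2, 0 < size x.1 <= n
      & exists2 y, y \in A & y.1 = x.1 \/ lex y.1 x.1]
    & forall j h, lie A j h -> h \in lie_span W j].
Proof.
have [m] := ubnP (size T); elim: m => // m IH in A T * => Tm QA Apre AT.
have [->|A0] := eqVneq A [::].
  exists [::]; split=> // j h /lie_nil; exact/subsetP/lcn_span.
have [[w a] Aw wmin] :=
  ex_min (@lex_trans d) (@lex_total d) A0; rewrite /= in wmin.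
have Alcn v g : (v, g) \in A -> g \in 'L_(size v)(G).
  by move=> Av; apply: Q_lcn; have [] := QA _ Av.
have Apos v g : (v, g) \in A -> 0 < size v <= n.
  by move=> Av; have [] := QA _ Av.
have wT : w \in T.
  by have /andP[_ wn] := Apos _ _ Aw; apply: (AT w (w, a)) => //; left.
pose A' := eliminate (w, a) A.
have lexA' := lex_eliminate Apos Aw wmin.
have [] := IH A' [seq u <- T | u != w].
- rewrite size_filter -ltnS; apply: leq_trans _ Tm; rewrite ltnS.
  by rewrite -(count_predC (pred1 w) T) -[X in X < _]add0n ltn_add2r -has_count has_pred1.
- move=> y A'y; have [x [k [Ax xw yn yE]]] := eliminateP A'y.
  rewrite yn andbT {y A'y yn}yE /=; have [Qx /andP[x0 _]] := QA _ Ax.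
  elim: k => //= k [IHQ k0]; rewrite size_cat addn_gt0 k0 orbT; split=> //.
  apply: Q_comm IHQ _; first by have [] := QA _ Aw.
  rewrite iter_ad_word; elim: k {k0} => /= [|k IHk]; last first.
    by rewrite -catA lex_cat2l.
  apply: lex_cat (wmin _ Ax xw) _.
  by have [] := eliminate_incomparable Apre Aw Ax xw.
- exact: (eliminate_prefix Apre Aw).
- move=> u x un A'x xu; have wu : lex w u.
    by have := lexA' _ A'x; case: xu => [->//|xu /lex_trans]; apply.
  rewrite mem_filter (AT u (w, a)) ?andbT //; last by right.
  by apply/eqP => uw; rewrite uw lex_irr in wu.
move=> W' [W'uniq W'A spanW'].
have lexW' x : x \in W' -> lex w x.1.
  case/W'A => _ _ [y /lexA' wy [<-//|]]; exact: lex_trans.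
exists ((w, a) :: W'); split.
- rewrite /= W'uniq andbT; apply/mapP => -[x /lexW' wx wE].
  by rewrite -wE lex_irr in wx.
- move=> x; rewrite inE => /orP[/eqP->|W'x].
    by have [Qw wn] := QA _ Aw; split=> //; exists (w, a) => //; left.
  have [Qx xn _] := W'A _ W'x; split=> //; exists (w, a) => //.
  by right; apply: lexW'.
move=> j h /(lie_eliminate Alcn Apos Apre Aw)[k [h' [/spanW' h'W -> jk]]].
apply: groupM; last by apply: subsetP h'W; apply: span_cons.
case: jk => [->|->]; last exact: group1.
by apply/groupX/mem_span/mem_head.
Qed.

(** Every term of the lower central series is generated by the brackets of the
    preceding one with elements of degree one. *)
Lemma lcn_lie A : (forall x, x \in A -> size x.1 = 1%N) ->
    (forall g, lie A 1 g) ->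
  forall j g, 0 < j -> g \in 'L_j(G) -> lie A j g.
Proof.
move=> A1 lieA [//|j] + _; elim: j => [|j IH] g; first by move=> _; apply: lieA.
rewrite lcnSn => /gen_prodgP[m [c Lc ->]].
apply: big_ind => [||i _]; [exact: lie1 | by move=> *; apply: lie_mul |].
have /imset2P[x y Lx _ ->] := Lc i.
by rewrite -addn1; apply: lie_comm; [apply: IH | apply: lieA].
Qed.

End Elimination.

(** * The lower p-series of a finite free quotient *)

Section NormalModulo.
Variables (gT : finGroupType) (N : {group gT}).
Hypothesis nN : N <| [set: gT].
Implicit Types x y : gT.

Local Lemma inN x : x \in 'N(N).
Proof. by have /andP[_ /subsetP->] := nN; rewrite ?inE. Qed.

Lemma coset_mulE x y : coset N (x * y) = coset N x * coset N y.
Proof. by rewrite morphM ?inN. Qed.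

Lemma coset_expE x k : coset N (x ^+ k) = coset N x ^+ k.
Proof. by rewrite morphX ?inN. Qed.

Lemma coset_commE x y : coset N [~ x, y] = [~ coset N x, coset N y].
Proof. by rewrite morphR ?inN. Qed.

Lemma coset_eq1 x : (coset N x == 1) = (x \in N).
Proof. by apply/eqP/idP => [/coset_idr->|/coset_id] //; apply: inN. Qed.

Lemma coset_eq x y : (coset N x == coset N y) = (x^-1 * y \in N).
Proof.
rewrite -coset_eq1 coset_mulE morphV ?inN //.
by rewrite -(inj_eq (mulgI (coset N x)^-1)) mulVg eq_sym.
Qed.

Lemma coset_commute x y : commute (coset N x) (coset N y) <-> [~ x, y] \in N.
Proof.
by rewrite -coset_eq1 coset_commE; split=> /commgP.
Qed.

(** Congruences modulo a normal subgroup, as statements about a group that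
    contains it. *)
Lemma mem_modulo (H : {group gT}) x y : N \subset H ->
  coset N x = coset N y -> (x \in H) = (y \in H).
Proof.
move=> sNH /eqP; rewrite coset_eq => /(subsetP sNH) xyH.
by rewrite -{1}(mulKVg x y) groupMr.
Qed.

End NormalModulo.

Section FreeQuotient.
Variables (d p n : nat) (p_pr : prime p).
Local Notation F := (freegroup d).
Local Notation gT := (free_quo d p_pr n.+1).
Local Notation prj := (free_proj p_pr n.+1).
Local Notation Gs i := (lower_p_section d p_pr n.+1 i).
Local Notation T := [set: gT].
Implicit Types (x y : F) (z t : gT) (i j k : nat).

Lemma lower_p_seriesW i x : 0 < i -> lower_p_series p i.+1 x -> lower_p_series p i x.
Proof.
move=> i0; rewrite lower_p_seriesS // => -[y [z [Py Cz ->]]].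
have [F1 FM FV FJ] := lower_p_series_normal F p i.
have FX y' k : lower_p_series p i y' -> lower_p_series p i (y' ^+ k).
  by move=> Fy; elim: k => [|k IH]; [exact: F1 | rewrite expgS; apply: FM].
apply: (FM y z).
  elim: Py => {y} [|_ [v Fv ->]|y v _ Fy _ Fv|y _ Fy].
  - exact: F1.
  - exact: FX.
  - exact: FM.
  - exact: FV.
elim: Cz => {z} [|_ [v [w [Fv _ ->]]]|z v _ Fz _ Fv|z _ Fz].
- exact: F1.
- by rewrite commgEl; apply: FM; [apply: FV | apply: FJ].
- exact: FM.
- exact: FV.
Qed.

Lemma lower_p_series_leq i j x : 0 < i <= j ->
  lower_p_series p j x -> lower_p_series p i x.
Proof.
case/andP=> i0; elim: j => [|j IH]; first by rewrite leqn0 => /eqP->.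
rewrite leq_eqVlt => /predU1P[->//|]; rewrite ltnS => ij /lower_p_seriesW Fj.
by apply: IH => //; apply: Fj; apply: leq_trans ij.
Qed.

Definition free_lift z : F := generic_quotient.repr (z : lower_p_quo F p n.+1).

Lemma free_liftK z : prj (free_lift z) = z.
Proof. exact: lower_p_proj_repr. Qed.

Lemma prjM x y : prj (x * y) = prj x * prj y. Proof. exact: lower_p_projM. Qed.
Lemma prjV x : prj x^-1 = (prj x)^-1. Proof. exact: lower_p_projV. Qed.
Lemma prjX x k : prj (x ^+ k) = prj x ^+ k. Proof. exact: lower_p_projX. Qed.
Lemma prjR x y : prj [~ x, y] = [~ prj x, prj y].
Proof. by rewrite !commgEl !conjgE !prjM !prjV. Qed.

Lemma prj_eq x y : prj x = prj y -> lower_p_series p n.+1 (x^-1 * y).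
Proof.
move=> xy; apply/(lower_p_proj_eq1 p n.+1); rewrite -/(prj _) prjM prjV xy.
exact: mulVg.
Qed.

Lemma mem_prj i x : 0 < i <= n.+1 -> prj x \in Gs i <-> lower_p_series p i x.
Proof.
move=> i_n; split=> [/lower_p_sectionP[y Fy /esym/prj_eq xy]|Fx]; last first.
  by apply/lower_p_sectionP; exists x.
have [_ FM _ _] := lower_p_series_normal F p i.
by rewrite -[x](mulKVg y); apply: FM => //; apply: lower_p_series_leq xy.
Qed.

Lemma free_lift_in i z : 0 < i <= n.+1 -> z \in Gs i -> lower_p_series p i (free_lift z).
Proof. by move=> i_n Gz; apply/mem_prj; rewrite ?free_liftK. Qed.

Lemma section1 : Gs 1 = T.
Proof.
apply/setP => z; rewrite !inE; apply/asboolP.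
by exists (free_lift z); rewrite ?free_liftK.
Qed.

Lemma sectionS i : 0 < i -> Gs i.+1 \subset Gs i.
Proof.
move=> i0; apply/subsetP => z /lower_p_sectionP[x Fx ->].
by apply/lower_p_sectionP; exists x => //; apply: lower_p_seriesW.
Qed.

Lemma section_leq i j : 0 < i <= j -> Gs j \subset Gs i.
Proof.
move=> ij; apply/subsetP => z /lower_p_sectionP[x Fx ->].
by apply/lower_p_sectionP; exists x => //; apply: lower_p_series_leq Fx.
Qed.

Lemma section_last : Gs n.+1 = 1.
Proof.
apply/trivgP/subsetP => z /lower_p_sectionP[x Fx ->]; apply/set1gP.
exact/lower_p_proj_eq1.
Qed.

Lemma section_normal i : Gs i <| T.
Proof.
have [_ _ _ FJ] := lower_p_series_normal F p i.
apply/andP; split; first exact: subsetT.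
apply/subsetP => z _; rewrite inE; apply/subsetP => _ /imsetP[t + ->].
case/lower_p_sectionP => x Fx ->; apply/lower_p_sectionP; exists (x ^ free_lift z).
  exact: FJ.
by rewrite -[in LHS](free_liftK z) !conjgE !prjM prjV.
Qed.

Lemma section_exp i z : 0 < i -> z \in Gs i -> z ^+ p \in Gs i.+1.
Proof.
move=> i0 /lower_p_sectionP[x Fx ->]; apply/lower_p_sectionP.
by exists (x ^+ p); [apply: lower_p_power | rewrite prjX].
Qed.

Lemma section_comm i z t : 0 < i -> z \in Gs i -> [~ z, t] \in Gs i.+1.
Proof.
move=> i0 /lower_p_sectionP[x Fx ->]; apply/lower_p_sectionP.
exists [~ x, free_lift t]; first exact: lower_p_central.
by rewrite prjR free_liftK.
Qed.

Lemma section_commG i : 0 < i -> [~: Gs i, T] \subset Gs i.+1.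
Proof.
move=> i0; rewrite gen_subG; apply/subsetP => _ /imset2P[z t Gz _ ->].
exact: section_comm.
Qed.

(** An induction principle along the series: the elements that have a given
    property are gathered in the subgroup [H]. *)
Lemma section_gen i (H : {group gT}) : 0 < i ->
    (forall z, z \in Gs i -> z ^+ p \in H) ->
    (forall z t, z \in Gs i -> [~ z, t] \in H) ->
  Gs i.+1 \subset H.
Proof.
move=> i0 HX HR; apply/subsetP => _ /lower_p_sectionP[x + ->].
have prjH (S : F -> Prop) y :
    (forall u, S u -> prj u \in H) -> Defs.generated S y -> prj y \in H.
  move=> SH; elim=> {y} [|y /SH //|y u _ Hy _ Hu|y _ Hy].
  - by rewrite (_ : prj 1 = 1) ?group1 // /free_proj lower_p_proj1.
  - by rewrite prjM groupM.
  - by rewrite prjV groupV.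
rewrite lower_p_seriesS // => -[y [u [Py Cu ->]]]; rewrite prjM groupM //.
  apply: prjH Py => _ [v Fv ->]; rewrite prjX; apply: HX.
  by apply/lower_p_sectionP; exists v.
apply: prjH Cu => _ [v [w [Fv _ ->]]]; rewrite prjR; apply: HR.
by apply/lower_p_sectionP; exists v.
Qed.

(** It suffices to let [t] be a p-th power or a commutator: modulo the
    target, bracketing with [z] turns powers into powers, and the three
    subgroup lemma deals with commutators. *)
Lemma section_comm2 i z t : 0 < i -> z \in Gs i -> t \in Gs 2 ->
  [~ z, t] \in Gs i.+2.
Proof.
move=> i0 Gz Gt; pose N := lower_p_section_group d p_pr n.+1 i.+2.
have nN : N <| T by apply: section_normal.
pose C := [set t | [forall z in Gs i, [~ z, t] \in N]].
have gC : group_set C.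
  apply/group_setP; split=> [|u v]; rewrite !inE.
    by apply/forall_inP => y _; rewrite commg1 group1.
  move=> /forall_inP Cu /forall_inP Cv; apply/forall_inP => y Gy.
  by rewrite commgMJ groupM ?Cv // memJ_norm ?Cu // inN.
suff /subsetP/(_ t Gt) : Gs 2 \subset Group gC.
  by rewrite inE => /forall_inP; apply.
apply: section_gen => // [u _|u v _]; rewrite inE; apply/forall_inP => y Gy.
  rewrite -(coset_eq1 nN) (coset_commE nN) (coset_expE nN) commgX.
    rewrite -(coset_commE nN) -(coset_expE nN) (coset_eq1 nN).
    by apply: section_exp => //; apply: section_comm.
  rewrite -(coset_commE nN); apply/commute_sym/(coset_commute nN).
  by apply: section_comm => //; apply: section_comm.
have GG : [~: Gs i, T, T] \subset N.
  by rewrite (subset_trans (commSg _ (section_commG i0))) // section_commG.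
have : [~: T, T, Gs i] \subset N.
  apply: (@three_subgroup_normal _ T T (lower_p_section_group d p_pr n.+1 i) T);
    rewrite ?subsetT //.
  by rewrite [[~: T, Gs i]]commGC.
rewrite commGC => /subsetP; apply; rewrite mem_commg // mem_commg ?inE //.
Qed.

Lemma lcn_section j : 0 < j -> 'L_j(T) \subset Gs j.
Proof.
case: j => // j _; elim: j => [|j IH]; first by rewrite section1 subsetT.
by rewrite lcnSn (subset_trans (commSg _ IH)) // section_commG.
Qed.

Lemma lcn_trivial : 'L_n.+1(T) = 1.
Proof. by apply/trivgP; rewrite -section_last lcn_section. Qed.

End FreeQuotient.

Arguments lcn_section {d p n p_pr j} _.
Arguments sectionS {d p n p_pr i} _.
Arguments section_leq {d p n p_pr i j} _.
Arguments section_commG {d p n p_pr i} _.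

Local Open Scope ring_scope.

(** * Basic commutators with distinct leading words *)

Section LeadWords.
Variable d : nat.
Implicit Types (f g : ser d) (u v w : seq 'I_d).

Definition vanish_below f w := forall v, wlt v w -> f v = 0.

(** No other cut of [u ++ v] contributes: the order being compatible with
    concatenation, one of the two pieces would precede [u] or [v]. *)
Lemma lead_mul f g u v : vanish_below f u -> vanish_below g v ->
  vanish_below (f * g) (u ++ v) /\ (f * g) (u ++ v) = f u * g v.
Proof.
move=> fu gv; split=> [w wuv|].
  rewrite serM big1 // => i _.
  have [/fu->|nfu] := boolP (wlt (take i w) u); first by rewrite mul0r.
  have [/gv->|ngv] := boolP (wlt (drop i w) v); first by rewrite mulr0.
  by have := wlt_cat nfu ngv; rewrite cat_take_drop wuv.
have iP : (size u < (size (u ++ v)).+1)%N by rewrite size_cat; lia.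
rewrite serM (bigD1 (Ordinal iP)) //= take_size_cat // drop_size_cat //.
rewrite big1 ?addr0 // => i ni.
have iu : (i : nat) != size u by apply: contra ni => /eqP iE; apply/eqP/val_inj.
have szuv : size (u ++ v) = (size u + size v)%N by rewrite size_cat.
have i_uv : (i <= size (u ++ v))%N by rewrite -ltnS.
have [i_lt|i_ge] := ltnP i (size u).
  by rewrite fu ?mul0r // /wlt size_takel // i_lt.
by rewrite gv ?mulr0 // /wlt size_drop; apply/orP; left; lia.
Qed.

End LeadWords.

Section Basis.
Variables (d p n : nat) (p_pr : prime p).
Hypothesis n_gt0 : (0 < n)%N.
Local Notation F := (freegroup d).
Local Notation gT := (free_quo d p_pr n.+1).
Local Notation prj := (free_proj p_pr n.+1).
Local Notation Gs i := (lower_p_section d p_pr n.+1 i).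
Local Notation Gg i := (lower_p_section_group d p_pr n.+1 i).
Local Notation T := [set: gT].
Implicit Types (x y : F) (z t c : gT) (i j k : nat) (u v w : seq 'I_d).

(** The invariant of elimination: a leading word with leading coefficient 1. *)
Definition lead_lift w c : Prop := c \in 'L_(size w)(T)%g /\
  exists x, [/\ c = prj x, vanish_below (nu x) w & nu x w = 1].

(** As [w ++ v] precedes [v ++ w], only one of the two products in the
    bracket reaches [w ++ v]. *)
Lemma lead_lift_comm w v a b : lead_lift w a -> lead_lift v b ->
  lex (w ++ v) (v ++ w) -> lead_lift (w ++ v) [~ a, b]%g.
Proof.
case=> La [x [aE xw x1]] [Lb [y [bE yv y1]]] lexwv.
split; first by rewrite size_cat; apply: lcn_comm.
exists [~ x, y]%g; rewrite aE bE prjR.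
have [xyv xy1] := lead_mul xw yv; have [yxv _] := lead_mul yv xw.
have wltwv : wlt (w ++ v) (v ++ w).
  by rewrite /wlt !size_cat addnC eqxx lexwv orbT.
pose h := nu x * nu y - nu y * nu x.
have h0 : vanish_below h (w ++ v).
  move=> u uwv; rewrite /h serB xyv // yxv ?subrr //; exact: (wlt_trans uwv wltwv).
have h1 : h (w ++ v) = 1 by rewrite /h serB xy1 yxv // x1 y1 mulr1 subr0.
have [||] := @lead_mul d (mu x^-1%g * mu y^-1%g) h [::] (w ++ v).
- by move=> u; rewrite wlt_nil.
- exact: h0.
by rewrite -nuR serM_nil !mu_nil !mul1r h1 /= => ? ?.
Qed.

Definition letters : seq (seq 'I_d * gT) :=
  [seq ([:: l], prj (fgenerator l)) | l <- enum 'I_d].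

Lemma lettersP (a : seq 'I_d * gT) :
  reflect (exists l, a = ([:: l], prj (fgenerator l))) (a \in letters).
Proof.
apply: (iffP mapP) => [[i _ ->]|[i ->]]; exists i => //.
by rewrite mem_enum.
Qed.

Lemma lie_letters z : lie letters 1 z.
Proof.
rewrite -(free_liftK z); elim/freegroup_ind: (free_lift z) => [|[i b] x IH].
  by rewrite (_ : prj 1%g = 1%g); [apply: lie1 | apply: lower_p_proj1].
rewrite prjM; apply: lie_mul => //.
have Li : lie letters 1 (prj (fgenerator i)).
  by apply: (@lie_gen _ _ _ [:: i]); apply/lettersP; exists i.
case: b => //; rewrite (_ : fletter (i, true) = (fgenerator i)^-1)%g.
  by rewrite prjV; apply: lieV.
exact: val_inj.
Qed.

(** Basic commutators, indexed by their leading words. They come from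
    eliminating the letters one after the other, while [lead_lift] is
    preserved. *)
Lemma lcn_basis : exists W : seq (seq 'I_d * gT),
  [/\ uniq (map fst W),
      forall a, a \in W -> lead_lift a.1 a.2 /\ (0 < size a.1 <= n)%N
    & forall j, (0 < j)%N -> 'L_j(T)%g \subset lie_span W j].
Proof.
have [|a|a b|u _ un _ _|W [uW WP WL]] :=
    @elimination_basis gT d n (lcn_trivial d n p_pr) lead_lift _
      lead_lift_comm letters (words d n).
- by move=> w c [].
- case/lettersP => i -> /=; rewrite n_gt0; split=> //.
  split; first by rewrite lcn1 inE.
  exists (fgenerator i).
  have nug : nu (fgenerator i) = var i by rewrite nuE mu_gen addrC addKr.
  split=> [//|v|]; rewrite nug /var ?eqxx //.
  by case: eqP => // ->; rewrite wlt_irr.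
- case/lettersP => i -> /lettersP [j ->] /=.
  by case/andP=> /eqP->.
- by rewrite mem_words.
exists W; split=> // [a /WP[]//|j j0]; apply/subsetP => z Lz; apply: WL.
apply: (lcn_lie _ lie_letters) => // a.
by case/lettersP=> i ->.
Qed.

(** * The symbol of an element of the quotient *)

(** Independent of the lift on the i-th term of the series ([gsym_prj]). *)
Definition gsym i z w : 'F_p := sym p i (free_lift z) w.

Lemma gsym_prj i x w : (0 < i <= n)%N -> (size w <= i)%N ->
  lower_p_series p i x -> gsym i (prj x) w = sym p i x w.
Proof.
case/andP=> i0 i_n wi Fx; apply: sym_congr => //.
  by apply: lower_dim (free_lift_in _ _); rewrite ?i0 ?leqW //; apply/mem_prj; rewrite ?i0 ?leqW.
have Fxy : lower_p_series p n.+1 ((free_lift (prj x))^-1 * x)%g.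
  by apply/(prj_eq (p_pr := p_pr)); rewrite free_liftK.
by apply: inI_W (lower_dim _ Fxy).
Qed.

Lemma gsymM i z t w : (0 < i <= n)%N -> (size w <= i)%N ->
  z \in Gs i -> t \in Gs i -> gsym i (z * t)%g w = gsym i z w + gsym i t w.
Proof.
case/andP=> i0 i_n wi Gz Gt; have i_n1 : (0 < i <= n.+1)%N by rewrite i0 leqW.
have [Fz Ft] := (free_lift_in i_n1 Gz, free_lift_in i_n1 Gt).
have [_ FM _ _] := lower_p_series_normal F p i.
rewrite -{1}(free_liftK z) -{1}(free_liftK t) -prjM gsym_prj ?i0 //; last exact: FM.
by rewrite symM //; apply: lower_dim.
Qed.

Lemma gsym0 i z w : (0 < i <= n)%N -> (size w <= i)%N ->
  z \in Gs i.+1 -> gsym i z w = 0.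
Proof.
case/andP=> i0 i_n wi Gz; apply: sym_dimS => //.
by apply/lower_dim/free_lift_in.
Qed.

Lemma gsym1 i w : (0 < i <= n)%N -> (size w <= i)%N -> gsym i 1%g w = 0.
Proof. by move=> i_n wi; apply: gsym0 => //; apply: group1. Qed.

Lemma gsymX i z w k : (0 < i <= n)%N -> (size w <= i)%N ->
  z \in Gs i -> gsym i (z ^+ k)%g w = gsym i z w *+ k.
Proof.
move=> i_n wi Gz; elim: k => [|k IH]; first by rewrite expg0 gsym1 ?mulr0n.
by rewrite expgS gsymM ?(groupX k Gz : _ \in Gg i) // IH mulrS.
Qed.

Lemma gsym_exp i z w : (0 < i < n)%N -> (size w <= i)%N ->
  z \in Gs i -> gsym i.+1 (z ^+ p)%g w = gsym i z w.
Proof.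
case/andP=> i0 i_n wi Gz; have i_n1 : (0 < i <= n.+1)%N by lia.
have Fz := free_lift_in i_n1 Gz.
rewrite -{1}(free_liftK z) -prjX gsym_prj //; [|lia|exact: lower_p_power].
by rewrite symX //; apply: lower_dim.
Qed.

Lemma gsym_comm i z w (l : 'I_d) : (0 < i < n)%N -> (size w <= i.+1)%N ->
  z \in Gs i -> gsym i.+1 [~ z, prj (fgenerator l)]%g w
    = rmul_var l (gsym i z) w - lmul_var l (gsym i z) w.
Proof.
case/andP=> i0 i_n wi Gz; have i_n1 : (0 < i <= n.+1)%N by lia.
have Fz := free_lift_in i_n1 Gz.
rewrite -{1}(free_liftK z) -prjR gsym_prj ?i_n //; last exact: lower_p_central.
by rewrite symR //; apply: lower_dim.
Qed.

End Basis.

Local Close Scope ring_scope.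

(** * The lower p-series is detected by symbols *)

Section Span.
Variables (d p n : nat) (p_pr : prime p).
Hypothesis n_gt0 : (0 < n)%N.
Local Notation F := (freegroup d).
Local Notation gT := (free_quo d p_pr n.+1).
Local Notation Gs i := (lower_p_section d p_pr n.+1 i).
Local Notation Gg i := (lower_p_section_group d p_pr n.+1 i).
Local Notation T := [set: gT].
Implicit Types (x y : F) (z t u v : gT) (i j k : nat).

Lemma section_expn i k z : 0 < i -> z \in Gs i -> z ^+ (p ^ k) \in Gs (i + k).
Proof.
move=> i0 Gz; elim: k => [|k IH]; first by rewrite addn0 expn0 expg1.
by rewrite expnSr expgM addnS section_exp // addn_gt0 i0.
Qed.

(** A basic commutator of length [j] enters the i-th term through its power
    of exponent [p ^ (i - j)], whose symbol has the same leading word. *)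
Definition power_items (W : seq (seq 'I_d * gT)) i : seq (seq 'I_d * gT) :=
  [seq (a.1, a.2 ^+ (p ^ (i - size a.1))) | a <- [seq a <- W | size a.1 <= i]].

Definition items_group (E : seq (seq 'I_d * gT)) : {group gT} :=
  <<[set z | z \in map snd E]>>%G.

Section OnBasis.
Variable W : seq (seq 'I_d * gT).
Hypothesis W_lcn : forall a, a \in W -> a.2 \in 'L_(size a.1)(T).
Hypothesis W_pos : forall a, a \in W -> 0 < size a.1.
Hypothesis W_span : forall j, 0 < j -> 'L_j(T) \subset lie_span W j.

Lemma power_item_in i a : a \in W -> size a.1 <= i ->
  a.2 ^+ (p ^ (i - size a.1)) \in Gs i.
Proof.
move=> Wa ai; rewrite -{2}(subnKC ai); apply: section_expn (W_pos Wa) _.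
by apply: (subsetP (lcn_section _)) (W_lcn Wa); apply: W_pos.
Qed.

Lemma mem_power_items i a : a \in W -> size a.1 <= i ->
  a.2 ^+ (p ^ (i - size a.1)) \in items_group (power_items W i).
Proof.
move=> Wa ai; apply: mem_gen; rewrite inE -map_comp.
by apply/mapP; exists a; rewrite ?mem_filter ?ai.
Qed.

Lemma lcn_power_items i : 0 < i ->
  'L_i(T) \subset items_group (power_items W i) <*> Gg i.+1.
Proof.
move=> i0; apply: subset_trans (W_span i0) _; rewrite gen_subG subUset.
apply/andP; split; last first.
  by rewrite (subset_trans (lcn_section _)) ?joing_subr.
apply/subsetP => z; rewrite inE => /hasP[a Wa /andP[/eqP ai /eqP<-]].
apply: (subsetP (joing_subl _ _)).
by have := @mem_power_items i a Wa; rewrite -ai leqnn subnn expn0 expg1; apply.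
Qed.

(** The p-th power map and the brackets are additive on the i-th term modulo
    the next but one, except that for [p = 2] and [i = 1] squaring is only
    additive up to commutators; this is why the lower central series is
    added to the modulus [Q]. *)
Lemma section_span i : 0 < i ->
  Gs i \subset items_group (power_items W i) <*> Gg i.+1.
Proof.
elim: i => // i IH _; case: i IH => [|k] IH.
  by rewrite section1; have := @lcn_power_items 1; rewrite lcn1; apply.
set i := k.+1 in IH *; have i0 : 0 < i by [].
pose H := (items_group (power_items W i.+1) <*> Gg i.+2)%G.
pose Q := ('L_i.+1(T) <*> Gg i.+2)%G.
have nQ : Q <| T by rewrite normalY ?lcn_normal ?section_normal.
have LQ : 'L_i.+1(T) \subset Q by apply: joing_subl.
have GQ : Gs i.+2 \subset Q by apply: (joing_subr _ (Gg i.+2)).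
have GH : Gs i.+2 \subset H by apply: (joing_subr _ (Gg i.+2)).
have QH : Q \subset H.
  by rewrite join_subG GH lcn_power_items.
have GiQ z t : z \in Gs i -> t \in Gs i -> [~ z, t] \in Q.
  case: k @i i0 {IH H nQ GH QH} Q LQ GQ => [|k] /= i0 Q LQ GQ Gz Gt.
    by rewrite (subsetP LQ) // mem_commg ?inE.
  by rewrite (subsetP GQ) // section_comm2 // (subsetP (@section_leq d p n p_pr 2 k.+2 isT)).
have powM z t : z \in Gs i -> t \in Gs i ->
    ((z * t) ^+ p \in H) = (z ^+ p * t ^+ p \in H).
  move=> Gz Gt; apply: (mem_modulo nQ QH).
  rewrite !(coset_mulE nQ, coset_expE nQ) expgMn //.
  by apply/(coset_commute nQ); apply: GiQ.
have Hpow z : z \in Gs i -> z ^+ p \in H.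
  pose K := [set z in Gs i | z ^+ p \in H].
  have KE u : (u \in K) = (u \in Gs i) && (u ^+ p \in H) by rewrite in_set.
  have gK : group_set K.
    apply/group_setP; split=> [|u v]; first by rewrite KE expg1n !group1.
    rewrite !KE => /andP[Gu Hu] /andP[Gv Hv].
    by rewrite (groupM (Gu : u \in Gg i)) //= powM // groupM.
  suff /subsetP sGK : Gs i \subset K by move=> /sGK; rewrite KE => /andP[].
  apply: subset_trans (IH i0) _.
  rewrite -[K]/(gval (Group gK)) join_subG gen_subG /=.
  apply/andP; split; apply/subsetP => u; last first.
    move=> Gu; rewrite KE (subsetP (sectionS _)) //.
    by rewrite (subsetP GH) // section_exp.
  rewrite in_set -map_comp => /mapP[a + ->] /=; rewrite mem_filter => /andP[ai Wa].
  rewrite KE power_item_in //= -expgM -expnSr -subSn //.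
  apply: (subsetP (joing_subl _ _)); apply: mem_power_items => //; exact: leqW.
have Hcomm z t : z \in Gs i -> [~ z, t] \in H.
  pose K := [set z in Gs i | [forall t, [~ z, t] \in H]].
  have KE u : (u \in K) = (u \in Gs i) && [forall t, [~ u, t] \in H].
    by rewrite in_set.
  have gK : group_set K.
    apply/group_setP; split=> [|u v]; rewrite !KE.
      by rewrite group1; apply/forallP => s; rewrite comm1g group1.
    move=> /andP[Gu /forallP Hu] /andP[Gv /forallP Hv].
    rewrite (groupM (Gu : u \in Gg i)) //=; apply/forallP => s.
    rewrite commMgJ groupM // -[_ ^ v](mulKVg [~ u, s]) groupM // -commgEl.
    by rewrite (subsetP GH) // section_comm // section_comm.
  suff /subsetP sGK : Gs i \subset K.
    by move=> /sGK; rewrite KE => /andP[_ /forallP].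
  apply: subset_trans (IH i0) _.
  rewrite -[K]/(gval (Group gK)) join_subG gen_subG /=.
  apply/andP; split; apply/subsetP => u; last first.
    move=> Gu; rewrite KE (subsetP (sectionS _)) //=; apply/forallP => s.
    by rewrite (subsetP GH) // section_comm.
  rewrite in_set -map_comp => /mapP[a + ->] /=; rewrite mem_filter => /andP[ai Wa].
  rewrite KE power_item_in //=; apply/forallP => s.
  have [ai'|ai'] := leqP i (size a.1).
    have aiE : size a.1 = i by apply/eqP; rewrite eqn_leq ai.
    rewrite aiE subnn expn0 expg1 (subsetP QH) // (subsetP LQ) //.
    by rewrite (subsetP (lcnSnS i _)) // mem_commg ?inE // -aiE W_lcn.
  have ak : size a.1 <= k by rewrite -ltnS.
  rewrite /i subSn // expnSr expgM; set b := a.2 ^+ _.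
  have Gb : b \in Gs k by apply: power_item_in.
  clearbody b.
  have k0 : 0 < k by apply: leq_trans ak; apply: W_pos.
  have Gbs : [~ b, s] \in Gs i by apply: section_comm.
  rewrite (mem_modulo nQ QH (_ : _ = coset Q ([~ b, s] ^+ p))); first exact: Hpow.
  rewrite (coset_commE nQ) !(coset_expE nQ) (coset_commE nQ) commXg //.
  rewrite -(coset_commE nQ); apply: commute_sym; apply/(coset_commute nQ).
  have [k2|k1] := leqP 2 k.
    by rewrite (subsetP GQ) // section_comm2 // (subsetP (@section_leq d p n p_pr 2 k k2)).
  have ek : k = 1%N by apply/eqP; rewrite eqn_leq k0 -ltnS k1.
  rewrite (subsetP LQ) // /i ek; apply: (@lcn_comm _ T 2 1); rewrite ?lcn1 ?inE //.
  by rewrite (subsetP (lcnSnS 1 _)) // mem_commg ?inE.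
exact: section_gen.
Qed.

End OnBasis.
End Span.

Lemma uniq_map_inj (T1 T2 : eqType) (f : T1 -> T2) (s : seq T1) :
  uniq (map f s) -> {in s &, injective f}.
Proof.
elim: s => //= a s IH /andP[nfa us] b c; rewrite !inE.
case/predU1P=> [->|sb] /predU1P[->|sc] // fE; last exact: IH.
  by rewrite fE map_f in nfa.
by rewrite -fE map_f in nfa.
Qed.

Section Injectivity.
Variables (d p n : nat) (p_pr : prime p).
Hypothesis n_gt0 : (0 < n)%N.
Local Notation F := (freegroup d).
Local Notation gT := (free_quo d p_pr n.+1).
Local Notation Gs i := (lower_p_section d p_pr n.+1 i).
Local Notation Gg i := (lower_p_section_group d p_pr n.+1 i).
Local Notation T := [set: gT].
Implicit Types (x y : F) (z t c : gT) (i j k : nat) (u v w : seq 'I_d).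

Definition gsym_ker i w := [set z : gT | (z \in Gs i) && (gsym i z w == 0%R)].

Lemma mem_gsym_ker i w z :
  (z \in gsym_ker i w) = (z \in Gs i) && (gsym i z w == 0%R).
Proof. by rewrite in_set. Qed.

Lemma gsym_ker_group_set i w : 0 < i <= n -> size w <= i ->
  group_set (gsym_ker i w).
Proof.
move=> i_n wi; apply/group_setP; split=> [|z t]; rewrite !mem_gsym_ker.
  by rewrite group1 gsym1 ?eqxx.
move=> /andP[Gz /eqP z0] /andP[Gt /eqP t0].
by rewrite (groupM (Gz : z \in Gg i)) // gsymM // z0 t0 addr0 eqxx.
Qed.

Lemma gsym_expn i k z w : 0 < i -> i + k <= n -> size w <= i -> z \in Gs i ->
  gsym (i + k) (z ^+ (p ^ k)) w = gsym i z w.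
Proof.
move=> i0; elim: k => [|k IH] ik wi Gz; first by rewrite addn0 expn0 expg1.
rewrite expnSr expgM addnS gsym_exp ?IH //; try lia.
exact: section_expn.
Qed.

Lemma lead_lift_sym w c : 0 < size w <= n -> lead_lift w c ->
  (forall v, wlt v w -> gsym (size w) c v = 0%R) /\ gsym (size w) c w = 1%R.
Proof.
move=> wn [Lc [x [cx xw x1]]].
have Gc : c \in Gs (size w).
  by apply: (subsetP (lcn_section _)) Lc; case/andP: wn.
have Fx : lower_p_series p (size w) x.
  by apply/(mem_prj (n := n) p_pr); rewrite -?cx //; lia.
rewrite cx; split=> [v vw|].
  by rewrite gsym_prj ?(wlt_size vw) // /sym xw // div0z.
by rewrite gsym_prj // /sym x1 subnn expr0 divz1.
Qed.

Section LeadItems.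
Variable i : nat.
Hypothesis i_n : 0 < i <= n.

Definition lead_item (a : seq 'I_d * gT) :=
  [/\ a.2 \in Gs i, size a.1 <= i, forall v, wlt v a.1 -> gsym i a.2 v = 0%R
    & gsym i a.2 a.1 = 1%R].

(** Elements with distinct leading words are independent: the least leading
    word cannot be cancelled. *)
Lemma items_group_inj (E : seq (seq 'I_d * gT)) z :
    (forall a, a \in E -> lead_item a) ->
    (forall a b, a \in E -> b \in E -> a.1 = b.1 -> a = b) ->
    z \in items_group E <*> Gg i.+1 ->
    (forall w, size w <= i -> gsym i z w = 0%R) ->
  z \in Gs i.+1.
Proof.
have i0 : 0 < i by case/andP: i_n.
have [m] := ubnP (size E); elim: m => // m IH in E z * => Em leadE injE Ez z0.
have [E0|En0] := eqVneq E [::].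
  rewrite E0 (joing_idPr _) // in Ez; rewrite gen_subG.
  by apply/subsetP => t; rewrite inE.
have [a Ea amin] := ex_min (@wlt_trans d) (@wlt_total d) En0.
have [Ga ai ava a1] := leadE a Ea.
pose E' := [seq b <- E | b.1 != a.1].
pose K := (items_group E' <*> Gg i.+1)%G.
have sKG : K \subset Gs i.
  rewrite join_subG sectionS // andbT gen_subG; apply/subsetP => t.
  rewrite in_set => /mapP[b + ->]; rewrite mem_filter => /andP[_ Eb].
  by case: (leadE b Eb).
have sNK : Gs i.+1 \subset K by apply: (joing_subr _ (Gg i.+1)).
have nKa : <[a.2]> \subset 'N(K).
  rewrite -commg_subr; apply: subset_trans _ sNK.
  apply: subset_trans _ (section_commG i0).
  by rewrite commgSS ?subsetT // cycle_subG.
have : z \in <[a.2]> <*> K.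
  apply: subsetP Ez; rewrite join_subG (subset_trans sNK) ?joing_subr // andbT.
  rewrite gen_subG; apply/subsetP => t; rewrite in_set => /mapP[b Eb ->].
  have [ba|ba] := eqVneq b.1 a.1.
    by rewrite (injE b a Eb Ea ba) (subsetP (joing_subl _ _)) ?cycle_id.
  apply: (subsetP (joing_subr _ _)); apply: (subsetP (joing_subl _ _)).
  by apply: mem_gen; rewrite in_set map_f // mem_filter ba.
rewrite norm_joinEl // => /imset2P[_ k /cycleP[l ->] Kk zE].
have Gk : k \in Gs i by apply: subsetP Kk.
have Gal : a.2 ^+ l \in Gs i by apply: (groupX _ (Ga : _ \in Gg i)).
have k0 : gsym i k a.1 = 0%R.
  suff : K \subset gsym_ker i a.1.
    by move=> /subsetP/(_ k Kk); rewrite mem_gsym_ker => /andP[_ /eqP].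
  rewrite -[gsym_ker i _]/(gval (Group (gsym_ker_group_set i_n ai))).
  rewrite join_subG gen_subG /=; apply/andP; split; apply/subsetP => t; last first.
    move=> Gt; rewrite mem_gsym_ker gsym0 // eqxx andbT.
    exact: (subsetP (sectionS i0)).
  rewrite in_set => /mapP[b + ->]; rewrite mem_filter => /andP[ba Eb].
  have [Gb bi bvb _] := leadE b Eb.
  by rewrite mem_gsym_ker Gb bvb ?eqxx //; apply: amin.
have := z0 _ ai; rewrite zE gsymM // k0 addr0 gsymX // a1.
move/eqP; rewrite -(dvdn_pcharf (pchar_Fp p_pr)) => /dvdnP[q lE].
have zK : z \in K.
  rewrite zE groupM // lE mulnC expgM groupX // (subsetP sNK) //.
  exact: section_exp.
apply: (IH E') => //.
- rewrite size_filter -ltnS; apply: leq_trans _ Em; rewrite ltnS.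
  rewrite -(count_predC (fun b => b.1 == a.1) E) -[X in X < _]add0n ltn_add2r.
  by rewrite -has_count; apply/hasP; exists a.
- by move=> b; rewrite mem_filter => /andP[_]; apply: leadE.
- by move=> b c; rewrite !mem_filter => /andP[_ Eb] /andP[_ Ec]; apply: injE.
- by rewrite -zE.
- by rewrite -zE.
Qed.

End LeadItems.

(** The Magnus-Witt theorem for the lower p-series: it is induced by the
    powers of the ideal generated by p and the variables. *)
Theorem gsym_inj i z : 0 < i <= n -> z \in Gs i ->
  (forall w, size w <= i -> gsym i z w = 0%R) -> z \in Gs i.+1.
Proof.
move=> i_n Gz; have i0 : 0 < i by case/andP: i_n.
have [W [uW WP WL]] := lcn_basis d p_pr n_gt0.
have W_lcn a : a \in W -> a.2 \in 'L_(size a.1)(T) by case/WP => -[].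
have W_pos a : a \in W -> 0 < size a.1 by case/WP => _ /andP[].
have /subsetP/(_ z Gz) := section_span W_lcn W_pos WL i0.
apply: items_group_inj => // [a'|b1 b2].
  case/mapP=> a + ->; rewrite mem_filter => /andP[ai Wa].
  have [leada an] := WP a Wa.
  have [sv s1] := lead_lift_sym an leada.
  have Ga : a.2 \in Gs (size a.1).
    by apply: (subsetP (lcn_section _)) (W_lcn a Wa); apply: W_pos.
  have E v : size v <= size a.1 ->
      gsym i (a.2 ^+ (p ^ (i - size a.1))) v = gsym (size a.1) a.2 v.
    move=> va; rewrite -{1}(subnKC ai) gsym_expn ?W_pos //.
    by rewrite subnKC //; case/andP: i_n.
  split=> [||v va|]; [exact: (power_item_in W_lcn W_pos) | by [] | | ].
    by rewrite E; [apply: sv | apply: wlt_size va].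
  by rewrite E.
case/mapP=> a + -> /mapP [b + ->]; rewrite !mem_filter => /andP[_ Wa] /andP[_ Wb].
move=> /= ab; suff -> : a = b by [].
exact: uniq_map_inj uW _ _ Wa Wb ab.
Qed.

End Injectivity.

(** * Leading words and the growth of the layers *)

Section ConstantWords.
Variables (d p : nat) (p_pr : prime p).
Local Notation F := (freegroup d).
Implicit Types (x y : F) (l : 'I_d).
Local Open Scope ring_scope.

Lemma dim_expn i x : magnus_dim p i.+1 (x ^+ (p ^ i))%g.
Proof.
elim: i => [|i IH]; first by rewrite expn0 expg1; apply: dim_1.
by rewrite expnSr expgM; apply: dimX.
Qed.

Lemma nu_letterM l x y : nu (x * y)%g [:: l] = nu x [:: l] + nu y [:: l].
Proof.
rewrite nuM !serD serM !big_ord_recl big_ord0 /= !nu_nil.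
by rewrite mul0r mulr0 !addr0.
Qed.

Lemma nu_letterX l x k : nu (x ^+ k)%g [:: l] = nu x [:: l] *+ k.
Proof.
elim: k => [|k IH]; first by rewrite nu1 mulr0n.
by rewrite expgS nu_letterM IH mulrS.
Qed.

Lemma nu_gen_letter l : nu (fgenerator l) [:: l] = 1.
Proof. by rewrite nuE mu_gen addrC addKr /var eqxx. Qed.

(** The coefficients at the powers of a letter only depend on the image of
    the element under the retraction onto the subgroup of that letter. *)
Lemma retract_letter l x : exists k y, [/\ y = fgenerator l \/ y = (fgenerator l)^-1%g
  & forall m, mu x (nseq m l) = mu (y ^+ k)%g (nseq m l)].
Proof.
pose g := fgenerator l.
have muM_const u v u' v' : (forall m, mu u (nseq m l) = mu u' (nseq m l)) ->
    (forall m, mu v (nseq m l) = mu v' (nseq m l)) ->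
    forall m, mu (u * v)%g (nseq m l) = mu (u' * v')%g (nseq m l).
  move=> uE vE m; rewrite !muM !serM; apply: eq_bigr => i _.
  have im : (i <= m)%N by rewrite -[X in (_ <= X)%N](size_nseq m l) -ltnS.
  by rewrite take_nseq // drop_nseq uE vE.
elim/freegroup_ind: x => [|[j b] x [k [y [yE xE]]]].
  by exists 0%N, g; split=> //; left.
have [jl|jl] := eqVneq j l; last first.
  exists k, y; split=> // m; rewrite -[(y ^+ k)%g]mul1g; apply: muM_const xE _ => {}m.
  rewrite /mu /= mulr1 /mu_letter /=; case: b; case: m => [|m] //=.
    by rewrite /var_inv /= ifN // negb_and eq_sym jl.
  by rewrite serD ser1 /var eqseq_cons [l == j]eq_sym (negPf jl) addr0.
have letterE : fletter (j, b) = (if b then g^-1 else g)%g.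
  by rewrite jl; case: b => //; apply: val_inj.
have {}xE m : mu (fletter (j, b) * x)%g (nseq m l)
    = mu ((if b then g^-1 else g) * y ^+ k)%g (nseq m l).
  by rewrite letterE; apply: muM_const.
case: k xE => [|k] xE.
  exists 1%N, (if b then g^-1 else g)%g; split.
    by case: b {letterE xE}; auto.
  by move=> m; rewrite xE expg0 mulg1 expg1.
have [yb|yb] := eqVneq y (if b then g^-1 else g)%g.
  by exists k.+2, y; split=> // m; rewrite xE [in RHS]expgS -yb.
exists k, y; split=> // m; rewrite xE expgS mulgA.
suff -> : ((if b then g^-1 else g) * y = 1)%g by rewrite mul1g.
by case: yE yb => ->; case: b {letterE xE}; rewrite ?eqxx // ?mulgV ?mulVg.
Qed.

(** By [retract_letter] one may take for [x] a power of a letter. Its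
    exponent is, up to sign, the coefficient at the letter; if it is a
    multiple of [p ^ i] then [x] has dimension [i + 1], and
    all its symbols of degree [i] vanish. *)
Lemma sym_const i l m x : (0 < i)%N -> (m <= i)%N -> magnus_dim p i x ->
  sym p i x [:: l] = 0 -> sym p i x (nseq m l) = 0.
Proof.
move=> i0 mi Dx /eqP; case: m mi => [|m] mi; first by rewrite sym_nil.
have [k [y [yE xE]]] := retract_letter l x.
have nuE' j : nu x (nseq j l) = nu (y ^+ k)%g (nseq j l).
  by rewrite !nuE !serB xE.
rewrite sym_eq0 // (_ : size [:: l] = 1%N) // (nuE' 1%N) nu_letterX.
have ->: (p%:Z ^+ (i - 1).+1 %| nu y [:: l] *+ k)%Z = (p ^ i %| k)%N.
  have [->|->] : nu y [:: l] *+ k = k%:Z \/ nu y [:: l] *+ k = - k%:Z.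
    case: yE => ->; first by left; rewrite nu_gen_letter natz.
    right; have := nu_letterM l (fgenerator l) (fgenerator l)^-1%g.
    rewrite mulgV nu1 ser0 nu_gen_letter => /eqP; rewrite eq_sym addrC addr_eq0.
    by move/eqP->; rewrite mulNrn natz.
    by rewrite subn1 prednK // dvdzE abszX.
  by rewrite subn1 prednK // dvdzE abszN abszX.
case/dvdnP => q kE; apply/eqP; rewrite sym_eq0 // nuE' kE mulnC expgM.
have : magnus_dim p i.+1 ((y ^+ (p ^ i)) ^+ q)%g.
  elim: q {kE} => [|q IH]; first exact: dim1.
  by rewrite expgS; apply/dimM/IH/dim_expn.
by move/(_ (nseq m.+1 l)); rewrite size_nseq subSn.
Qed.

End ConstantWords.

(** The fibres of [f] are cosets of its kernel. *)
Lemma card_ker_Fp (gT : finGroupType) (p : nat) (p_pr : prime p)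
    (A : {group gT}) (f : gT -> 'F_p) z0 :
    (forall x y, x \in A -> y \in A -> f (x * y) = (f x + f y)%R) ->
    z0 \in A -> f z0 != 0%R ->
  #|A| = (p * #|[set z in A | f z == 0%R]|)%N.
Proof.
move=> fM Az0 fz0.
have fX x k : x \in A -> f (x ^+ k) = (f x *+ k)%R.
  move=> Ax; elim: k => [|k IH]; last by rewrite expgS fM ?groupX // IH mulrS.
  by apply: (addrI (f 1)); rewrite -fM ?group1 // mulg1 mulr0n addr0.
rewrite -sum1_card (partition_big f xpredT) //=.
rewrite (eq_bigr (fun _ => #|[set z in A | f z == 0%R]|)).
  by rewrite sum_nat_const card_Fp.
move=> k _; pose m : nat := nat_of_ord (k / f z0)%R.
have fm : f (z0 ^+ m) = k.
  by rewrite fX // -mulr_natr natr_Zp mulrC divfK.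
rewrite sum1dep_card -(card_imset _ (mulgI (z0 ^+ m))); apply: eq_card => z.
rewrite !inE; apply/andP/imsetP => [[Az /eqP fz]|[y]].
  exists ((z0 ^+ m)^-1 * z); last by rewrite mulKVg.
  rewrite inE groupM ?groupV ?groupX //=; apply/eqP.
  apply: (addrI (f (z0 ^+ m))); rewrite -fM ?groupM ?groupV ?groupX //.
  by rewrite mulKVg fm fz addr0.
rewrite inE => /andP[Ay /eqP fy] ->.
by rewrite fM ?groupM ?groupX // fm fy addr0.
Qed.

(** To be applied to the list of the values of a map whose fibres have at most
    [k] elements. *)
Lemma size_count_bound (S : eqType) k (s r : seq S) :
  {subset s <= r} -> (forall x, count_mem x s <= k) -> size s <= k * size r.
Proof.
elim: r s => [|a r IH] s sr sk; first by case: s sr {sk} => // b s /(_ b (mem_head _ _)).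
rewrite -(count_predC (pred1 a) s) mulnS leq_add // -size_filter; apply: IH => [x|x].
  by rewrite mem_filter /= => /andP[xa /sr]; rewrite inE (negPf xa).
by rewrite count_filter; apply: leq_trans (sk x); apply: sub_count => y /andP[].
Qed.

Section Leads.
Variables (d p n : nat) (p_pr : prime p).
Hypothesis n_gt0 : (0 < n)%N.
Local Notation gT := (free_quo d p_pr n.+1).
Local Notation prj := (free_proj p_pr n.+1).
Local Notation Gs i := (lower_p_section d p_pr n.+1 i).
Local Notation Gg i := (lower_p_section_group d p_pr n.+1 i).
Implicit Types (M K : {group gT}) (z t c : gT) (i j k : nat) (u v w : seq 'I_d).

Definition is_lead i M w := exists z,
  [/\ z \in M, z \in Gs i, gsym i z w != 0%R
    & forall v, wlt v w -> gsym i z v = 0%R].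

Definition leads i M := [seq w <- words d i | `[< is_lead i M w >]].

Lemma leads_uniq i M : uniq (leads i M).
Proof. by rewrite filter_uniq // words_uniq. Qed.

Lemma mem_leads i M w : reflect (is_lead i M w /\ size w <= i) (w \in leads i M).
Proof.
by rewrite mem_filter mem_words; apply: (iffP andP) => -[? ?]; split=> //; apply/asboolP.
Qed.

(** The coordinates are set to zero one at a time, in increasing order of
    the words. The word [w] divides the order by p exactly if some element
    on which the previous coordinates vanish has a nonzero one at [w]. *)
Lemma card_leads_chain i (A : {group gT}) (s : seq (seq 'I_d)) : 0 < i <= n ->
    A \subset Gs i -> sorted (@wlt d) s -> all (fun w => size w <= i) s ->
  #|A| = (p ^ count (fun w => `[< exists z, [/\ z \in A, gsym i z w != 0%R
            & forall v, v \in s -> wlt v w -> gsym i z v = 0%R] >]) s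
          * #|[set z in A | all (fun w => gsym i z w == 0%R) s]|)%N.
Proof.
move=> i_n; elim: s A => [|w s IH] A sAG.
  move=> _ _; rewrite mul1n; apply: eq_card => z.
  by rewrite inE andbT.
move=> /= ws /andP[wi si]; have s_sorted := path_sorted ws.
have w_min v : v \in s -> wlt w v.
  by move=> sv; have := order_path_min (@wlt_trans d) ws => /allP/(_ v sv).
have fM x y : x \in A -> y \in A -> gsym i (x * y) w = (gsym i x w + gsym i y w)%R.
  by move=> /(subsetP sAG) Gx /(subsetP sAG) Gy; apply: gsymM.
pose A0 := [set z in A | gsym i z w == 0%R].
have gA0 : group_set A0.
  apply/group_setP; split=> [|x y]; rewrite !inE.
    by rewrite group1 gsym1 ?eqxx.
  by move=> /andP[Ax /eqP x0] /andP[Ay /eqP y0]; rewrite groupM // fM // x0 y0 addr0 eqxx.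
have sA0G : Group gA0 \subset Gs i.
  by apply: subset_trans _ sAG; apply/subsetP => z; rewrite inE => /andP[].
have A0E z : (z \in Group gA0) = (z \in A) && (gsym i z w == 0%R) by rewrite inE.
have cardA : #|A| = (p ^ `[< exists z, [/\ z \in A, gsym i z w != 0%R
            & forall v, v \in w :: s -> wlt v w -> gsym i z v = 0%R] >] * #|A0|)%N.
  case: asboolP => [[z0 [Az0 fz0 _]]|nA].
    by rewrite expn1 (card_ker_Fp p_pr fM Az0 fz0).
  rewrite mul1n; apply: eq_card => z; rewrite inE; case Az: (z \in A) => //=.
  apply/esym/negPn/negP => fz; case: nA; exists z; split=> // v.
  rewrite inE => /predU1P[->|/w_min wv]; first by rewrite wlt_irr.
  by rewrite (wlt_asym wv).
rewrite cardA (IH (Group gA0)) // mulnA -expnD; congr (_ ^ (_ + _) * _)%N.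
  apply: eq_in_count => u su; apply: asbool_equiv_eq; split.
    case=> z []; rewrite A0E => /andP[Az z0] zu zv; exists z; split=> // v.
    by rewrite inE => /predU1P[-> _|]; [apply/eqP | apply: zv].
  case=> z [Az zu zv]; exists z; split=> // [|v sv].
    by rewrite A0E Az zv ?mem_head ?eqxx //; apply: w_min.
  by apply: zv; rewrite inE sv orbT.
by apply: eq_card => z; rewrite !inE andbA.
Qed.

(** Gaussian elimination: a layer of a subgroup has as many dimensions as
    leading words. *)
Lemma card_leads i M : 0 < i <= n ->
  #|M :&: Gs i| = (p ^ size (leads i M) * #|M :&: Gs i.+1|)%N.
Proof.
move=> i_n; have i0 : 0 < i by case/andP: i_n.
pose r := fun u v => ~~ @wlt d v u.
pose s := sort r (words d i).
have r_total : total r.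
  move=> u v; rewrite /r -negb_and; apply/andP => -[uv vu].
  by rewrite (wlt_asym uv) in vu.
have sE w : (w \in s) = (size w <= i) by rewrite mem_sort mem_words.
have s_sorted : sorted (@wlt d) s.
  have : sorted r s by apply: sort_sorted.
  have : uniq s by rewrite sort_uniq words_uniq.
  case: s {sE} => //= a s; elim: s a => //= b s IH a /andP[+ us] /andP[ab bs].
  rewrite inE negb_or => /andP[nab _]; rewrite IH // andbT.
  by have := wlt_total nab; rewrite (negPf ab) orbF.
have sAG : (M :&: Gg i)%G \subset Gs i by apply: subsetIr.
have sall : all (fun w => size w <= i) s by apply/allP => w; rewrite sE.
have /= -> := card_leads_chain i_n sAG s_sorted sall; congr (p ^ _ * _)%N.
  rewrite size_filter -(seq.permP (permEl (perm_sort r (words d i))) _) -/s.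
  apply: eq_in_count => w; rewrite sE => wi; apply: asbool_equiv_eq; split.
    case=> z [/setIP[Mz Gz] zw zv]; exists z; split=> // v vw.
    by apply: zv => //; rewrite sE (leq_trans (wlt_size vw)).
  by case=> z [Mz Gz zw zv]; exists z; split; rewrite ?in_setI ?Mz // => v _; apply: zv.
apply: eq_card => z; rewrite in_set !in_setI -andbA; case Mz: (z \in M) => //=.
apply/andP/idP => [[Gz /allP z0]|Gz].
  by apply: (gsym_inj n_gt0 i_n Gz) => w wi; apply/eqP/z0; rewrite sE.
split; first exact: (subsetP (sectionS i0)).
by apply/allP => w; rewrite sE => wi; rewrite gsym0.
Qed.

Section Growth.
Variables (i : nat) (M K : {group gT}).
Hypothesis i_n : 0 < i < n.
Hypothesis MK_exp : forall z, z \in M -> z ^+ p \in K.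
Hypothesis MK_comm : forall z t, z \in M -> [~ z, t] \in K.

Let i0 : 0 < i. Proof. by case/andP: i_n. Qed.
Let i_n' : 0 < i <= n. Proof. by case/andP: i_n => -> /ltnW. Qed.

(** The p-th power map does not change symbols. *)
Lemma leads_sub w : w \in leads i M -> w \in leads i.+1 K.
Proof.
case/mem_leads => -[z [Mz Gz zw zv]] wi; apply/mem_leads; split; last exact: leqW.
exists (z ^+ p); split; [exact: MK_exp | exact: section_exp | | ].
  by rewrite gsym_exp.
move=> v vw; rewrite gsym_exp ?zv //.
exact: leq_trans (wlt_size vw) wi.
Qed.

Lemma nil_leads : [::] \notin leads i M.
Proof.
by apply/negP => /mem_leads[[z [_ _]]]; rewrite /gsym sym_nil eqxx.
Qed.

(** The leading word contributed to the next layer by [w] and [l]: it comes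
    from the bracket with the letter, or from the p-th power when [w] is
    that letter and the bracket may be trivial. *)
Definition derived_word w (l : 'I_d) :=
  if w == [:: l] then w else
  if wlt (rcons w l) (l :: w) then rcons w l else l :: w.

Lemma rcons_cons_nseq w (l : 'I_d) : rcons w l = l :: w -> w = nseq (size w) l.
Proof. by elim: w => //= a w IH [-> /IH->]; rewrite size_nseq. Qed.

(** Otherwise [w] is a power of the letter [l] of length at least two, the
    coefficient at [l] vanishes as [l] precedes [w], and then so does the
    one at [w]. *)
Lemma lead_nonconstant w (l : 'I_d) : w \in leads i M -> w != [:: l] ->
  rcons w l != l :: w.
Proof.
move=> wM wl; apply: contraTneq wM => /rcons_cons_nseq wE.
apply/negP => /mem_leads[[z [_ Gz zw zv]] wi].
have w1 : 1 < size w.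
  case: w wE wl zw {zv wi} => [|a [|b w]] //= => [_ _|[->]].
    by rewrite /gsym sym_nil eqxx.
  by rewrite eqxx.
have Dz : magnus_dim p i (free_lift z).
  by apply/lower_dim/free_lift_in => //; case/andP: i_n' => -> /leqW.
move: zw; rewrite wE /gsym sym_const ?eqxx //.
by apply: zv; rewrite /wlt w1.
Qed.

Lemma derived_leads w l : w \in leads i M -> derived_word w l \in leads i.+1 K.
Proof.
move=> wM; rewrite /derived_word; case: ifPn => [_|wl]; first exact: leads_sub.
have ne := lead_nonconstant wM wl.
case/mem_leads: wM => -[z [Mz Gz zw zv]] wi.
have Kz := MK_comm (prj (fgenerator l)) Mz.
have Gz' := section_comm (prj (fgenerator l)) i0 Gz.
have rmul0 v : wlt v (rcons w l) -> rmul_var l (gsym i z) v = 0%R.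
  case/lastP: v => // v a; rewrite /rmul_var.
  case E : (rcons v a) => [//|b v']; move: (E); rewrite (lastI b) => /rcons_inj[<- <-].
  have [->|] := eqVneq a l; last by rewrite mul0r.
  move=> vw; rewrite zv ?mulr0 //; apply: contraLR vw => nvw.
  by rewrite -!cats1; apply: wlt_cat nvw _; rewrite wlt_irr.
have lmul0 v : wlt v (l :: w) -> lmul_var l (gsym i z) v = 0%R.
  case: v => //= a v; have [->|_ _] := eqVneq a l; last by rewrite mul0r.
  move=> vw; rewrite zv ?mulr0 //; apply: contraLR vw => nvw.
  by rewrite -[l :: v]cat1s -[l :: w]cat1s; apply: wlt_cat nvw; rewrite wlt_irr.
have rmulE : rmul_var l (gsym i z) (rcons w l) = gsym i z w.
  rewrite /rmul_var; case E : (rcons w l) => [|b v']; first by case: (w) E.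
  by move: (E); rewrite (lastI b) => /rcons_inj[<- <-]; rewrite eqxx mul1r.
have lmulE : lmul_var l (gsym i z) (l :: w) = gsym i z w by rewrite /= eqxx mul1r.
have szr : size (rcons w l) = (size w).+1 by rewrite size_rcons.
case: ifPn => [rl|nrl].
  apply/mem_leads; split; last by rewrite szr.
  exists [~ z, prj (fgenerator l)]; split=> //.
    by rewrite gsym_comm ?szr // rmulE lmul0 // subr0.
  move=> v vr; rewrite gsym_comm ?rmul0 ?lmul0 ?subr0 //.
    exact: wlt_trans rl.
  by rewrite (leq_trans (wlt_size vr)) ?szr.
have lr : wlt (l :: w) (rcons w l) by have := wlt_total ne; rewrite (negPf nrl).
apply/mem_leads; split=> //; exists [~ z, prj (fgenerator l)]; split=> //.
  by rewrite gsym_comm // lmulE rmul0 // sub0r oppr_eq0.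
move=> v vl; rewrite gsym_comm ?rmul0 ?lmul0 ?subr0 //.
  exact: wlt_trans lr.
by rewrite (leq_trans (wlt_size vl)).
Qed.

Lemma size_leads_mono : size (leads i M) <= size (leads i.+1 K).
Proof. by apply: uniq_leq_size (leads_uniq _ _) _ => w; apply: leads_sub. Qed.

(** Each leading word yields d leading words of the next layer, and each of
    these arises at most twice: by removing its first or its last letter. *)
Lemma growth : d * size (leads i M) <= 2 * size (leads i.+1 K).
Proof.
pose P := [seq (w, l) | w <- leads i M, l <- enum 'I_d].
pose D := [seq derived_word a.1 a.2 | a <- P].
have szP : size P = (size (leads i M) * d)%N.
  by rewrite size_allpairs -[X in (_ * X)%N = _]cardE card_ord.
rewrite mulnC -szP -(size_map (fun a => derived_word a.1 a.2)) -/D.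
have PM w l : (w, l) \in P -> w \in leads i M.
  by case/allpairsP => -[w' l'] /= [? _ [-> _]].
have uP : uniq P.
  apply: allpairs_uniq; rewrite ?leads_uniq ?enum_uniq //.
  by move=> [? ?] [? ?].
apply: size_count_bound => [w /mapP[[v l] /PM Mv ->]|w]; first exact: derived_leads.
rewrite count_map -size_filter.
pose cand := if w is a :: w' then
    if w' is [::] then [:: ([:: a], a)] else [:: (w', a); (belast a w', last a w')]
  else [::].
apply: leq_trans (_ : size cand <= 2); last by case: w @cand => [|? []].
apply: uniq_leq_size => [|[v l]]; first exact: filter_uniq.
rewrite mem_filter /= => /andP[/eqP vlw /PM Mv].
have v0 : v != [::] by apply: contraTneq Mv => ->; apply: nil_leads.
move: vlw; rewrite /derived_word /cand; case: eqP => [-> <-|_]; first by rewrite inE.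
case: ifP => _ <-; case: v v0 {Mv} => // a v _ /=.
  case E : (rcons v l) => [|b t]; first by case: v E.
  by rewrite -E belast_rcons last_rcons !inE eqxx orbT.
by rewrite inE eqxx.
Qed.

End Growth.
End Leads.

(** * Counting subgroups of an elementary abelian group *)

(** Abelian groups of order p ^ v are counted through their bases, on which
    the general linear group acts freely. *)
Lemma card_subgroups_unitmx (gT : finGroupType) (p m v : nat) (p_pr : prime p)
    (E : {group gT}) : p.-abelem E -> #|E| = (p ^ m)%N ->
  #|[set V : {group gT} | (V \subset E) && (#|V| == p ^ v)%N]|
    * #|[set A : 'M['F_p]_v | A \in unitmx]| <= p ^ (m * v).
Proof.
move=> abE cardE; have [E1|ntE] := eqVneq (E : {set gT}) 1.
  have m0 : m = 0%N.
    have := cardE; rewrite E1 cards1 => /esym/eqP.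
    by rewrite -[1%N](expn0 p) eqn_exp2l ?prime_gt1 // => /eqP.
  have [->|v0] := posnP v.
    rewrite muln0 expn0 (@leq_trans (1 * 1)) // leq_mul //.
      apply: (@leq_trans #|[set 1%G : {group gT}]|); last by rewrite cards1.
      apply/subset_leq_card/subsetP => V.
      rewrite !inE => /andP[_]; rewrite -trivg_card1 => /eqP V1.
      by apply/eqP/val_inj.
    by rewrite (leq_trans (max_card _)) // card_mx muln0.
  rewrite (_ : [set V | _] = set0) ?cards0 ?mul0n //.
  apply/setP => V; rewrite !inE E1; apply/negP => /andP[/trivgP-> /eqP].
  rewrite cards1 => /esym/eqP; rewrite -(expn0 p) eqn_exp2l ?prime_gt1 //.
  by rewrite -[_ == _]negbK -lt0n v0.
pose F := 'F_p; pose k := 'dim E.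
have dimE : k = m by rewrite /k (dim_abelemE abE ntE) cardE pfactorK.
pose Phi (B : 'M[F]_(v, k)) : {set gT} := rVabelem abE ntE @* rowg B.
pose subs := [set V : {group gT} | (V \subset E) && (#|V| == p ^ v)%N].
have basis (V : {group gT}) : V \in subs ->
    exists2 B : 'M[F]_(v, k), row_free B & Phi B = V.
  rewrite inE => /andP[sVE /eqP cardV].
  pose L := (abelem_rV abE ntE @* V)%G.
  have UL : rowg (rowg_mx L) = L by apply: rowg_mxK.
  have rU : \rank (rowg_mx L) = v.
    apply/eqP; rewrite -(eqn_exp2l _ _ (prime_gt1 p_pr)) -{1}(card_Fp p_pr).
    by rewrite -card_rowg UL card_injm ?abelem_rV_injm // cardV.
  have [B [fB eB]] : exists B : 'M[F]_(v, k), row_free B /\ (B :=: rowg_mx L)%MS.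
    by rewrite -rU; exists (row_base (rowg_mx L)); split;
       [apply: row_base_free | apply: eq_row_base].
  exists B => //; rewrite /Phi (eq_rowg eB) UL /=.
  exact: abelem_rV_mK.
pose units := [set A : 'M[F]_v | A \in unitmx].
have fibre (V : {group gT}) : V \in subs ->
    #|units| <= #|[set B : 'M[F]_(v, k) | Phi B == V]|.
  case/basis => B fB BV.
  have injA : {in units &, injective (fun A : 'M[F]_v => A *m B)%R}.
    by move=> A1 A2 _ _; apply: row_free_inj.
  rewrite -(card_in_imset injA).
  apply/subset_leq_card/subsetP => _ /imsetP[A + ->]; rewrite !inE => uA.
  rewrite -BV /Phi (eq_rowg (_ : ((A *m B)%R :=: B)%MS)) //.
  by apply: eqmxMfull; rewrite row_full_unit.
apply: (@leq_trans (\sum_(V in subs) #|[set B : 'M[F]_(v, k) | Phi B == V]|)).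
  by rewrite -sum_nat_const; apply: leq_sum.
apply: (@leq_trans #|{: 'M[F]_(v, k)}|); last first.
  by rewrite card_mx card_Fp // dimE mulnC.
rewrite -[X in _ <= X]sum1_card (bigID (fun B => [exists V in subs, Phi B == V])) /=.
rewrite (leq_trans _ (leq_addr _ _)) //.
rewrite (eq_bigr (fun V : {group gT} => \sum_(B : 'M[F]_(v, k) | Phi B == V) 1)%N); last first.
  by move=> V _; rewrite sum1dep_card.
rewrite (exchange_big_dep (fun B => [exists V in subs, Phi B == V])) /=; last first.
  by move=> V B sV PV; apply/exists_inP; exists V.
apply: leq_sum => B _; rewrite sum1dep_card.
apply/card_le1_eqP => V1 V2; rewrite !inE => /andP[_ /eqP P1] /andP[_ /eqP P2].
by apply/val_inj; rewrite /= -P1 -P2.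
Qed.

(** The proportion of invertible matrices is the product of the [1 - p ^ -i]
    for [i <= v], which stays above a quarter. *)
Lemma card_unitmx_ge (p v : nat) (p_pr : prime p) :
  p ^ (v * v) <= 4 * #|[set A : 'M['F_p]_v | A \in unitmx]|.
Proof.
case: v => [|v].
  rewrite (leq_trans (_ : _ <= 4 * 1)) // leq_mul2l /=.
  by apply/card_gt0P; exists 1%:M%R; rewrite inE unitmx1.
have p2 := prime_gt1 p_pr.
have -> : #|[set A : 'M['F_p]_v.+1 | A \in unitmx]| = #|'GL_v.+1['F_p]%g|.
  rewrite -[RHS](card_imset _ val_inj); apply: eq_card => A; rewrite inE.
  apply/idP/imsetP => [uA|[g _ ->]]; last exact: valP.
  by exists (Sub A uA); rewrite ?inE // SubK.
rewrite card_GL // card_Fp //.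
have prodE k : (\prod_(1 <= i < k.+1) p ^ i = p ^ 'C(k.+1, 2))%N.
  elim: k => [|k IH]; first by rewrite big_nil.
  by rewrite big_nat_recr //= IH -expnD [in RHS]binS bin1.
(* The product of the [1 - p ^ -i] for [i <= k] is at least
   [1 / 4 + p ^ -(k + 1)]: the extra term lets the induction go through. *)
have bound k : (0 < k)%N -> (p ^ k.+1 + 4) * \prod_(1 <= i < k.+1) p ^ i
    <= 4 * p ^ k.+1 * \prod_(1 <= i < k.+1) (p ^ i - 1).
  elim: k => // -[_ _|k IH _].
    by rewrite !big_nat1 expn1; nia.
  rewrite !(@big_nat_recr _ _ _ k.+2) //=.
  set P := (\prod_(1 <= i < k.+2) p ^ i)%N.
  set P' := (\prod_(1 <= i < k.+2) (p ^ i - 1))%N.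
  have {IH} := IH isT; rewrite -/P -/P'; rewrite (expnS p k.+2).
  have : 2 * 2 <= p ^ k.+2.
    by rewrite -[(2 * 2)%N]/(2 ^ 2)%N (@leq_trans (2 ^ k.+2)) ?leq_exp2r ?leq_exp2l.
  move: (p ^ k.+2)%N => q q4 IH.
  have step : (p * q + 4) * q <= p * ((q + 4) * (q - 1)) by nia.
  apply: (@leq_trans (p * ((q + 4) * P * (q - 1)))).
    have := leq_mul step (leqnn P); nia.
  have := leq_mul (leqnn p) (leq_mul IH (leqnn (q - 1))); nia.
have := bound v.+1 isT; rewrite prodE.
rewrite (_ : (v.+1 * v.+1 = 'C(v.+1, 2) + 'C(v.+2, 2))%N); last first.
  rewrite !bin2 /=; have := odd_double_half (v.+1 * v).
  by have := odd_double_half (v.+2 * v.+1); rewrite !oddM /=; lia.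
rewrite expnD => b.
have q0 : 0 < p ^ v.+2 by rewrite expn_gt0 prime_gt0.
rewrite mulnCA leq_mul2l; apply/orP; right.
rewrite -(leq_pmul2l q0); apply: leq_trans (leq_trans _ b) _; nia.
Qed.

Section SubgroupCounts.
Variables (gT : finGroupType) (p m : nat) (E : {group gT}).
Hypotheses (p_pr : prime p) (abE : p.-abelem E) (cardE : #|E| = (p ^ m)%N).

Definition subgroups_of_order v :=
  [set V : {group gT} | (V \subset E) && (#|V| == p ^ v)%N].

(** A subgroup of order [p ^ v] has [v] generators. *)
Lemma card_subgroups_crude v : #|subgroups_of_order v| <= p ^ (m * v).
Proof.
apply: leq_trans (card_subgroups_unitmx v p_pr abE cardE).
rewrite leq_pmulr //; apply/card_gt0P; exists 1%:M%R.
by rewrite inE unitmx1.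
Qed.

Lemma card_subgroups_le v : v <= m ->
  #|subgroups_of_order v| <= 4 * p ^ (v * (m - v)).
Proof.
move=> vm; have := card_subgroups_unitmx v p_pr abE cardE.
have := card_unitmx_ge v p_pr; rewrite -/(subgroups_of_order v).
have -> : (m * v = v * v + v * (m - v))%N by nia.
have q0 : 0 < p ^ (v * v) by rewrite expn_gt0 prime_gt0.
rewrite expnD -(leq_pmul2l q0); nia.
Qed.

(** The graphs of the homomorphisms between two complements. *)
Lemma card_subgroups_ge a b : (a + b)%N = m ->
  p ^ (a * b) <= #|[set V : {group gT} | V \subset E]|.
Proof.
move=> abm; have [E1|ntE] := eqVneq (E : {set gT}) 1.
  have m0 : m = 0%N.
    have := cardE; rewrite E1 cards1 => /esym/eqP.
    by rewrite -[1%N](expn0 p) eqn_exp2l ?prime_gt1 // => /eqP.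
  rewrite (_ : a = 0%N); last by lia.
  by apply/card_gt0P; exists E; rewrite inE.
have dimE : 'dim E = (a + b)%N.
  by rewrite (dim_abelemE abE ntE) cardE pfactorK // abm.
pose Phi (B : 'M['F_p]_(a, 'dim E)) : {group gT} :=
  (rVabelem abE ntE @* rowg B)%G.
pose graph (A : 'M['F_p]_(a, b)) : 'M['F_p]_(a, 'dim E) :=
  castmx (erefl, esym dimE) (row_mx 1%:M A)%R.
have Phi_inj : injective (Phi \o graph).
  move=> A1 A2 /(congr1 (fun V : {group gT} => V : {set gT})) /=.
  move/rVabelem_minj => eqg.
  have : (graph A1 <= graph A2)%MS.
    by rewrite -rowgS eqg.
  case/submxP => D; rewrite /graph => /(congr1 (castmx (erefl, dimE))).
  rewrite castmxKV -[in RHS](castmx_id (erefl, erefl) D).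
  rewrite (_ : castmx _ (_ *m _)%R = D *m row_mx 1%:M A2)%R; last first.
    rewrite castmx_id; move: (esym dimE) (dimE); case: _ / => e.
    by rewrite (eq_axiomK e) !castmx_id.
  rewrite mul_mx_row mulmx1 => /eq_row_mx[<-].
  by rewrite mul1mx.
have := card_imset predT Phi_inj; rewrite card_mx card_Fp // => <-.
apply/subset_leq_card/subsetP => _ /imsetP[A _ ->]; rewrite inE /=.
exact: sub_rVabelem.
Qed.

End SubgroupCounts.

Local Close Scope group_scope.

(** * Estimates of exponents *)

Lemma square_le_exp2 N : 54 <= N -> 2 * (N * N.+1) <= 2 ^ (N %/ 4).
Proof.
move=> N54; have : 13 <= N %/ 4 by lia.
have : N <= 4 * (N %/ 4) + 3 by lia.
move: (N %/ 4) => k Nk k13.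
apply: (@leq_trans (2 * ((4 * k + 3) * (4 * k + 4)))); first by nia.
elim: k k13 {Nk} => // k IH; rewrite leq_eqVlt => /predU1P[[<-] //|].
rewrite ltnS => k13; have {}IH := IH k13.
have BA : (4 * k.+1 + 3) * (4 * k.+1 + 4) <= 2 * ((4 * k + 3) * (4 * k + 4)) by nia.
by rewrite expnS leq_mul2l (leq_trans BA IH).
Qed.

(** The exponents that come up when a normal subgroup has a layer of dimension
    [u] just above the last one: [D] and [N] are the dimensions of these two
    layers of the whole group. *)
Lemma layer_exponents D N u : 5 * D <= 2 * N -> 54 <= N -> 0 < u <= D ->
  u * D.+1 + (N + 3) %/ 4 + N %/ 4 <= D + (3 * u + 1) %/ 4 * (N - (3 * u + 1) %/ 4).
Proof.
move=> DN N54 /andP[u0 uD].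
have : (N + 3) %/ 4 + N %/ 4 <= N %/ 2 + 1 by lia.
set a := (N + 3) %/ 4 + _; rewrite -addnA -/a; move: a => a aN.
set h := (3 * u + 1) %/ 4.
(* For small [u] the estimate of [h] below loses too much. *)
have [u5|u5] := leqP 5 u; last first.
  have : [|| u == 1, u == 2, u == 3 | u == 4]%N by lia.
  case/or4P => /eqP uE; move: uD; rewrite /h uE => uD.
  - by have -> : (3 * 1 + 1) %/ 4 = 1 by []; lia.
  - by have -> : (3 * 2 + 1) %/ 4 = 1 by []; lia.
  - by have -> : (3 * 3 + 1) %/ 4 = 2 by []; lia.
  - by have -> : (3 * 4 + 1) %/ 4 = 3 by []; lia.
have h1 : 3 * u - 2 <= 4 * h by rewrite /h; lia.
have h2 : 4 * h <= 3 * u + 1 by rewrite /h; lia.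
have : 14 * N - 5 <= 20 * (N - h) by lia.
move: (N - h) => t ht.
have : (3 * u - 2) * (14 * N - 5) <= 80 * (h * t).
  by have := leq_mul h1 ht; lia.
have : 5 * (u * D) <= 2 * (u * N) - 2 * N + 5 * D by nia.
nia.
Qed.

(** The integer part of a quarter of a square. *)
Definition quarter_square x := x./2 * uphalf x.

(** The product of two numbers of given sum is greatest when they are as
    close as possible. *)
Lemma quarter_square_max e x : e <= x -> e * (x - e) <= quarter_square x.
Proof.
rewrite /quarter_square => ex; have := odd_double_half x.
rewrite uphalf_half; move: (x./2) (odd x) => y b xE.
have : (x - e) + e = x by lia.
move: (x - e) => f fE; have [ey|/ltnW ye] := leqP e y.
  have [t tE] : exists t, y = e + t by exists (y - e); lia.
  by case: b xE => /= xE; nia.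
have [t tE] : exists t, e = y + t by exists (e - y); lia.
have ft : f + t = b + y by lia.
rewrite tE -ft mulnDl mulnDr leq_add2l mulnC leq_mul2r.
by case: t {tE} ft => //= t ft; case: (b) ft => /=; lia.
Qed.

Lemma quarter_square_leq x y : x <= y -> quarter_square x <= quarter_square y.
Proof.
move=> xy; apply: leq_mul; first exact: half_leq.
by apply: uphalf_leq.
Qed.

Lemma quarter_square_sub h x : 2 * h <= x ->
  quarter_square x = h * (x - h) + quarter_square (x - 2 * h).
Proof.
move=> hx; have [z ->] : exists z, x = z + 2 * h by exists (x - 2 * h); lia.
rewrite addnK /quarter_square !uphalf_half mul2n oddD odd_double addbF.
rewrite halfD odd_double andbF add0n doubleK; have := odd_double_half z.
move: (z./2) (odd z) => y b zE; rewrite (_ : z + h.*2 - h = z + h); last by lia.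
by rewrite -zE; case: b {zE} => /=; nia.
Qed.

Local Open Scope group_scope.

(** * Counting normal subgroups layer by layer *)

(** Lift a basis of the elementary abelian quotient. *)
Lemma abelem_generators (gT : finGroupType) (p r : nat) (p_pr : prime p)
    (M K : {group gT}) : K <| M -> p.-abelem (M / K) -> #|M : K| <= p ^ r ->
  exists R : {set gT}, [/\ R \subset M, #|R| <= r & M \subset <<R>> <*> K].
Proof.
move=> /andP[sKM nKM] abQ ind.
have [B BQ cardB] := grank_witness (M / K).
have sBQ : B \subset M / K by rewrite -BQ subset_gen.
pose R := [set repr (b : coset_of K) | b in B].
have sRM : R \subset M.
  apply/subsetP => _ /imsetP[b /(subsetP sBQ) /morphimP[x Nx Mx ->] ->].
  have : repr (coset K x) \in K :* x.
    by rewrite -[K :* x](val_coset Nx) mem_repr_coset.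
  by case/rcosetP => k Kk ->; rewrite groupM // (subsetP sKM).
have RB : coset K @: R = B.
  apply/setP => b; apply/imsetP/idP => [[_ /imsetP[c Bc ->] ->]|Bb].
    by rewrite coset_reprK.
  exists (repr b); last by rewrite coset_reprK.
  exact: imset_f.
exists R; split=> //.
  rewrite (leq_trans (leq_imset_card _ _)) // cardB.
  rewrite grank_abelian ?(abelem_abelian abQ) // (rank_abelem abQ).
  rewrite -(leq_exp2l _ _ (prime_gt1 p_pr)).
  by rewrite -(card_pgroup (abelem_pgroup abQ)) card_quotient.
have nKR : R \subset 'N(K) by apply: subset_trans sRM nKM.
have sgRM : <<R>> \subset M by rewrite gen_subG.
have nKgR : <<R>> \subset 'N(K) by rewrite gen_subG.
rewrite joingC norm_joinEr // -quotientSK // quotient_gen //.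
by rewrite [R / K]morphimEsub // RB BQ.
Qed.

(** The counting takes place in any finite group with a descending central
    filtration of elementary abelian layers, together with a function [lev]
    that gives the dimension of the trace of a subgroup on each layer, and
    that grows by the factor [d / 2] when a subgroup is replaced by its
    brackets and p-th powers. *)
Section Layers.
Variables (gT : finGroupType) (d p n : nat) (G_ : nat -> {group gT}).
Variable lev : nat -> {group gT} -> nat.
Local Notation T := [set: gT].
Implicit Types (M N V W : {group gT}) (i j k e u : nat).

Hypothesis p_pr : prime p.
Hypothesis G1 : G_ 1 :=: T.
Hypothesis Glast : G_ n.+1 :=: 1.
Hypothesis GS : forall i, 0 < i -> G_ i.+1 \subset G_ i.
Hypothesis Gnormal : forall i, G_ i <| T.
Hypothesis Gexp : forall i z, 0 < i -> z \in G_ i -> z ^+ p \in G_ i.+1.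
Hypothesis Gcomm : forall i z t, 0 < i -> z \in G_ i -> [~ z, t] \in G_ i.+1.
Hypothesis card_lev : forall i M, 0 < i <= n ->
  #|M :&: G_ i| = (p ^ lev i M * #|M :&: G_ i.+1|)%N.
Hypothesis lev_mono : forall i M N, 0 < i < n ->
  (forall z, z \in M -> z ^+ p \in N) ->
  (forall z t, z \in M -> [~ z, t] \in N) -> lev i M <= lev i.+1 N.
Hypothesis lev_growth : forall i M N, 0 < i < n ->
  (forall z, z \in M -> z ^+ p \in N) ->
  (forall z t, z \in M -> [~ z, t] \in N) -> d * lev i M <= 2 * lev i.+1 N.

Definition rk i := lev i [set: gT]%G.

Let p_gt0 : 0 < p. Proof. exact: prime_gt0. Qed.
Let p_gt1 : 1 < p. Proof. exact: prime_gt1. Qed.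

Lemma G_leq i j : 0 < i <= j -> G_ j \subset G_ i.
Proof.
case/andP=> i0; elim: j => [|j IH]; first by rewrite leqn0 => /eqP->.
rewrite leq_eqVlt => /predU1P[->//|]; rewrite ltnS => ij.
by apply: subset_trans (GS _) (IH ij); apply: leq_trans ij.
Qed.

Lemma lev_eq i M N : 0 < i <= n -> M :&: G_ i = N :&: G_ i -> lev i M = lev i N.
Proof.
move=> i_n MN; have i0 : 0 < i by case/andP: i_n.
have MNS : M :&: G_ i.+1 = N :&: G_ i.+1.
  by rewrite -(setIidPr (GS i0)) !setIA MN.
have := card_lev M i_n; rewrite MN (card_lev N) // MNS => /eqP.
by rewrite eqn_pmul2r // eqn_exp2l // => /eqP.
Qed.

Lemma lev_rk i M : 0 < i <= n -> G_ i \subset M -> lev i M = rk i.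
Proof.
by move=> i_n GM; apply: lev_eq => //; rewrite setTI; apply/setIidPr.
Qed.

Lemma lev_eq0 i M : 0 < i <= n -> M \subset G_ i.+1 -> lev i M = 0%N.
Proof.
move=> i_n MG; have i0 : 0 < i by case/andP: i_n.
have := card_lev M i_n; rewrite (setIidPl MG) (setIidPl (subset_trans MG (GS i0))).
rewrite -[X in X = _]mul1n => /eqP; rewrite eqn_pmul2r // -(expn0 p).
by rewrite eqn_exp2l // => /eqP.
Qed.

Lemma card_layers i M : 0 < i <= n.+1 ->
  #|M :&: G_ i| = (p ^ \sum_(i <= j < n.+1) lev j M)%N.
Proof.
case/andP=> i0 i_n; move: {2}(n.+1 - i)%N (erefl (n.+1 - i)%N) => m.
elim: m => [|m IH] in i i0 i_n *.
  move=> i_eq; have -> : i = n.+1 by lia.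
  by rewrite Glast (setIidPr (sub1G _)) cards1 big_geq.
move=> m_eq; rewrite big_ltn; last lia.
by rewrite expnD card_lev ?IH //; lia.
Qed.

Lemma card_factor i : 0 < i <= n -> #|G_ i| = (p ^ rk i * #|G_ i.+1|)%N.
Proof. by move=> i_n; have := card_lev [set: gT]%G i_n; rewrite !setTI. Qed.

(** The relative Frattini subgroup of a normal subgroup. Any other normal
    subgroup with the same product with a layer has to contain it
    ([verbal_over]). *)
Definition verbal M : {group gT} :=
  (<<[set z ^+ p | z in M]>> <*> [~: M, T])%G.

Lemma verbal_exp M z : z \in M -> z ^+ p \in verbal M.
Proof.
move=> Mz; rewrite (subsetP (joing_subl _ _)) // mem_gen //.
by apply/imsetP; exists z.
Qed.

Lemma verbal_comm M z t : z \in M -> [~ z, t] \in verbal M.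
Proof.
by move=> Mz; rewrite (subsetP (joing_subr _ _)) // mem_commg ?inE.
Qed.

Lemma verbal_min M N : (forall z, z \in M -> z ^+ p \in N) ->
  (forall z t, z \in M -> [~ z, t] \in N) -> verbal M \subset N.
Proof.
move=> MX MR; rewrite join_subG !gen_subG; apply/andP; split.
  by apply/subsetP => _ /imsetP[z Mz ->]; apply: MX.
by apply/subsetP => _ /imset2P[z t Mz _ ->]; apply: MR.
Qed.

Lemma verbal_sub M : M <| T -> verbal M \subset M.
Proof.
move=> /andP[_ nM]; apply: verbal_min => z; first by move=> *; apply: groupX.
move=> t Mz; rewrite commgEl groupM ?groupV // memJ_norm //.
by rewrite (subsetP nM) ?inE.
Qed.

Lemma verbal_norm M : M <| T -> T \subset 'N(verbal M).
Proof.
move=> /andP[_ nMT]; apply: normsY; last exact: commg_normr.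
apply: norms_gen; apply/subsetP => t _; rewrite inE; apply/subsetP => z.
case/imsetP => _ /imsetP[y My ->] ->; rewrite conjXg; apply/imsetP.
by exists (y ^ t); rewrite // memJ_norm // (subsetP nMT) ?inE.
Qed.

Section Fibre.
Variables (k : nat) (M : {group gT}).
Hypothesis k_n : 1 < k <= n.
Hypothesis nM : M <| T.
Hypothesis GkM : G_ k \subset M.
Hypothesis MG2 : M \subset G_ 2.

Let k0 : 0 < k. Proof. by case/andP: k_n => /ltnW. Qed.

Let K := (verbal M <*> G_ k)%G.

Lemma joined_verbal_sub : K \subset M.
Proof. by rewrite join_subG verbal_sub. Qed.

Lemma joined_verbal_norm : T \subset 'N(K).
Proof. by rewrite normsY ?verbal_norm //; have /andP[] := Gnormal k. Qed.

(** The relative Frattini quotient is no larger than the top layer of [M],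
    because each layer of the relative Frattini subgroup is at least as
    large as the preceding layer of [M]. *)
Lemma index_joined_verbal : #|M : K| <= p ^ lev k.-1 M.
Proof.
have n_gt0 : 0 < n by case/andP: k_n => k1 /(leq_trans (ltnW k1)).
have cardM : #|M| = (p ^ \sum_(1 <= j < n.+1) lev j M)%N.
  by rewrite -(@card_layers 1) // G1 setIT.
have cardK : #|K| = (p ^ \sum_(1 <= j < n.+1) lev j K)%N.
  by rewrite -(@card_layers 1) // G1 setIT.
have Kpos : 0 < #|K| := cardG_gt0 K.
rewrite -(leq_pmul2l Kpos) Lagrange ?joined_verbal_sub // cardM cardK -expnD.
rewrite leq_exp2l //.
rewrite (@big_cat_nat _ _ _ k 1 n.+1 _ (fun j => lev j M)) /=; try lia.
rewrite (@big_cat_nat _ _ _ k 1 n.+1 _ (fun j => lev j K)) /=; try lia.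
have -> : (\sum_(k <= j < n.+1) lev j M = \sum_(k <= j < n.+1) lev j K)%N.
  apply: eq_big_nat => j /andP[kj jn]; rewrite !lev_rk //; try lia.
    by apply: subset_trans (joing_subr _ (G_ k)); apply: G_leq; lia.
  by apply: subset_trans GkM; apply: G_leq; lia.
rewrite addnAC leq_add2r.
have [l kE] : exists l, k = l.+2 by exists k.-2; lia.
rewrite kE big_nat_recr //= leq_add2r [X in _ <= X]big_ltn //.
rewrite (leq_trans _ (leq_addl _ _)) // !big_add1 /=.
rewrite [X in X <= _]big_nat [X in _ <= X]big_nat; apply: leq_sum => j /andP[_ jl].
apply: lev_mono => [|z Mz|z t Mz]; first lia.
  by apply: (subsetP (joing_subl _ (G_ k))); apply: verbal_exp.
by apply: (subsetP (joing_subl _ (G_ k))); apply: verbal_comm.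
Qed.

Lemma fibre_generators : exists R : {set gT},
  [/\ R \subset M, #|R| <= lev k.-1 M & M \subset <<R>> <*> K].
Proof.
apply: (abelem_generators p_pr) index_joined_verbal.
  rewrite /normal joined_verbal_sub; apply: subset_trans (joined_verbal_norm).
  exact: subsetT.
have nKT : K <| T by rewrite /normal subsetT joined_verbal_norm.
have sVK : verbal M \subset K by apply: joing_subl.
apply/(abelemP p_pr); split.
  apply/centsP => _ /morphimP[x _ Mx ->] _ /morphimP[y _ My ->].
  by apply/(coset_commute nKT); apply: (subsetP sVK); apply: verbal_comm.
move=> _ /morphimP[x _ Mx ->]; rewrite -(coset_expE nKT); apply/eqP.
by rewrite (coset_eq1 nKT); apply: (subsetP sVK); apply: verbal_exp.
Qed.

(** Modulo [G_ k.+1], which [N] contains, the layer [G_ k] is central and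
    killed by [p]; so an element of [M] may be corrected by an element of
    [G_ k] to lie in [N] without any change in its brackets and p-th power. *)
Lemma verbal_over N : N <| T -> G_ k.+1 \subset N -> N <*> G_ k = M ->
  verbal M \subset N.
Proof.
move=> nN GN NM; have nGk := Gnormal k; have /andP[_ nGk1] := Gnormal k.+1.
have NMM : M = N * G_ k :> {set gT}.
  rewrite -NM norm_joinEr //; have /andP[_ /(subset_trans (subsetT _))] := nN.
  exact.
have nGT := Gnormal k.+1.
apply: verbal_min => [z|z t]; rewrite NMM => /imset2P[a b Na Gb ->].
  rewrite (mem_modulo nGT GN (_ : _ = coset _ (a ^+ p * b ^+ p))).
    by apply: groupM; [apply: groupX | rewrite (subsetP GN) // Gexp].
  rewrite !(coset_expE nGT, coset_mulE nGT) expgMn //.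
  by apply: commute_sym; apply/(coset_commute nGT); apply: Gcomm.
have nNJ (x y : gT) : x \in N -> x ^ y \in N.
  by move=> Nx; rewrite memJ_norm //; have /andP[_ /subsetP->] := nN; rewrite ?inE.
rewrite commMgJ groupM ?nNJ //.
  by rewrite commgEl groupM ?groupV ?nNJ.
by rewrite (subsetP GN) // Gcomm.
Qed.

Definition fibre V : {set {group gT}} :=
  [set N : {group gT} | [&& N <| T, G_ k.+1 \subset N, (N <*> G_ k)%G == M
                          & (N :&: G_ k)%G == V]].

(** For a generator [m] of [M] modulo [K], the elements [z] of [G_ k] with
    [m * z] in [N] form a coset of [V]. These cosets determine [N]: an
    element common to two members for each generator, together with [V] and
    the relative Frattini subgroup, generates both. *)
Lemma card_fibre V : #|fibre V| <= #|G_ k : V| ^ lev k.-1 M.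
Proof.
have [->|/set0Pn[N0 N0V]] := eqVneq (fibre V) set0; first by rewrite cards0.
have [R [sRM cardR genR]] := fibre_generators.
have VG : V \subset G_ k.
  by move: N0V; rewrite inE => /and4P[_ _ _ /eqP<-]; apply: subsetIr.
pose trace (N : {group gT}) : {ffun gT -> {set gT}} :=
  [ffun m => if m \in R then (m^-1 *: N) :&: G_ k else set0].
have traceP N m : N \in fibre V -> m \in M ->
    exists2 z, z \in G_ k & (m^-1 *: N) :&: G_ k = z *: V.
  rewrite inE => /and4P[nN GN /eqP NM /eqP NV].
  have NMM : M = N * G_ k :> {set gT}.
    rewrite -NM /= norm_joinEr //; have /andP[_ nNT] := nN.
    by apply: subset_trans nNT; apply: subsetT.
  rewrite NMM => /imset2P[a b Na Gb ->]; exists b^-1; first by rewrite groupV.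
  rewrite -NV /=; apply/setP => x; rewrite inE !mem_lcoset !invgK inE.
  by rewrite (groupMl _ Gb) -mulgA groupMl.
have trace_lcosets N m : N \in fibre V -> m \in R -> trace N m \in lcosets V (G_ k).
  move=> FN Rm; rewrite ffunE Rm; have [|z Gz ->] := traceP N m FN.
    exact: (subsetP sRM).
  by apply/lcosetsP; exists z.
have trace_inj : {in fibre V &, injective trace}.
  move=> N1 N2 F1 F2 /ffunP eqt.
  pose N := (N1 :&: N2)%G.
  have [nN1 GN1 NM1 NV1] : [/\ N1 <| T, G_ k.+1 \subset N1, N1 <*> G_ k = M & N1 :&: G_ k = V].
    by move: F1; rewrite inE => /and4P[? ? /eqP/(congr1 val)/= ? /eqP/(congr1 val)/= ?].
  have [nN2 GN2 NM2 NV2] : [/\ N2 <| T, G_ k.+1 \subset N2, N2 <*> G_ k = M & N2 :&: G_ k = V].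
    by move: F2; rewrite inE => /and4P[? ? /eqP/(congr1 val)/= ? /eqP/(congr1 val)/= ?].
  have KN : verbal M \subset N.
    by rewrite subsetI; apply/andP; split; apply: verbal_over.
  have RN : R \subset N <*> G_ k.
    apply/subsetP => m Rm; have := eqt m; rewrite !ffunE Rm => eqm.
    have [|z Gz zE] := traceP N1 m F1; first exact: (subsetP sRM).
    have : z \in z *: V by rewrite mem_lcoset mulVg group1.
    rewrite -{1}zE inE mem_lcoset invgK => /andP[N1mz _].
    have : z \in z *: V by rewrite mem_lcoset mulVg group1.
    rewrite -zE eqm inE mem_lcoset invgK => /andP[N2mz _].
    have Nmz : m * z \in N by rewrite inE N1mz.
    rewrite -[m](mulgK z) groupM //; first by rewrite (subsetP (joing_subl _ _)).
    by rewrite groupV (subsetP (joing_subr _ _)).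
  have sMN : M \subset N <*> G_ k.
    apply: subset_trans genR _; rewrite join_subG gen_subG RN join_subG joing_subr andbT.
    exact: subset_trans KN (joing_subl _ _).
  have nGN (X : {group gT}) : X \subset 'N(G_ k).
    by have /andP[_] := Gnormal k; apply: subset_trans; apply: subsetT.
  have sub (X : {group gT}) : X \subset M -> N \subset X -> X :&: G_ k \subset N -> X \subset N.
    move=> XM NX XGN; apply/subsetP => x Xx.
    have := subsetP sMN x (subsetP XM x Xx).
    rewrite norm_joinEl // => /imset2P[a b Na Gb xE].
    rewrite xE groupM // (subsetP XGN) // inE Gb andbT.
    by rewrite -(groupMl _ (subsetP NX a Na)) -xE.
  have VN : V \subset N by rewrite subsetI -{1}NV1 -NV2 !subsetIl.
  apply/val_inj/eqP; rewrite /= eqEsubset; apply/andP; split.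
    have : N1 \subset N; last by rewrite subsetI => /andP[].
    apply: sub; rewrite ?subsetIl ?NV1 //.
    by rewrite -NM1 joing_subl.
  have : N2 \subset N; last by rewrite subsetI => /andP[].
  apply: sub; rewrite ?subsetIr ?NV2 //.
  by rewrite -NM2 joing_subl.
rewrite -(card_in_imset trace_inj).
have ind_gt0 : 0 < #|G_ k : V| by apply: indexg_gt0.
apply: leq_trans (_ : _ <= #|G_ k : V| ^ #|R|) _; last by rewrite leq_pexp2l.
rewrite -card_lcosets -(card_pffun_on set0 (mem R) (mem (lcosets V (G_ k)))).
apply/subset_leq_card/subsetP => _ /imsetP[N FN ->].
apply/pffun_onP; split.
  by apply/subsetP => m; rewrite inE ffunE; case: ifP => //; rewrite eqxx.
by move=> _ /imageP[m Rm ->]; apply: trace_lcosets.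
Qed.

End Fibre.

Hypothesis lev_sub : forall i M N, M \subset N -> lev i M <= lev i N.
Hypothesis d_ge5 : 5 <= d.
Hypothesis rk1 : 0 < rk 1.

(** These stand for normal subgroups of the quotient by [G_ k.+1]. *)
Definition inner k : {set {group gT}} :=
  [set N : {group gT} | [&& N <| T, G_ k.+1 \subset N & N \subset G_ 2]].

Lemma innerP k N : reflect [/\ N <| T, G_ k.+1 \subset N & N \subset G_ 2] (N \in inner k).
Proof. by rewrite inE; apply: and3P. Qed.

Lemma rk_growth i : 0 < i < n -> 5 * rk i <= 2 * rk i.+1.
Proof.
move=> i_n; apply: (@leq_trans (d * rk i)); first by rewrite leq_mul2r d_ge5 orbT.
by apply: lev_growth => // *; rewrite inE.
Qed.

Lemma rk_gt0 i : 0 < i <= n -> 0 < rk i.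
Proof.
elim: i => // -[//|i] IH i_n; have := @rk_growth i.+1; have := IH; lia.
Qed.

Lemma rk_lt i : 0 < i < n -> rk i < rk i.+1.
Proof.
move=> i_n; have := rk_growth i_n; have := @rk_gt0 i; lia.
Qed.

Section Above.
Variables (k : nat) (M : {group gT}).
Hypothesis k_n : 1 < k <= n.
Hypothesis MX : M \in inner k.-1.

Let nM : M <| T. Proof. by case/innerP: MX. Qed.
Let MG2 : M \subset G_ 2. Proof. by case/innerP: MX. Qed.
Let GkM : G_ k \subset M.
Proof. by case/innerP: MX => _ + _; rewrite prednK //; case/andP: k_n => /ltnW. Qed.
Let k0 : 0 < k. Proof. by case/andP: k_n => /ltnW. Qed.
Let k_n' : 0 < k <= n. Proof. by rewrite k0; case/andP: k_n. Qed.

(** What the brackets and the powers of the elements of [M] force into the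
    layer [k] of any [N] whose product with that layer is [M]. *)
Definition forced := ((verbal M :&: G_ k) <*> G_ k.+1)%G.

Lemma forced_sub : forced \subset G_ k.
Proof. by rewrite join_subG subsetIr GS. Qed.

Lemma forced_growth : 5 * lev k.-1 M <= 2 * lev k forced.
Proof.
have k1 : 0 < k.-1 < n by lia.
have kE : k = k.-1.+1 by lia.
pose M1 := (M :&: G_ k.-1)%G.
have -> : lev k.-1 M = lev k.-1 M1.
  by apply: lev_eq; [lia | rewrite /= -setIA setIid].
have Mforced z : z \in verbal M -> z \in G_ k -> z \in forced.
  by move=> Vz Gz; rewrite (subsetP (joing_subl _ _)) // inE Vz.
have growM1 : d * lev k.-1 M1 <= 2 * lev k.-1.+1 forced.
  apply: (lev_growth k1) => [z /setIP[Mz Gz]|z t /setIP[Mz Gz]]; apply: Mforced.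
  - exact: verbal_exp.
  - by rewrite kE; apply: Gexp => //; case/andP: k1.
  - exact: verbal_comm.
  - by rewrite kE; apply: Gcomm => //; case/andP: k1.
rewrite -kE in growM1; apply: leq_trans growM1.
by rewrite leq_mul2r d_ge5 orbT.
Qed.

Lemma card_forced : #|forced| = (p ^ lev k forced * #|G_ k.+1|)%N.
Proof.
have := card_lev forced k_n'; rewrite (setIidPl forced_sub) => ->.
by rewrite (setIidPr _) // joing_subr.
Qed.

Lemma forced_le_rk : lev k forced <= rk k.
Proof. exact/lev_sub/subsetT. Qed.

Definition corank := rk k - lev k forced.

Lemma forced_normal : forced <| G_ k.
Proof.
rewrite /normal forced_sub /=; apply: (@subset_trans _ _ T); first exact: subsetT.
have /andP[_ nGk] := Gnormal k; have /andP[_ nGk1] := Gnormal k.+1.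
by rewrite normsY ?normsI ?verbal_norm.
Qed.

Lemma card_layer_quotient : #|G_ k / forced| = (p ^ corank)%N.
Proof.
rewrite card_quotient; last by have /andP[] := forced_normal.
apply/eqP; rewrite -(eqn_pmul2l (cardG_gt0 forced)) Lagrange ?forced_sub //.
rewrite card_factor // card_forced mulnAC -expnD subnKC ?forced_le_rk //.
Qed.

Lemma abelem_layer_quotient : p.-abelem (G_ k / forced).
Proof.
have nGT := Gnormal k.+1; have sGW : G_ k.+1 \subset forced by apply: joing_subr.
have /andP[_ nWG] := forced_normal.
have cosetE x : x \in G_ k.+1 -> coset forced x = 1.
  by move=> /(subsetP sGW); apply: coset_id.
apply/(abelemP p_pr); split.
  apply/centsP => _ /morphimP[x Nx Gx ->] _ /morphimP[y Ny Gy ->].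
  by apply/commgP; rewrite -morphR //; apply/eqP/cosetE/Gcomm.
move=> _ /morphimP[x Nx Gx ->]; rewrite -morphX //.
by apply/cosetE/Gexp.
Qed.

Definition traces u := [set V : {group gT} |
  [&& forced \subset V, V \subset G_ k & lev k V == u]].

Lemma card_trace V u : V \in traces u ->
  [/\ #|V| = (p ^ u * #|G_ k.+1|)%N, #|G_ k : V| = (p ^ (rk k - u))%N
    & lev k forced <= u <= rk k].
Proof.
rewrite inE => /and3P[WV VG /eqP uE].
have cardV : #|V| = (p ^ u * #|G_ k.+1|)%N.
  have := card_lev V k_n'; rewrite (setIidPl VG) uE => ->.
  by rewrite (setIidPr _) // (subset_trans _ WV) // joing_subr.
have bounds : lev k forced <= u <= rk k.
  by rewrite -uE !lev_sub ?subsetT.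
split=> //; apply/eqP; rewrite -(eqn_pmul2l (cardG_gt0 V)) Lagrange //.
by rewrite card_factor // cardV mulnAC -expnD subnKC //; case/andP: bounds.
Qed.

Lemma card_traces u :
  #|traces u| <= #|subgroups_of_order p (G_ k / forced) (u - lev k forced)|.
Proof.
have quo_inj : {in traces u &, injective (fun V : {group gT} => (V / forced)%G)}.
  move=> V1 V2; rewrite !inE => /and3P[W1 G1' _] /and3P[W2 G2' _] /(congr1 val) /= e.
  have /andP[_ nW] := forced_normal.
  apply/val_inj; rewrite /= -(quotientGK (H := forced) (G := V1)).
    by rewrite e quotientGK // /normal W2 (subset_trans G2').
  by rewrite /normal W1 (subset_trans G1').
rewrite -(card_in_imset quo_inj).
apply/subset_leq_card/subsetP => _ /imsetP[V Vu ->].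
have [cardV _ /andP[gu ur]] := card_trace Vu.
move: Vu; rewrite !inE => /and3P[WV VG _]; rewrite quotientS //=.
have /andP[_ nW] := forced_normal.
rewrite card_quotient ?(subset_trans VG) //.
rewrite -(eqn_pmul2l (cardG_gt0 forced)) Lagrange // cardV card_forced.
by rewrite mulnAC -expnD subnKC.
Qed.

Definition above := [set N in inner k | (N <*> G_ k)%G == M].

Lemma above_trace N : N \in above ->
  (N :&: G_ k)%G \in traces (lev k N) /\ N \in fibre k M (N :&: G_ k)%G.
Proof.
rewrite inE => /andP[/innerP[nN GN NG2] /eqP NM].
have NM' : N <*> G_ k = M by rewrite -NM.
split; last by rewrite inE nN GN NM !eqxx.
have VN := verbal_over k_n nN GN NM'.
rewrite inE subsetIr /= join_subG setSI // subsetI GN GS //=.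
by apply/eqP/lev_eq => //=; rewrite -setIA setIid.
Qed.

(** First choose the trace on the layer, then a member of the fibre. *)
Lemma card_above (P : pred nat) :
  #|[set N in above | P (lev k N)]| <=
    \sum_(u < (rk k).+1 | P u) #|traces u| * p ^ ((rk k - u) * lev k.-1 M).
Proof.
pose tr N := (N :&: G_ k)%G.
rewrite -sum1_card (partition_big (fun N => inord (lev k N) : 'I_(rk k).+1) P) /=; last first.
  move=> N; rewrite in_set => /andP[_ PN]; rewrite inordK // ltnS.
  exact/lev_sub/subsetT.
apply: leq_sum => u Pu.
rewrite (partition_big tr (fun V => V \in traces u)) /=; last first.
  move=> N; rewrite in_set => /andP[/andP[Na _] /eqP Nu].
  have [Nt _] := above_trace Na.
  by rewrite -Nu inordK // ltnS; apply/lev_sub/subsetT.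
rewrite -sum_nat_const; apply: leq_sum => V Vu.
have [_ indV _] := card_trace Vu.
rewrite expnM -indV; apply: leq_trans (card_fibre k_n nM GkM MG2 V).
rewrite sum1dep_card; apply/subset_leq_card/subsetP => N.
rewrite in_set => /andP[/andP[+ _] /eqP NV]; rewrite in_set => /andP[Na _].
by have [_] := above_trace Na; rewrite -/(tr N) NV.
Qed.

(** The crude bound on the number of traces suffices: with [g] the dimension
    of the forced part and [l] that of the preceding layer, the exponent is
    [(rk k - g) * (u - g) + (rk k - u) * l], and [l] is at most [g]. *)
Lemma card_above_layer u : #|[set N in above | lev k N == u]|
  <= (lev k.-1 M <= u) * p ^ (rk k * (u - lev k.-1 M)).
Proof.
apply: leq_trans (card_above (pred1 u)) _.
have [ur|ur] := leqP u (rk k); last first.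
  rewrite big_pred0 // => j; apply/negP => /eqP E; have := ltn_ord j; rewrite E; lia.
rewrite (big_pred1 (Ordinal (ur : u < (rk k).+1))) /=; last first.
  by move=> j; rewrite /= -val_eqE.
have [->|/set0Pn[V Vu]] := eqVneq (traces u) set0; first by rewrite cards0.
have [_ _ /andP[gu _]] := card_trace Vu; have gr := forced_growth.
have -> : lev k.-1 M <= u by lia.
rewrite mul1n; apply: leq_trans (leq_mul (card_traces u) (leqnn _)) _.
apply: leq_trans (leq_mul (card_subgroups_crude p_pr abelem_layer_quotient
   card_layer_quotient _) (leqnn _)) _.
rewrite -expnD leq_exp2l // /corank; nia.
Qed.

(** With [g], [l] as forced and preceding dimensions and [e] the codimension
    of the trace, the exponent is at most [e * (rk k - g + l - e)], hence at
    most a quarter of the square of [rk k - g + l]. *)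
Lemma card_above_all h : 2 * h + lev k.-1 M <= lev k forced ->
  #|above| <= 4 * (rk k).+1 * p ^ quarter_square (rk k - 2 * h).
Proof.
move=> hg; have gr := forced_le_rk.
have -> : above = [set N in above | predT (lev k N)].
  by apply/setP => N; rewrite [in RHS]inE andbT.
apply: leq_trans (card_above predT) _.
apply: leq_trans (_ : \sum_(u < (rk k).+1) 4 * p ^ quarter_square (rk k - 2 * h) <= _); last first.
  by rewrite sum_nat_const card_ord mulnCA mulnA.
apply: leq_sum => u _.
have [->|/set0Pn[V Vu]] := eqVneq (traces u) set0; first by rewrite cards0.
have [_ _ /andP[gu ur]] := card_trace Vu.
apply: leq_trans (leq_mul (card_traces u) (leqnn _)) _.
have uc : u - lev k forced <= corank by rewrite /corank; lia.
apply: leq_trans (leq_mul (card_subgroups_le p_pr abelem_layer_quotient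
   card_layer_quotient uc) (leqnn _)) _.
rewrite -mulnA leq_mul2l /= -expnD leq_exp2l //.
apply: leq_trans (quarter_square_leq (_ : corank + lev k.-1 M <= _)); last first.
  by rewrite /corank; lia.
apply: leq_trans (quarter_square_max (e := rk k - u) _); last by rewrite /corank; lia.
by rewrite /corank; nia.
Qed.

End Above.

Lemma join_inner k N : 1 < k <= n -> N \in inner k -> (N <*> G_ k)%G \in inner k.-1.
Proof.
move=> k_n /innerP[nN GN NG2]; apply/innerP; split.
- by rewrite /= normalY.
- by rewrite prednK ?joing_subr //; lia.
- by rewrite /= join_subG NG2 G_leq //; lia.
Qed.

(** By induction on the layer, over the products with [G_ k]: a member with
    dimension [v] on the preceding layer has at most [p ^ (rk k * (u - v))]
    members of dimension [u] above it, and the term [+ 1] in the exponent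
    pays for the sum over [v]. *)
Lemma card_inner_layer k u : 0 < k <= n ->
  #|[set N in inner k | lev k N == u]| <= p ^ (u * (rk k).+1).
Proof.
elim: k u => // -[_ u n0|k IH u k_n].
  have [->|u0] := posnP u.
    rewrite mul0n expn0; apply/card_le1_eqP => N1 N2; rewrite !inE.
    move=> /andP[/and3P[_ ? ?] _] /andP[/and3P[_ ? ?] _].
    by apply/val_inj/eqP; rewrite eqEsubset; apply/andP; split;
      apply: (@subset_trans _ _ (G_ 2)).
  rewrite (_ : [set N in _ | _] = set0) ?cards0 //; apply/setP => N.
  rewrite !inE; apply/negP => /andP[/and3P[_ _ NG2]].
  by rewrite lev_eq0 // eq_sym; case: u u0.
have k1 : 0 < k.+1 < n by lia.
have rk_k := rk_lt k1.
pose join N := (N <*> G_ k.+2)%G.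
rewrite -sum1_card (partition_big join (fun M => M \in inner k.+1)) /=; last first.
  by move=> N; rewrite in_set => /andP[NX _]; apply: join_inner NX; lia.
apply: (@leq_trans (\sum_(M in inner k.+1) (lev k.+1 M <= u) * p ^ (rk k.+2 * (u - lev k.+1 M)))).
  apply: leq_sum => M MX; have k2 : 1 < k.+2 <= n by lia.
  apply: leq_trans (card_above_layer k2 MX u); rewrite sum1dep_card.
  apply/subset_leq_card/subsetP => N; rewrite !inE.
  by case/andP=> /andP[-> ->] ->.
rewrite (bigID (fun M => lev k.+1 M <= u)) /= [X in _ + X]big1 ?addn0; last first.
  by move=> M /andP[_ /negPf->].
rewrite (partition_big (fun M => inord (lev k.+1 M) : 'I_u.+1) predT) //=.
apply: (@leq_trans (\sum_(v < u.+1) p ^ (u * rk k.+2))).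
  apply: leq_sum => v _.
  apply: (@leq_trans (#|[set N in inner k.+1 | lev k.+1 N == v]| * p ^ (rk k.+2 * (u - v)))).
    rewrite -sum_nat_const.
    rewrite big_mkcond [X in _ <= X]big_mkcond /=; apply: leq_sum => M _.
    case: ifP => // /andP[/andP[MX Mu] /eqP Mv].
    have vE : lev k.+1 M = v by rewrite -Mv inordK.
    by rewrite in_set MX Mu mul1n vE eqxx.
  apply: leq_trans (leq_mul (IH v _) (leqnn _)) _; first lia.
  by rewrite -expnD leq_exp2l //; have := ltn_ord v; nia.
rewrite sum_nat_const card_ord mulnS expnD leq_mul2r.
by apply/orP; right; apply: ltn_expl.
Qed.

(** Dimensions on successive layers do not decrease, as p-th powers remain
    in [M]; so all the layers up to the last but one are trivial. *)
Lemma inner_lev0 M : 1 < n -> M \in inner n.-1 -> lev n.-1 M = 0%N -> M \subset G_ n.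
Proof.
move=> n1 MX M0; have [nM _ _] := innerP _ _ MX.
have levS j : 0 < j < n -> lev j M <= lev j.+1 M.
  move=> j_n; apply: lev_mono => // z; first by move=> ?; apply: groupX.
  move=> t Mz; apply: (subsetP (verbal_sub nM)); exact: verbal_comm.
have lev0 m : m < n.-1 -> lev (n.-1 - m) M = 0%N.
  elim: m => [|m IH] mn; first by rewrite subn0.
  apply/eqP; rewrite -leqn0 -(IH (ltnW mn)).
  have := levS (n.-1 - m.+1)%N; rewrite (_ : (n.-1 - m.+1).+1 = (n.-1 - m)%N); last lia.
  by apply; lia.
apply/setIidPl/eqP; rewrite eqEcard subsetIl /= -{1}[M : {set gT}]setIT -G1.
rewrite (@card_layers 1) // (@card_layers n) //; last lia.
rewrite leq_exp2l // (@big_cat_nat _ _ _ n) /=; try lia.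
rewrite [X in X + _]big_nat big1 ?add0n // => j /andP[j1 jn].
by have := lev0 (n.-1 - j)%N; rewrite (_ : (n.-1 - (n.-1 - j))%N = j); [apply|]; lia.
Qed.

Lemma central_normal N : N \subset G_ n -> 0 < n -> N <| T.
Proof.
move=> NG n0; rewrite /normal subsetT /=; apply/subsetP => t _; rewrite inE.
apply/subsetP => _ /imsetP[z Nz ->].
have /set1gP z1 : [~ z, t] \in [1 gT].
  by rewrite -Glast; apply: Gcomm => //; apply: (subsetP NG).
by rewrite -[z ^ t](mulKVg z) -commgEl z1 mulg1.
Qed.

(** In the elementary abelian group [G_ n] choose complements of dimensions
    as close as possible. *)
Lemma card_central : 0 < n ->
  p ^ quarter_square (rk n) <= #|[set N : {group gT} | N \subset G_ n]|.
Proof.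
move=> n0; have n_n : 0 < n <= n by rewrite n0 leqnn.
have abG : p.-abelem (G_ n).
  apply/(abelemP p_pr); split.
    apply/centsP => x Gx y _; apply/commgP/eqP/set1gP.
    by rewrite -Glast; apply: Gcomm.
  by move=> x Gx; apply/set1gP; rewrite -Glast; apply: Gexp.
have cardG : #|G_ n| = (p ^ rk n)%N by rewrite card_factor // Glast cards1 muln1.
apply: (card_subgroups_ge p_pr abG cardG).
by rewrite uphalf_half addnCA addnn odd_double_half.
Qed.

(** Group the subgroups by their dimension [u] on the last layer but one,
    which is positive. By [forced_growth] and [quarter_square_sub] the
    number of choices on the last layer is smaller than the number of all
    its subspaces by a factor of exponent [h * (N0 - h)], with [h] about
    [3 * u / 4], which beats the exponent [u * D.+1] of the choices below. *)
Theorem card_noncentral : 2 < n -> 54 <= rk n ->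
  #|[set N in inner n | ~~ (N \subset G_ n)]| * p ^ ((rk n + 3) %/ 4)
    <= p ^ rk n.-1 * #|[set N : {group gT} | N \subset G_ n]|.
Proof.
move=> n2 N54; have n_n : 1 < n <= n by lia.
have DN : 5 * rk n.-1 <= 2 * rk n.
  by have := @rk_growth n.-1; rewrite prednK; [apply|]; lia.
set D := rk n.-1 in DN *; set N0 := rk n in N54 DN *.
set e := (N0 + 3) %/ 4; set Q := quarter_square N0.
apply: (@leq_trans (p ^ (D + Q))); last first.
  by rewrite expnD leq_mul2l card_central ?orbT //; lia.
pose join N := (N <*> G_ n)%G.
have joinP N : N \in [set N in inner n | ~~ (N \subset G_ n)] ->
    join N \in [set M in inner n.-1 | 0 < lev n.-1 M].
  rewrite inE => /andP[NX NG]; rewrite inE join_inner //= lt0n.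
  apply: contra NG => /eqP M0; apply: subset_trans (inner_lev0 _ _ M0); try lia.
    exact: joing_subl.
  exact: join_inner.
pose h u := (3 * u + 1) %/ 4.
pose bound u := (p ^ (u * D.+1) * (4 * N0.+1 * p ^ quarter_square (N0 - 2 * h u)))%N.
have main : #|[set N in inner n | ~~ (N \subset G_ n)]|
    <= \sum_(u < D.+1 | 0 < u) bound u.
  rewrite -sum1_card (partition_big join
    (fun M => M \in [set M in inner n.-1 | 0 < lev n.-1 M])) //.
  apply: (@leq_trans (\sum_(M in [set M in inner n.-1 | 0 < lev n.-1 M])
      4 * N0.+1 * p ^ quarter_square (N0 - 2 * h (lev n.-1 M)))).
    apply: leq_sum => M; rewrite in_set => /andP[MX M0].
    have gr := forced_growth n_n MX.
    have hg : 2 * h (lev n.-1 M) + lev n.-1 M <= lev n (forced n M).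
      by rewrite /h; lia.
    apply: leq_trans (card_above_all n_n MX hg); rewrite sum1dep_card.
    apply/subset_leq_card/subsetP => N; rewrite in_set => /andP[].
    by rewrite in_set => /andP[NX _] NM; rewrite in_set NX.
  rewrite (partition_big (fun M => inord (lev n.-1 M) : 'I_D.+1)
    (fun v : 'I_D.+1 => 0 < v)) /=; last first.
    move=> M; rewrite in_set => /andP[_ M0]; rewrite inordK // ltnS.
    exact/lev_sub/subsetT.
  apply: leq_sum => u u0.
  apply: (@leq_trans (#|[set N in inner n.-1 | lev n.-1 N == u]|
      * (4 * N0.+1 * p ^ quarter_square (N0 - 2 * h u)))); last first.
    by rewrite leq_mul2r card_inner_layer ?orbT //; lia.
  rewrite -sum_nat_const big_mkcond [X in _ <= X]big_mkcond /=.
  apply: leq_sum => M _; case: ifP => // /andP[]; rewrite in_set => /andP[MX _] /eqP Mu.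
  have uE : lev n.-1 M = u by rewrite -Mu inordK // ltnS; apply/lev_sub/subsetT.
  by rewrite in_set MX uE eqxx.
apply: leq_trans (leq_mul main (leqnn _)) _.
rewrite big_distrl -(leq_pmul2l (ltn0Sn D)) big_distrr /=.
apply: (@leq_trans (\sum_(u < D.+1 | 0 < u) p ^ (D + Q))); last first.
  rewrite big_mkcond; apply: (@leq_trans (\sum_(u < D.+1) p ^ (D + Q))).
    by apply: leq_sum => u _; case: ifP.
  by rewrite sum_nat_const card_ord.
apply: leq_sum => u u0; have uD := ltn_ord u; rewrite ltnS in uD.
move: (nat_of_ord u) u0 uD => {}u u0 uD.
have small : 4 * D.+1 * N0.+1 <= p ^ (N0 %/ 4).
  apply: (@leq_trans (2 ^ (N0 %/ 4))); last by case: (N0 %/ 4) => // m; rewrite leq_exp2r.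
  by apply: leq_trans (square_le_exp2 N54); nia.
have uDb : 0 < u <= D by rewrite u0.
have := layer_exponents DN N54 uDb; rewrite -/(h u) -/e => expo.
have hN : 2 * h u <= N0 by rewrite /h; lia.
rewrite /bound /Q (quarter_square_sub hN).
move: (quarter_square _) => q.
apply: (@leq_trans (4 * D.+1 * N0.+1 * p ^ (u * D.+1 + e + q))).
  by rewrite !expnD; nia.
apply: leq_trans (leq_mul small (leqnn _)) _.
by rewrite -expnD leq_exp2l //; lia.
Qed.

End Layers.

(** * The layers of the free quotient *)

Section LeadMore.
Variables (d p n : nat) (p_pr : prime p).
Hypothesis n_gt0 : (0 < n)%N.
Local Notation F := (freegroup d).
Local Notation gT := (free_quo d p_pr n.+1).
Local Notation prj := (free_proj p_pr n.+1).
Implicit Types (M K : {group gT}) (z t c : gT) (i j k : nat) (u v w : seq 'I_d).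

Lemma size_leads_sub i M K : M \subset K -> size (leads i M) <= size (leads i K).
Proof.
move=> /subsetP MK; apply: uniq_leq_size (leads_uniq _ _) _ => w.
case/mem_leads => -[z [/MK Kz Gz zw zv]] wi.
by apply/mem_leads; split=> //; exists z.
Qed.

(** Symbols are computed in the free group, so the leading words of a layer do
    not depend on [n]. *)
Lemma is_lead_full i w : 0 < i <= n -> size w <= i ->
  is_lead i [set: gT]%G w <-> exists x : F, [/\ lower_p_series p i x,
    sym p i x w != 0%R & forall v, wlt v w -> sym p i x v = 0%R].
Proof.
move=> i_n wi; have i_n1 : 0 < i <= n.+1 by lia.
split=> [[z [_ Gz zw zv]]|[x [Fx xw xv]]].
  by exists (free_lift z); split=> //; apply: free_lift_in.
exists (prj x); split; [by rewrite inE | exact/mem_prj | by rewrite gsym_prj |].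
by move=> v vw; rewrite gsym_prj ?xv // (leq_trans (wlt_size vw)).
Qed.

(** The words are the letters: each one leads the corresponding generator,
    and the empty word never leads. *)
Lemma size_leads1 : size (leads 1 [set: gT]%G) = d.
Proof.
have dE : size [seq [:: l] | l <- enum 'I_d] = d by rewrite size_map -cardE card_ord.
rewrite -[RHS]dE.
have i_n : 0 < 1 <= n by rewrite n_gt0.
apply/eqP; rewrite eqn_leq; apply/andP; split.
  apply: uniq_leq_size (leads_uniq _ _) _ => -[|l [|? ?]] /mem_leads[[z [_ _ zw _]]] //.
    by rewrite /gsym sym_nil eqxx in zw.
  by move=> _; rewrite map_f // mem_enum.
apply: uniq_leq_size.
  by rewrite map_inj_uniq ?enum_uniq // => l1 l2 [].
move=> _ /mapP[l _ ->]; apply/mem_leads; split=> //.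
have Ll : lead_lift [:: l] (prj (fgenerator l)).
  split; first by rewrite lcn1 inE.
  exists (fgenerator l); split=> [//|v|]; last exact: nu_gen_letter.
  rewrite nuE mu_gen addrC addKr /var.
  by case: eqP => // ->; rewrite wlt_irr.
have [lv l1] := lead_lift_sym n_gt0 (i_n : 0 < size [:: l] <= n) Ll.
exists (prj (fgenerator l)); split; [by rewrite inE | | | exact: lv].
  by rewrite section1 inE.
by rewrite l1 oner_eq0.
Qed.

End LeadMore.

Lemma lower_p_rank_leads d p n (p_pr : prime p) i : 0 < i <= n ->
  lower_p_rank d p_pr i = size (leads i [set: free_quo d p_pr n.+1]%G).
Proof.
move=> i_n; have i0 : 0 < i by case/andP: i_n.
have i_i : 0 < i <= i by rewrite i0 leqnn.
rewrite lower_p_rankE //.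
have := card_leads i0 [set: free_quo d p_pr i.+1]%G i_i.
rewrite !setTI section_last cards1 muln1 => ->; rewrite pfactorK //.
rewrite /leads; congr size; apply: eq_in_filter => w; rewrite mem_words => wi.
have H1 := is_lead_full p_pr i0 i_i wi.
have H2 := is_lead_full p_pr (leq_trans i0 (proj2 (andP i_n))) i_n wi.
apply: asbool_equiv_eq; exact: (iff_trans H1 (iff_sym H2)).
Qed.

Section Instance.
Variables (d p n : nat) (p_pr : prime p).
Hypothesis hdn : (3 <= n /\ 6 <= d) \/ (10 <= n /\ 5 <= d).
Local Notation gT := (free_quo d p_pr n.+1).
Local Notation Gs i := (lower_p_section d p_pr n.+1 i).
Local Notation Gg i := (lower_p_section_group d p_pr n.+1 i).

Let n2 : 2 < n. Proof. by case: hdn => -[]; lia. Qed.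
Let n_gt0 : 0 < n. Proof. by lia. Qed.
Let d5 : 5 <= d. Proof. by case: hdn => -[]; lia. Qed.
Let lev i (M : {group gT}) := size (leads i M).
Let r i := lev i [set: gT]%G.

Lemma rank_growth i : 0 < i < n -> d * r i <= 2 * r i.+1.
Proof. by move=> i_n; apply: (growth n_gt0 i_n) => *; rewrite inE. Qed.

(** From [d], the growth by [d / 2] gives [6], [18], [54] in the first case;
    with [d = 5] the ranks are integers, and [5], [13], [33], [83] pass the
    bound too. *)
Lemma last_rank_ge : 54 <= r n.
Proof.
have r1 : r 1 = d by apply: size_leads1.
have step i : 0 < i < n -> 5 * r i <= 2 * r i.+1.
  by move=> /rank_growth; nia.
have mono i m : 0 < i -> i + m <= n -> r i <= r (i + m).
  move=> i0; elim: m => [|m IH] im; first by rewrite addn0.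
  rewrite addnS in im *; have := step (i + m); have := IH; lia.
case: hdn => -[n3 d6].
  have := @rank_growth 1; have := @rank_growth 2; have := @mono 3 (n - 3).
  by rewrite r1 subnKC //; nia.
have := step 1%N; have := step 2%N; have := step 3%N.
have := @mono 4 (n - 4)%N; rewrite r1 subnKC; lia.
Qed.

Lemma card_noncentral_free :
  #|[set N in inner (fun i => Gg i) n | ~~ (N \subset Gs n)]| * p ^ ((r n + 3) %/ 4)
    <= p ^ r n.-1 * #|[set N : {group gT} | N \subset Gs n]|.
Proof.
apply: (@card_noncentral gT d p n (fun i => Gg i) lev p_pr) => //.
- exact: section1.
- exact: section_last.
- by move=> i; apply: sectionS.
- by move=> i; apply: section_normal.
- by move=> i z; apply: section_exp.
- by move=> i z t; apply: section_comm.
- by move=> i M; apply: card_leads.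
- by move=> i M N i_n MX _; apply: size_leads_mono.
- by move=> i M N; apply: growth.
- by move=> i M N; apply: size_leads_sub.
- by rewrite /rk /lev size_leads1 //; lia.
- exact: last_rank_ge.
Qed.

End Instance.

(** * Orbits under automorphisms *)

(** The values of [f] are functions of those of [g]. *)
Lemma card_imset_factor (A B C : finType) (f : A -> B) (g : A -> C) (D : {set A}) :
  {in D &, forall x y, g x = g y -> f x = f y} -> #|f @: D| <= #|g @: D|.
Proof.
move=> gf; have [->|[x0 Dx0]] := set_0Vmem D; first by rewrite !imset0 !cards0.
pose h c := if [pick x in D | g x == c] is Some x then f x else f x0.
apply: (@leq_trans #|h @: (g @: D)|); last exact: leq_imset_card.
apply/subset_leq_card/subsetP => _ /imsetP[x Dx ->]; apply/imsetP.
exists (g x); first exact: imset_f.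
rewrite /h; case: pickP => [y /andP[Dy /eqP yx]|/(_ x)]; first exact: gf.
by rewrite Dx eqxx.
Qed.

(** Central factors drop out of a commutator, as soon as those of the second
    argument commute with the two elements. *)
Lemma comm_shift_central (hT : finGroupType) (u v s t : hT) :
    [~ t, v * s] = 1 -> [~ u, v * s, t] = 1 -> [~ u, s] = 1 -> [~ u, v, s] = 1 ->
  [~ u * t, v * s] = [~ u, v].
Proof.
have conj1 (x y : hT) : [~ x, y] = 1 -> x ^ y = x.
  by move=> xy; rewrite -[x ^ y](mulKVg x) -commgEl xy mulg1.
move=> t1 /conj1 ut us /conj1 uvs.
by rewrite commMgJ t1 mulg1 ut commgMJ us mul1g.
Qed.

Section Automorphisms.
Variables (d p n : nat) (p_pr : prime p).
Hypothesis n_gt0 : (0 < n)%N.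
Local Notation gT := (free_quo d p_pr n.+1).
Local Notation prj := (free_proj p_pr n.+1).
Local Notation Gs i := (lower_p_section d p_pr n.+1 i).
Local Notation Gg i := (lower_p_section_group d p_pr n.+1 i).
Local Notation T := [set: gT].
Implicit Types (a b : {perm gT}) (z t : gT) (i : nat).

Lemma aut_mul a z t : a \in Aut T -> a (z * t) = a z * a t.
Proof. by move=> /Aut_morphic/morphicP; apply; rewrite inE. Qed.

Lemma aut_inv a z : a \in Aut T -> a z^-1 = (a z)^-1.
Proof.
move=> Aa; have := morphV (autm_morphism Aa) (in_setT z).
by rewrite /= !autmE.
Qed.

Lemma aut_one a : a \in Aut T -> a 1 = 1.
Proof. by move=> Aa; have := morph1 (autm_morphism Aa); rewrite /= autmE. Qed.

Lemma aut_exp a z k : a \in Aut T -> a (z ^+ k) = (a z) ^+ k.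
Proof.
move=> Aa; have := morphX (autm_morphism Aa) k (in_setT z).
by rewrite /= !autmE.
Qed.

Lemma aut_comm a z t : a \in Aut T -> a [~ z, t] = [~ a z, a t].
Proof. by move=> Aa; rewrite !commgEl !conjgE !(aut_mul, aut_inv) // !aut_inv. Qed.

Lemma aut_section a i z : a \in Aut T -> 0 < i -> z \in Gs i -> a z \in Gs i.
Proof.
move=> Aa; elim: i z => // i IH z _; case: i IH => [|i] IH.
  by rewrite section1 !inE.
pose H := [set z | a z \in Gg i.+2].
have HE t : (t \in H) = (a t \in Gg i.+2) by rewrite in_set.
have gH : group_set H.
  apply/group_setP; split=> [|u v]; rewrite !HE; first by rewrite aut_one ?group1.
  by rewrite aut_mul //; apply: groupM.
suff /subsetP sGH : Gs i.+2 \subset Group gH by move/sGH; rewrite HE.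
apply: section_gen => // [t Gt|t u Gt]; rewrite HE.
  by rewrite aut_exp //; apply: section_exp => //; apply: IH.
by rewrite aut_comm //; apply: section_comm => //; apply: IH.
Qed.

Lemma aut_agree_mod a b : a \in Aut T -> b \in Aut T ->
    (forall l : 'I_d, coset (Gg 2) (a (prj (fgenerator l)))
                        = coset (Gg 2) (b (prj (fgenerator l)))) ->
  forall z, coset (Gg 2) (a z) = coset (Gg 2) (b z).
Proof.
move=> Aa Ab ab z; have nG := section_normal d n p_pr 2.
rewrite -(free_liftK z); elim/freegroup_ind: (free_lift z) => [|[l s] x IH].
  by rewrite (_ : prj 1 = 1) ?aut_one //; apply: lower_p_proj1.
rewrite prjM !aut_mul // !(coset_mulE nG) IH; congr (_ * _).
case: s; last exact: ab.
rewrite (_ : fletter (l, true) = (fgenerator l)^-1).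
  by rewrite prjV !aut_inv // !morphV ?(subsetP (normal_norm nG)) ?in_setT // [LHS]/= ab.
exact: val_inj.
Qed.

(** By induction on [i], it suffices to compare the images of a p-th power
    and of a bracket. The images of their arguments agree modulo the next
    term, respectively modulo [G_2] for the second argument of a bracket,
    and a bracket of elements of the i-th term with [G_2] already lies two
    terms further. *)
Lemma aut_agree_layer a b i : a \in Aut T -> b \in Aut T ->
    (forall z, coset (Gg 2) (a z) = coset (Gg 2) (b z)) ->
  0 < i -> forall z, z \in Gs i -> coset (Gg i.+1) (a z) = coset (Gg i.+1) (b z).
Proof.
move=> Aa Ab ab; elim: i => // i IH _; case: i IH => [_ z _|i IH]; first exact: ab.
have nG := section_normal d n p_pr i.+3.
pose H := [set z | coset (Gg i.+3) (a z) == coset (Gg i.+3) (b z)].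
have HE t : (t \in H) = (coset (Gg i.+3) (a t) == coset (Gg i.+3) (b t)).
  by rewrite in_set.
have gH : group_set H.
  apply/group_setP; split=> [|u v]; rewrite !HE; first by rewrite !aut_one.
  by rewrite !aut_mul // !(coset_mulE nG) => /eqP-> /eqP->.
suff /subsetP sGH : Gs i.+2 \subset Group gH.
  by move=> z /sGH; rewrite HE => /eqP.
have mem1 u : u \in Gs i.+3 -> coset (Gg i.+3) u = 1.
  by move=> Nu; apply/eqP; rewrite (coset_eq1 nG).
apply: section_gen => // [y Gy|y g Gy]; rewrite HE.
  have /eqP := IH isT y Gy; rewrite (coset_eq (section_normal d n p_pr i.+2)) => Gt.
  rewrite !aut_exp // -[b y](mulKVg (a y)); move: (_ * b y) Gt => t Gt.
  rewrite !(coset_expE nG) (coset_mulE nG) expgMn.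
    rewrite -(coset_expE nG t) [X in _ * X](_ : _ = 1) ?mulg1 //.
    by apply/eqP; rewrite (coset_eq1 nG); apply: section_exp.
  by apply: commute_sym; apply/(coset_commute nG); apply: section_comm.
have /eqP := IH isT y Gy; rewrite (coset_eq (section_normal d n p_pr i.+2)) => Gt.
have /eqP := ab g; rewrite (coset_eq (section_normal d n p_pr 2)) => Gs2.
have GA : a y \in Gs i.+1 by apply: aut_section.
rewrite !aut_comm // -[b y](mulKVg (a y)) -[b g](mulKVg (a g)).
move: (_ * b g) Gs2 => s Gs2; move: (_ * b y) Gt => t Gt.
move: (a y) GA (a g) => u Gu v.
apply/eqP; rewrite !(coset_commE nG, coset_mulE nG); apply/esym.
apply: comm_shift_central; rewrite -?(coset_mulE nG) -?(coset_commE nG); apply: mem1.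
- exact: section_comm.
- by apply: section_comm => //; apply: section_comm.
- exact: section_comm2.
- by apply: section_comm => //; apply: section_comm.
Qed.

Lemma setact_agree a b (N : {set gT}) : a \in Aut T -> b \in Aut T ->
    (forall l : 'I_d, coset (Gg 2) (a (prj (fgenerator l)))
                        = coset (Gg 2) (b (prj (fgenerator l)))) ->
  N \subset Gs n -> 'P^*%act N a = 'P^*%act N b.
Proof.
move=> Aa Ab /(aut_agree_mod Aa Ab) ab NG; rewrite /= !setactE.
apply: eq_in_imset => z Nz /=; rewrite /aperm.
have /eqP := aut_agree_layer Aa Ab ab n_gt0 (subsetP NG z Nz).
rewrite (coset_eq (section_normal d n p_pr n.+1)) /= section_last.
by move/set1P => /(canRL (mulKVg _)); rewrite mulg1.
Qed.

(** By [setact_agree] the image of the subgroup is determined by those of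
    the [d] generators in the quotient by [G_2], of order [p ^ d]. *)
Lemma card_central_orbit (N : {set gT}) : N \subset Gs n ->
  #|orbit 'P^* (Aut T) N| <= p ^ (d * d).
Proof.
move=> NG.
pose key a : {ffun 'I_d -> coset_of (Gg 2)} :=
  [ffun l => coset (Gg 2) (a (prj (fgenerator l)))].
have nG := section_normal d n p_pr 2.
have cardQ : #|T / Gg 2| = (p ^ d)%N.
  have i_n : 0 < 1 <= n by rewrite n_gt0.
  rewrite card_quotient; last by have /andP[] := nG.
  have := card_leads n_gt0 [set: gT]%G i_n.
  rewrite !setTI section1 (size_leads1 d p_pr n_gt0) => cardT.
  by rewrite -divgS ?subsetT //= cardT mulnK ?cardG_gt0.
rewrite orbitE; apply: leq_trans (@card_imset_factor _ _ _ _ key _ _) _.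
  move=> a b Aa Ab /ffunP ab; apply: setact_agree => // l.
  by have := ab l; rewrite !ffunE.
rewrite expnM -cardQ -[X in (_ ^ X)%N]card_ord -card_ffun_on.
apply/subset_leq_card/subsetP => _ /imsetP[a _ ->]; apply/ffun_onP => l.
by rewrite ffunE mem_quotient ?inE.
Qed.

End Automorphisms.

Lemma aut_orbitsS (hT : finGroupType) (S S' : {set {set hT}}) :
  S \subset S' -> #|aut_orbits S| <= #|aut_orbits S'|.
Proof. by move=> sSS'; apply/subset_leq_card/imsetS. Qed.

Lemma card_aut_orbits_diff (hT : finGroupType) (S S' : {set {set hT}}) :
  #|aut_orbits S| <= #|aut_orbits S'| + #|S :\: S'|.
Proof.
apply: leq_trans (leq_add (leqnn _) (leq_imset_card (orbit 'P^* (Aut [set: hT])) _)).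
apply: leq_trans (_ : #|aut_orbits (S' :|: (S :\: S'))| <= _); last first.
  by rewrite /aut_orbits imsetU leq_card_setU.
apply/aut_orbitsS/subsetP => N SN; rewrite !in_setU in_setD SN andbT.
exact: orbN.
Qed.

Lemma card_cover_orbits (hT : finGroupType) (S : {set {set hT}}) m :
    (forall N, N \in S -> #|orbit 'P^* (Aut [set: hT]) N| <= m) ->
  #|S| <= #|aut_orbits S| * m.
Proof.
move=> orb; apply: (@leq_trans #|cover (aut_orbits S)|).
  apply/subset_leq_card/subsetP => N SN; apply/bigcupP.
  exists (orbit 'P^* (Aut [set: hT]) N); first exact: imset_f.
  exact: orbit_refl.
apply: leq_trans (leq_card_cover _) _; rewrite -sum_nat_const.
by apply: leq_sum => _ /imsetP[N SN ->]; apply: orb.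
Qed.

Section OrbitCount.
Variables (d p n : nat) (p_pr : prime p).
Hypothesis hdn : (3 <= n /\ 6 <= d) \/ (10 <= n /\ 5 <= d).
Local Notation gT := (free_quo d p_pr n.+1).
Local Notation Gs i := (lower_p_section d p_pr n.+1 i).
Local Notation Gg i := (lower_p_section_group d p_pr n.+1 i).
Local Notation T := [set: gT].
Local Notation A := (normal_subgroups_in (Gs 2)).
Local Notation C := (normal_subgroups_in (Gs n)).

Let n_gt1 : 1 < n. Proof. by case: hdn => -[]; lia. Qed.
Let n_gt0 : 0 < n := ltnW n_gt1.

Lemma central_in_inner : C \subset A.
Proof.
apply/subsetP => N; rewrite 2!in_set => /and3P[-> -> NG] /=.
by apply: subset_trans NG _; apply: section_leq.
Qed.

Lemma orbits_C_le_A : #|orbits_C d n p_pr| <= #|orbits_A d n p_pr|.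
Proof. exact/aut_orbitsS/central_in_inner. Qed.

Lemma orbits_C_gt0 : 0 < #|orbits_C d n p_pr|.
Proof.
apply/card_gt0P; exists (orbit 'P^* (Aut T) 1); apply: imset_f.
by rewrite in_set groupP normal1 sub1G.
Qed.

Lemma card_noncentral_sets :
  #|A :\: C| <= #|[set N in inner (fun i => Gg i) n | ~~ (N \subset Gs n)]|.
Proof.
apply: leq_trans (leq_imset_card (fun N : {group gT} => N : {set gT}) _).
apply/subset_leq_card/subsetP => N; rewrite in_setD 2!in_set.
case/andP=> + /and3P[gN nN NG2]; rewrite gN nN /= => NG.
apply/imsetP; exists (Group gN) => //; rewrite in_set NG andbT.
by apply/innerP; split=> //=; rewrite section_last; apply: (sub1G (Group gN)).
Qed.

Lemma card_central_sets : #|[set N : {group gT} | N \subset Gs n]| <= #|C|.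
Proof.
rewrite -(card_imset _ (@group_inj gT)).
apply/subset_leq_card/subsetP => _ /imsetP[N + ->]; rewrite in_set => NG.
rewrite in_set groupP NG andbT /=.
apply: (@central_normal gT n (fun i => Gg i)) => //; first exact: section_last.
by move=> i z t; apply: section_comm.
Qed.

(** Orbits in A that are not in C contain members of A that are not in C,
    and C is the union of its orbits, of at most [p ^ (d * d)] elements
    each. *)
Theorem card_orbits_diff :
  (#|orbits_A d n p_pr| - #|orbits_C d n p_pr|)
      * p ^ ((lower_p_rank d p_pr n + 3) %/ 4)
    <= p ^ (lower_p_rank d p_pr n.-1 + d * d) * #|orbits_C d n p_pr|.
Proof.
rewrite !(@lower_p_rank_leads d p n); try lia.
have diff : #|orbits_A d n p_pr| - #|orbits_C d n p_pr| <= #|A :\: C|.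
  by rewrite leq_subLR; apply: card_aut_orbits_diff.
apply: leq_trans (leq_mul (leq_trans diff card_noncentral_sets) (leqnn _)) _.
apply: leq_trans (card_noncentral_free p_pr hdn) _.
rewrite expnD -mulnA leq_mul2l; apply/orP; right.
apply: leq_trans card_central_sets _; rewrite mulnC; apply: card_cover_orbits.
by move=> N; rewrite in_set => /and3P[_ _]; apply: card_central_orbit.
Qed.

End OrbitCount.

Local Close Scope group_scope.

From mathcomp Require Import all_classical all_reals all_analysis.
Import Order.TTheory Num.Theory.
Import numFieldNormedType.Exports.
Local Open Scope ring_scope.

(** * The two analytic constants *)

Section Constants.
Variable R : realType.
Variable q : R.
Hypothesis q_ge2 : 2 <= q.

Let q_gt0 : 0 < q. Proof. by apply: lt_le_trans q_ge2; rewrite ltr0n. Qed.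

Lemma expV_le k m : (k <= m)%N -> q ^- m <= 2 ^- k.
Proof.
move=> km; rewrite lef_pV2 ?posrE ?exprn_gt0 //.
apply: (@le_trans _ _ (q ^+ k)); first by rewrite lerXn2r ?nnegrE ?(ltW q_gt0).
by rewrite ler_weXn2l //; move: q_ge2; lra.
Qed.

Lemma sum_half_powers m : \sum_(0 <= k < m) (2 ^- k : R) <= 2.
Proof.
suff -> : \sum_(0 <= k < m) (2 ^- k : R) = 2 - 2 * 2 ^- m.
  by rewrite gerBl mulr_ge0 // invr_ge0 exprn_ge0.
elim: m => [|m IH]; first by rewrite big_geq // expr0 invr1; lra.
rewrite big_nat_recr //= IH exprS invfM; lra.
Qed.

(** The term of index 0 is 1. The series has to be shown to converge too,
    the value of [fine] at infinity being 0; its terms are dominated by two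
    geometric series, over the nonnegative and the negative integers. *)
Lemma theta_sum_ge1 : 1 <= theta_sum q.
Proof.
pose t (r : int) : R := q ^ (- r ^+ 2).
have t_ge0 r : 0 <= t r by rewrite exprz_ge0 ?ltW.
have tE (r : int) : t r = q ^- (`|r| ^ 2)%N.
  by rewrite /t -[r ^+ 2]gez0_abs ?exprn_even_ge0 // abszX exprnN.
pose ints m := [seq Posz k | k <- iota 0 m] ++ [seq Negz k | k <- iota 0 m].
have ints_uniq m : uniq (ints m).
  rewrite cat_uniq !map_inj_uniq ?iota_uniq //=; last 2 first.
  - by move=> ? ? [].
  - by move=> ? ? [].
  by rewrite andbT; apply/hasPn => _ /mapP[k _ ->]; apply/negP => /mapP[].
have le_sum m : (\sum_(r \in [set` ints m]%classic) (t r)%:E <= 4%:E)%E.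
  rewrite -fsbig_seq // sumEFin lee_fin big_cat !big_map /=.
  rewrite [leRHS](_ : _ = 2 + 2); last lra.
  apply: lerD; apply: le_trans (sum_half_powers m); rewrite /index_iota subn0.
    by apply: ler_sum => k _; rewrite tE expV_le //= -mulnn; nia.
  by apply: ler_sum => k _; rewrite tE expV_le //= -mulnn; nia.
have theta_le : (\esum_(r in [set: int]%classic) (t r)%:E <= 4%:E)%E.
  apply: ge_ereal_sup => _ [_ [/finite_seqP[s ->] _] <-].
  pose m := (\max_(r <- s) `|r|%N).+1.
  apply: le_trans (le_sum m); apply: lee_fsum_nneg_subset => [||r|r _];
    [exact: finite_seq|exact: finite_seq| |by rewrite lee_fin].
  rewrite !mem_setE => sr.
  have rm : (`|r| < m)%N.
    by rewrite ltnS; exact: (@leq_bigmax_seq _ s predT (fun x : int => `|x|%N)).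
  rewrite mem_cat; apply/orP; case: r rm {sr} => k km.
    by left; rewrite map_f // mem_iota.
  by right; rewrite map_f // mem_iota /=; move: km; rewrite NegzE; lia.
have theta_ge : (1%:E <= \esum_(r in [set: int]%classic) (t r)%:E)%E.
  apply: esum_ge; exists [set (0 : int)]%classic; first by split.
  by rewrite fsbig_set1 tE lee_fin expr0 invr1.
rewrite /theta_sum -lee_fin fineK //.
rewrite fin_numElt (lt_le_trans _ theta_ge) ?ltNyr //.
by rewrite (le_lt_trans theta_le) ?ltry.
Qed.

Let factor (j : nat) : R := 1 - q ^- j.

Lemma factor_bounds j : (0 < j)%N -> 1 - 2 ^- j <= factor j < 1.
Proof.
move=> j0; rewrite /factor lerB ?expV_le //=.
by rewrite gtrBl invr_gt0 exprn_gt0.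
Qed.

Lemma factor_gt0 j : (0 < j)%N -> 0 < factor j.
Proof.
case: j => // j _; have /andP[+ _] := @factor_bounds j.+1 isT; apply: lt_le_trans.
rewrite subr_gt0 invf_lt1 ?exprn_gt0 // exprn_egt1 //; lra.
Qed.

(** For q = 2, the product over [j <= m] is at least [1 / 4 + 2 ^- (m + 1)]
    by induction on [m], the extra term being what the induction needs; the
    factors increase with q. *)
Lemma prod_factor_ge m : 1 / 4 <= \prod_(1 <= j < m.+1) factor j.
Proof.
case: m => [|m]; first by rewrite big_geq //; lra.
suff : 1 / 4 + 2 ^- m.+2 <= \prod_(1 <= j < m.+2) factor j.
  by apply: le_trans; rewrite lerDl invr_ge0 exprn_ge0.
elim: m => [|m IH].
  rewrite big_nat1; have /andP[+ _] := @factor_bounds 1 isT.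
  by apply: le_trans; rewrite expr1 expr2 ; lra.
rewrite big_nat_recr //=; have /andP[lo _] := @factor_bounds m.+2 isT.
have x_gt0 : 0 < (2 ^- m.+2 : R) by rewrite invr_gt0 exprn_gt0.
have x_le : (2 ^- m.+2 : R) <= 1 / 4.
  rewrite (_ : 1 / 4 = 2 ^- 2); last by rewrite expr2; lra.
  by rewrite lef_pV2 ?posrE ?exprn_gt0 // ler_weXn2l //; lra.
apply: le_trans (ler_pM _ _ IH lo); last 2 first.
- by rewrite addr_ge0 //; lra.
- by lra.
by rewrite (exprS _ m.+2) invfM; move: x_gt0 x_le; move: (2 ^- m.+2) => x *; nra.
Qed.

(** The partial products increase from 1, and they converge because they are
    bounded. *)
Lemma euler_prod_ge1 : 1 <= euler_prod q.
Proof.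
rewrite /euler_prod; set u := (X in limn X).
have u0 : u 0%N = 1 by rewrite /u big_geq.
have u_nd : nondecreasing_seq u.
  apply/nondecreasing_seqP => m; rewrite /u [leRHS]big_nat_recr //=.
  rewrite ler_peMr //.
    by rewrite big_nat prodr_ge0 // => j /andP[j0 _]; rewrite invr_ge0 ltW // factor_gt0.
  rewrite invf_ge1 ?factor_gt0 //.
  by have /andP[_ /ltW] := @factor_bounds m.+1 isT.
have u_cvg : cvgn u.
  apply: nondecreasing_is_cvgn => //; exists 4 => _ [m _ <-].
  rewrite /u prodfV invf_ple ?posrE //.
    by apply: le_trans (prod_factor_ge m); lra.
  by apply: lt_le_trans (prod_factor_ge m); lra.
by rewrite -u0; apply: nondecreasing_cvgn_le.
Qed.

End Constants.

Theorem theorem1p3 (R : realType) (p : nat) (p_pr : prime p) (d n : nat)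
    (hdn : (3 <= n /\ 6 <= d)%N \/ (10 <= n /\ 5 <= d)%N) :
  let ratio : R := #|orbits_A d n p_pr|%:R / #|orbits_C d n p_pr|%:R in
  let rk (i : nat) : R := (lower_p_rank d p_pr i)%:R in
  1 <= ratio /\
  ratio <= 1 + theta_sum (p%:R : R) ^+ n.-1 * euler_prod (p%:R : R) ^+ n.-2
               * p%:R `^ (rk n.-1 - rk n / 4%:R + d%:R ^+ 2).
Proof.
move=> ratio rk.
have C_gt0 : 0 < (#|orbits_C d n p_pr|%:R : R).
  by rewrite ltr0n orbits_C_gt0.
have CA := orbits_C_le_A p_pr hdn.
split; first by rewrite ler_pdivlMr // mul1r ler_nat.
have p_ge2 : 2 <= p%:R :> R by rewrite ler_nat prime_gt1.
have p_gt0 : 0 < p%:R :> R by rewrite ltr0n prime_gt0.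
have key : ratio - 1 <= p%:R `^ (rk n.-1 - rk n / 4%:R + d%:R ^+ 2).
  rewrite -(ler_pM2r C_gt0) mulrBl mul1r divfK ?gt_eqF // -natrB //.
  set e := ((lower_p_rank d p_pr n + 3) %/ 4)%N.
  have pe_gt0 : 0 < (p%:R ^+ e : R) by rewrite exprn_gt0.
  rewrite -(ler_pM2r pe_gt0) -natrX -natrM.
  apply: le_trans (_ : (p ^ (lower_p_rank d p_pr n.-1 + d * d)
                        * #|orbits_C d n p_pr|)%:R <= _).
    by rewrite ler_nat; apply: card_orbits_diff.
  rewrite mulrAC natrM ler_pM2r // !natrX -!(@powR_mulrn _ p%:R) ?(ltW p_gt0) //.
  rewrite -powRD; last first.
    by rewrite (gt_eqF p_gt0) implybT.
  apply: ler_powR; first by rewrite ler1n prime_gt0.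
  rewrite natrD natrM expr2 addrAC lerD2r -addrA lerDl addrC subr_ge0.
  by rewrite ler_pdivrMr // -natrM ler_nat /e; lia.
rewrite -lerBlDl; apply: le_trans key _; rewrite ler_peMl ?powR_ge0 //.
have C_ge1 := theta_sum_ge1 p_ge2; have D_ge1 := euler_prod_ge1 p_ge2.
by rewrite mulr_ege1 // exprn_ege1.
Qed.
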